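(* Let $(R,\mathfrak m)$ be a Noetherian local ring with residue field $k=R/\mathfrak m$, and let $I\subsetneq R$ be a cohomologically complete intersection ideal with $c=\operatorname{grade} I$. Let $X$ be an arbitrary $R$-module. Then for all $i\in\mathbb Z$ there are the following functorial isomorphisms: (a) $\operatorname{Tor}^R_{c-i}(X,H^c_I(R))\cong H^i_I(X)$; (b) $\operatorname{Ext}_R^{c-i}\bigl(X,\operatorname{Hom}_R(H^c_I(R),E_R(k))\bigr)\cong \operatorname{Hom}_R\bigl(H^i_I(X),E_R(k)\bigr)$.
   Context: An ideal $I$ of $R$ is called a cohomologically complete intersection if there is an integer $c$ such that $H^i_I(R)=0$ for all $i\neq c$ (then $c=\operatorname{grade} I$). $H^i_I$ denotes local cohomology with support in $I$, and $E_R(k)$ is an injective hull of $k$. $\operatorname{Tor}$, $\operatorname{Ext}$ and local cohomology in negative degrees are zero. ''Functorial'' means natural in the $R$-module $X$. *)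

(* Defs.v *)
From HB Require Import structures.
From mathcomp Require Import all_boot all_order all_algebra.
From mathcomp Require Import boolp classical_sets functions.
From mathcomp Require Import finmap.
From mathcomp.multinomials Require Import monalg.

Set Implicit Arguments.
Unset Strict Implicit.
Unset Printing Implicit Defensive.

Import Order.TTheory GRing.Theory Num.Theory.
Local Open Scope ring_scope.
Local Open Scope quotient_scope.
Local Open Scope classical_set_scope.

Section LinearMaps.
Variables (R : comNzRingType) (A B C : lmodType R).

Definition mklin (f : A -> B) (hf : linear f) : {linear A -> B} :=
  HB.pack f (GRing.isLinear.Build R A B *:%R f hf).

Lemma mklinE f (hf : linear f) x : mklin hf x = f x.
Proof. by []. Qed.

Definition lcomp (g : {linear B -> C}) (f : {linear A -> B}) : {linear A -> C} :=
  g \o f.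

Lemma lin_eqP (f g : {linear A -> B}) : f = g <-> (f =1 g).
Proof.
split=> [-> //|]; case: f => f [[mf] [lf]]; case: g => g [[mg] [lg]] /= h.
have e : f = g by apply/funext.
subst g; rewrite (Prop_irrelevance mf mg) (Prop_irrelevance lf lg) //.
Qed.
End LinearMaps.

Section Submodules.
Variables (R : comNzRingType) (V : lmodType R).

Record submod := Submod {
  smset :> V -> Prop;
  sm0 : smset 0;
  smP : forall a u v, smset u -> smset v -> smset (a *: u + v) }.

Definition smem (W : submod) : {pred V} := fun x => `[< smset W x >].

Lemma smemE (W : submod) x : (x \in smem W) = `[< smset W x >].
Proof. by []. Qed.

Lemma smem_closed W : submod_closed (smem W).
Proof.
split=> [|a u v /asboolP hu /asboolP hv]; apply/asboolP; first exact: sm0.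
exact: smP.
Qed.

HB.instance Definition _ W := GRing.isSubmodClosed.Build R V (smem W)
  (smem_closed W).

Record subm (W : submod) := Subm { submv : V; _ : submv \in smem W }.
HB.instance Definition _ W := [isSub for @submv W].
HB.instance Definition _ W := [Choice of subm W by <:].
HB.instance Definition _ W := [SubChoice_isSubLmodule of subm W by <:].

Lemma submP W (x : subm W) : W (val x).
Proof. by case: x => x hx /=; apply/asboolP. Qed.

Definition mksub (W : submod) x (hx : W x) : subm W := Subm (asboolT hx).

(* The quotient module V/W: the library's quotient group V/W, to which the
   scalar multiplication is added. *)
Definition quotm (W : submod) : Type := Quotient.quot (smem W).
HB.instance Definition _ W := GRing.Zmodule.on (quotm W).

Definition qproj (W : submod) (x : V) : quotm W := \pi_(Quotient.quot (smem W)) x.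

Lemma qprojP W x y : qproj W x = qproj W y <-> W (x - y).
Proof.
rewrite /qproj; split=> [/eqP|h].
  by rewrite -Quotient.idealrBE => /asboolP.
by apply/eqP; rewrite -Quotient.idealrBE; apply/asboolP.
Qed.

Lemma qproj_surj W q : exists x, qproj W x = q.
Proof. by exists (repr q); rewrite /qproj reprK. Qed.

Lemma qprojD W x y : qproj W (x + y) = qproj W x + qproj W y.
Proof. by rewrite /qproj raddfD. Qed.

Definition qscale W (a : R) (q : quotm W) : quotm W :=
  qproj W (a *: (repr q : V)).

Lemma qscale_proj W a x : qscale a (qproj W x) = qproj W (a *: x).
Proof.
apply/qprojP; rewrite -scalerBr -[_ *: _]addr0; apply: smP; last exact: sm0.
by apply/qprojP; rewrite /qproj reprK.
Qed.

Fact qscaleA W a b (q : quotm W) : qscale a (qscale b q) = qscale (a * b) q.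
Proof. by have [x <-] := qproj_surj q; rewrite !qscale_proj scalerA. Qed.
Fact qscale1 W : left_id 1 (@qscale W).
Proof. by move=> q; have [x <-] := qproj_surj q; rewrite qscale_proj scale1r. Qed.
Fact qscaleDr W : right_distributive (@qscale W) +%R.
Proof.
move=> a q r; have [x <-] := qproj_surj q; have [y <-] := qproj_surj r.
by rewrite -qprojD !qscale_proj scalerDr qprojD.
Qed.
Fact qscaleDl W (q : quotm W) : {morph (@qscale W)^~ q : a b / a + b}.
Proof.
by move=> a b; have [x <-] := qproj_surj q; rewrite !qscale_proj scalerDl qprojD.
Qed.
HB.instance Definition _ W := GRing.Zmodule_isLmodule.Build R (quotm W)
  (@qscaleA W) (@qscale1 W) (@qscaleDr W) (@qscaleDl W).

Fact qproj_linear W : linear (qproj W).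
Proof. by move=> a x y; rewrite qprojD -qscale_proj. Qed.
HB.instance Definition _ W :=
  GRing.isLinear.Build R V (quotm W) *:%R (qproj W) (@qproj_linear W).

Definition total_submod : submod :=
  @Submod (fun=> True) I (fun _ _ _ _ _ => I).

Fact zero_submodP (a : R) (u v : V) : u = 0 -> v = 0 -> a *: u + v = 0.
Proof. by move=> -> ->; rewrite scaler0 addr0. Qed.
Definition zero_submod : submod := @Submod (eq^~ 0) erefl zero_submodP.

Fact span0 (S : set V) (W : submod) : S `<=` W -> W 0.
Proof. by move=> _; exact: sm0. Qed.
Fact spanP (S : set V) (a : R) u v :
  (forall W : submod, S `<=` W -> W u) ->
  (forall W : submod, S `<=` W -> W v) ->
  forall W : submod, S `<=` W -> W (a *: u + v).
Proof. by move=> hu hv W h; apply: smP; [exact: hu|exact: hv]. Qed.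
(* The smallest submodule containing S. *)
Definition span (S : set V) : submod :=
  Submod (smset := fun x => forall W : submod, S `<=` W -> W x)
    (@span0 S) (@spanP S).

Lemma span_incl (S : set V) : S `<=` span S.
Proof. by move=> x Sx W; apply. Qed.
End Submodules.

Section KernelImage.
Variables (R : comNzRingType) (A B : lmodType R) (f : {linear A -> B}).

Fact kersmP (a : R) u v : f u = 0 -> f v = 0 -> f (a *: u + v) = 0.
Proof. by move=> hu hv; rewrite linearP hu hv scaler0 addr0. Qed.
Definition kersm : submod A :=
  Submod (smset := fun x => f x = 0) (linear0 f) kersmP.

Fact imsm0 : exists x, f x = 0.
Proof. by exists 0; rewrite linear0. Qed.
Fact imsmP (a : R) u v :
  (exists x, f x = u) -> (exists x, f x = v) -> exists x, f x = a *: u + v.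
Proof. by move=> [x <-] [y <-]; exists (a *: x + y); rewrite linearP. Qed.
Definition imsm : submod B :=
  Submod (smset := fun y => exists x, f x = y) imsm0 imsmP.

Variable W : submod B.
Fact presm0 : W (f 0).
Proof. by rewrite linear0; exact: sm0. Qed.
Fact presmP (a : R) u v : W (f u) -> W (f v) -> W (f (a *: u + v)).
Proof. by move=> hu hv; rewrite linearP; exact: smP. Qed.
Definition presm : submod A := Submod (smset := fun x => W (f x)) presm0 presmP.
End KernelImage.

Section InducedMaps.
Variables (R : comNzRingType) (A B : lmodType R).

Section Quotient.
Variables (W : submod A) (f : {linear A -> B}) (hf : forall x, W x -> f x = 0).
Definition qlift_fun (q : quotm W) : B := f (repr q).
Lemma qlift_funE x : qlift_fun (qproj W x) = f x.
Proof.
apply/eqP; rewrite -subr_eq0 -linearB; apply/eqP/hf/qprojP.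
by rewrite /qproj reprK.
Qed.
Fact qlift_linear : linear qlift_fun.
Proof.
move=> a q r; have [x <-] := qproj_surj q; have [y <-] := qproj_surj r.
by rewrite -linearP !qlift_funE linearP.
Qed.
Definition qlift : {linear quotm W -> B} := mklin qlift_linear.
Lemma qliftE x : qlift (qproj W x) = f x.
Proof. exact: qlift_funE. Qed.
End Quotient.

Section Corestriction.
Variables (W : submod B) (f : {linear A -> B}) (hf : forall x, W (f x)).
Fact corestr_linear : linear (fun x => mksub (hf x)).
Proof. by move=> a x y; apply: val_inj; rewrite /= linearP. Qed.
Definition corestr : {linear A -> subm W} := mklin corestr_linear.
Lemma corestrE x : val (corestr x) = f x.
Proof. by []. Qed.
End Corestriction.
End InducedMaps.

Definition subincl (R : comNzRingType) (V : lmodType R) (W : submod V) :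
  {linear subm W -> V} := \val.

Section InducedMaps2.
Variables (R : comNzRingType) (A B : lmodType R).

Section Restriction.
Variables (U : submod A) (W : submod B) (f : {linear A -> B}).
Variable hf : forall x, U x -> W (f x).

Fact restr_in (x : subm U) : W (f (val x)).
Proof. exact/hf/submP. Qed.
Definition restr : {linear subm U -> subm W} :=
  corestr (f := lcomp f (subincl U)) restr_in.
Lemma restrE x : val (restr x) = f (val x).
Proof. by []. Qed.
End Restriction.

Section QuotientMap.
Variables (U : submod A) (W : submod B) (f : {linear A -> B}).
Variable hf : forall x, U x -> W (f x).

Fact qmap_zero x : U x -> lcomp (qproj W) f x = 0.
Proof.
by move=> /hf h; rewrite -(linear0 (qproj W)); apply/qprojP; rewrite subr0.
Qed.
Definition qmap : {linear quotm U -> quotm W} := qlift qmap_zero.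
Lemma qmapE x : qmap (qproj U x) = qproj W (f x).
Proof. exact: qliftE. Qed.
End QuotientMap.
End InducedMaps2.

Section Hom.
Variables (R : comNzRingType) (A B : lmodType R).

Definition lhom : Type := {linear A -> B}.
Identity Coercion hom_linear : lhom >-> GRing.Linear.type.
HB.instance Definition _ := gen_eqMixin lhom.
HB.instance Definition _ := gen_choiceMixin lhom.

Implicit Types f g : lhom.
Lemma homP f g : (forall x, f x = g x) -> f = g.
Proof. by move=> h; apply/lin_eqP. Qed.

Fact hom_add_linear f g : linear (fun x => f x + g x).
Proof. by move=> a x y; rewrite !linearP scalerDr addrACA. Qed.
Fact hom_opp_linear f : linear (fun x => - f x).
Proof. by move=> a x y; rewrite linearP opprD scalerN. Qed.
Fact hom_zero_linear : linear (fun _ : A => 0 : B).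
Proof. by move=> a x y; rewrite scaler0 addr0. Qed.
Fact hom_scale_linear (c : R) f : linear (fun x => c *: f x).
Proof. by move=> a x y; rewrite linearP scalerDr !scalerA mulrC. Qed.

Definition hom_add f g : lhom := mklin (hom_add_linear f g).
Definition hom_opp f : lhom := mklin (hom_opp_linear f).
Definition hom_zero : lhom := mklin hom_zero_linear.
Definition hom_scale c f : lhom := mklin (hom_scale_linear c f).

Fact hom_addA : associative hom_add.
Proof. by move=> f g h; apply: homP => x /=; rewrite addrA. Qed.
Fact hom_addC : commutative hom_add.
Proof. by move=> f g; apply: homP => x /=; rewrite addrC. Qed.
Fact hom_add0 : left_id hom_zero hom_add.
Proof. by move=> f; apply: homP => x /=; rewrite add0r. Qed.
Fact hom_addN : left_inverse hom_zero hom_opp hom_add.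
Proof. by move=> f; apply: homP => x /=; rewrite addNr. Qed.
HB.instance Definition _ :=
  GRing.isZmodule.Build lhom hom_addA hom_addC hom_add0 hom_addN.

Fact hom_scaleA a b f : hom_scale a (hom_scale b f) = hom_scale (a * b) f.
Proof. by apply: homP => x /=; rewrite scalerA. Qed.
Fact hom_scale1 : left_id 1 hom_scale.
Proof. by move=> f; apply: homP => x /=; rewrite scale1r. Qed.
Fact hom_scaleDr : right_distributive hom_scale +%R.
Proof. by move=> a f g; apply: homP => x /=; rewrite scalerDr. Qed.
Fact hom_scaleDl f : {morph hom_scale^~ f : a b / a + b}.
Proof. by move=> a b; apply: homP => x /=; rewrite scalerDl. Qed.
HB.instance Definition _ := GRing.Zmodule_isLmodule.Build R lhom
  hom_scaleA hom_scale1 hom_scaleDr hom_scaleDl.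

Lemma homDE f g x : (f + g : lhom) x = f x + g x. Proof. by []. Qed.
Lemma homZE a f x : (a *: f : lhom) x = a *: f x. Proof. by []. Qed.
Lemma hom0E x : (0 : lhom) x = 0. Proof. by []. Qed.
End Hom.

Section HomPre.
Variables (R : comNzRingType) (A B N : lmodType R) (f : {linear A -> B}).
Fact hompre_linear : linear (fun g : lhom B N => lcomp g f : lhom A N).
Proof. by move=> a g h; apply: homP. Qed.
Definition hompre : {linear lhom B N -> lhom A N} := mklin hompre_linear.
Lemma hompreE g x : hompre g x = g (f x).
Proof. by []. Qed.
End HomPre.

Section Free.
Variables (R : comNzRingType) (T : choiceType) (V : lmodType R) (F : T -> V).
Definition free_lift_fun (g : {malg R[T]}) : V :=
  \sum_(t <- msupp g) g@_t *: F t.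
Lemma free_liftw (g : {malg R[T]}) (d : {fset T}) : (msupp g `<=` d)%fset ->
  free_lift_fun g = \sum_(t <- d) g@_t *: F t.
Proof.
move=> le; rewrite /free_lift_fun (big_fset_incl _ le) //.
by move=> t _ /mcoeff_outdom ->; rewrite scale0r.
Qed.
Fact free_lift_linear : linear free_lift_fun.
Proof.
move=> a g h; pose d := (msupp g `|` msupp h `|` msupp (a *: g + h))%fset.
have hg : (msupp g `<=` d)%fset by rewrite /d -fsetUA fsubsetUl.
have hh : (msupp h `<=` d)%fset by rewrite /d [(msupp g `|` _)%fset]fsetUC -fsetUA fsubsetUl.
have hgh : (msupp (a *: g + h) `<=` d)%fset by rewrite fsubsetUr.
rewrite (free_liftw hg) (free_liftw hh) (free_liftw hgh) scaler_sumr -big_split.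
by apply: eq_bigr => t _ /=; rewrite mcoeffD mcoeffZ scalerDl scalerA.
Qed.
Definition free_lift : {linear {malg R[T]} -> V} := mklin free_lift_linear.
Lemma free_liftE t : free_lift << t >> = F t.
Proof.
by rewrite /= /free_lift_fun msuppU oner_eq0 big_seq_fset1 mcoeffUU scale1r.
Qed.
Lemma free_ext (f g : {linear {malg R[T]} -> V}) :
  (forall t, f << t >> = g << t >>) -> f =1 g.
Proof.
move=> h x; rewrite (monalgE x) !linear_sum; apply: eq_bigr => t _.
have -> : << x@_t *g t >> = x@_t *: << t >> :> {malg R[T]}.
  by apply/malgP => k; rewrite mcoeffZ !mcoeffU mulr_natr.
by rewrite !linearZ h.
Qed.
End Free.

Section Tensor.
Variables (R : comNzRingType) (A M : lmodType R).

Definition tensor_rel : set {malg R[(A * M)%type]} :=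
  [set t | (exists a x y m,
              t = << (a *: x + y, m) >> - (a *: << (x, m) >> + << (y, m) >>))
        \/ (exists a x m n,
              t = << (x, a *: m + n) >> - (a *: << (x, m) >> + << (x, n) >>))].

Definition tensor : lmodType R := quotm (span tensor_rel).

Definition tens (x : A) (m : M) : tensor := qproj _ << (x, m) >>.

Lemma tensPl a x y m : tens (a *: x + y) m = a *: tens x m + tens y m.
Proof.
rewrite -linearP; apply/qprojP/span_incl; left.
by exists a, x, y, m.
Qed.
Lemma tensPr a x m n : tens x (a *: m + n) = a *: tens x m + tens x n.
Proof.
rewrite -linearP; apply/qprojP/span_incl; right.
by exists a, x, m, n.
Qed.
Lemma tens0 m : tens 0 m = 0.
Proof.
by have := tensPl 1 0 0 m; rewrite scaler0 addr0 scale1r -{1}[tens 0 m]addr0 => /addrI.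
Qed.

Section Lift.
Variables (C : lmodType R) (b : A -> M -> C).
Hypothesis bl : forall m, linear (b^~ m).
Hypothesis br : forall x, linear (b x).
Fact tlift_zero (t : {malg R[(A * M)%type]}) :
  span tensor_rel t -> free_lift (fun p => b p.1 p.2) t = 0.
Proof.
move/(_ (kersm (free_lift (fun p => b p.1 p.2)))); apply=> {}t.
case=> [[a [x [y [m ->]]]]|[a [x [m [n ->]]]]];
  rewrite /smset; cbn -[free_lift]; rewrite linearB linearP !free_liftE /=.
  by rewrite bl subrr.
by rewrite br subrr.
Qed.
Definition tlift : {linear tensor -> C} := qlift tlift_zero.
Lemma tliftE x m : tlift (tens x m) = b x m.
Proof. by rewrite /tlift qliftE free_liftE. Qed.
End Lift.

Lemma tens_ext (C : lmodType R) (f g : {linear tensor -> C}) :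
  (forall x m, f (tens x m) = g (tens x m)) -> f =1 g.
Proof.
move=> h q; have [t <-] := qproj_surj q.
by apply: (@free_ext _ _ _ (lcomp f (qproj _)) (lcomp g (qproj _))) => -[x m]; exact: h.
Qed.
End Tensor.

Section TensorMap.
Variables (R : comNzRingType) (A B M : lmodType R) (f : {linear A -> B}).
Fact tmap_l (m : M) : linear (fun x => tens (f x) m).
Proof. by move=> a x y; rewrite linearP tensPl. Qed.
Fact tmap_r (x : A) : linear (fun m : M => tens (f x) m).
Proof. by move=> a m n; rewrite tensPr. Qed.
Definition tmap : {linear tensor A M -> tensor B M} := tlift tmap_l tmap_r.
Lemma tmapE x m : tmap (tens x m) = tens (f x) m.
Proof. exact: tliftE. Qed.
End TensorMap.

(* Complexes are indexed by nat and understood to be zero in negative degrees;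
   their (co)homology is indexed by int. *)

Section Complexes.
Variable R : comNzRingType.

Record chain := Chain {
  chain_ob :> nat -> lmodType R;
  chain_d : forall n, {linear chain_ob n.+1 -> chain_ob n};
  chain_dd : forall n x, chain_d n (chain_d n.+1 x) = 0 }.

Record cochain := Cochain {
  cochain_ob :> nat -> lmodType R;
  cochain_d : forall n, {linear cochain_ob n -> cochain_ob n.+1};
  cochain_dd : forall n x, cochain_d n.+1 (cochain_d n x) = 0 }.

Record chain_map (C D : chain) := ChainMap {
  chain_f :> forall n, {linear C n -> D n};
  chain_fd : forall n x, chain_f n (chain_d C n x) = chain_d D n (chain_f n.+1 x) }.

Record cochain_map (C D : cochain) := CochainMap {
  cochain_f :> forall n, {linear C n -> D n};
  cochain_fd : forall n x,
    cochain_f n.+1 (cochain_d C n x) = cochain_d D n (cochain_f n x) }.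

Definition cycles (C : chain) n : submod (C n) :=
  if n is m.+1 return submod (C n) then kersm (chain_d C m) else total_submod _.
Definition boundaries (C : chain) n : submod (C n) := imsm (chain_d C n).

Definition cocycles (C : cochain) n : submod (C n) := kersm (cochain_d C n).
Definition coboundaries (C : cochain) n : submod (C n) :=
  if n is m.+1 return submod (C n) then imsm (cochain_d C m) else zero_submod _.

Definition zero_module : lmodType R := 'rV[R]_0.

Definition homology (C : chain) (i : int) : lmodType R :=
  match i with
  | Posz n => quotm (presm (subincl (cycles C n)) (boundaries C n))
  | Negz _ => zero_module
  end.

Definition cohomology (C : cochain) (i : int) : lmodType R :=
  match i with
  | Posz n => quotm (presm (subincl (cocycles C n)) (coboundaries C n))
  | Negz _ => zero_module
  end.

Section ChainMaps.
Variables (C D : chain) (f : chain_map C D).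
Fact cycles_map n x : cycles C n x -> cycles D n (f n x).
Proof. by case: n x => [//|n] x /= hx; rewrite -chain_fd hx linear0. Qed.
Fact boundaries_map n (z : subm (cycles C n)) :
  presm (subincl _) (boundaries C n) z ->
  presm (subincl _) (boundaries D n) (restr (@cycles_map n) z).
Proof. by case=> y /= hy; exists (f n.+1 y); rewrite -chain_fd hy. Qed.
Definition homology_map (i : int) : {linear homology C i -> homology D i} :=
  match i with
  | Posz n => qmap (@boundaries_map n)
  | Negz _ => idfun
  end.
End ChainMaps.

Section CochainMaps.
Variables (C D : cochain) (f : cochain_map C D).
Fact cocycles_map n x : cocycles C n x -> cocycles D n (f n x).
Proof. by move=> /= hx; rewrite -cochain_fd hx linear0. Qed.
Fact coboundaries_map n (z : subm (cocycles C n)) :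
  presm (subincl _) (coboundaries C n) z ->
  presm (subincl _) (coboundaries D n) (restr (@cocycles_map n) z).
Proof.
case: n z => [|n] z /=; first by move=> ->; rewrite linear0.
by case=> y /= hy; exists (f n y); rewrite -cochain_fd hy.
Qed.
Definition cohomology_map (i : int) : {linear cohomology C i -> cohomology D i} :=
  match i with
  | Posz n => qmap (@coboundaries_map n)
  | Negz _ => idfun
  end.
End CochainMaps.

Section TensorComplex.
Variable M : lmodType R.
Fact tens_chain_dd (C : chain) n (t : tensor (C n.+2) M) :
  tmap M (chain_d C n) (tmap M (chain_d C n.+1) t) = 0.
Proof.
pose f : {linear tensor (C n.+2) M -> tensor (C n) M} :=
  lcomp (tmap M (chain_d C n)) (tmap M (chain_d C n.+1)).
apply: (@tens_ext _ _ _ _ f (hom_zero _ _)) => x m.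
transitivity (tmap M (chain_d C n) (tmap M (chain_d C n.+1) (tens x m))) => //.
by rewrite !tmapE chain_dd tens0.
Qed.
Definition tens_chain (C : chain) : chain :=
  Chain (chain_ob := fun n => tensor (C n) M) (@tens_chain_dd C).

Variables (C D : chain) (f : chain_map C D).
Fact tens_chain_fd n (t : tensor (C n.+1) M) :
  tmap M (f n) (tmap M (chain_d C n) t) = tmap M (chain_d D n) (tmap M (f n.+1) t).
Proof.
apply: (@tens_ext _ _ _ _ (lcomp (tmap M (f n)) (tmap M (chain_d C n)))
  (lcomp (tmap M (chain_d D n)) (tmap M (f n.+1)))) => x m.
transitivity (tmap M (f n) (tmap M (chain_d C n) (tens x m))) => //.
rewrite !tmapE chain_fd -!tmapE //.
Qed.
Definition tens_chain_map : chain_map (tens_chain C) (tens_chain D) :=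
  @ChainMap (tens_chain C) (tens_chain D) (fun n => tmap M (f n)) tens_chain_fd.
End TensorComplex.

Section HomComplex.
Variable N : lmodType R.
Fact hom_cochain_dd (C : chain) n (g : lhom (C n) N) :
  hompre N (chain_d C n.+1) (hompre N (chain_d C n) g) = 0.
Proof. by apply: homP => x; rewrite !hompreE chain_dd linear0. Qed.
Definition hom_cochain (C : chain) : cochain :=
  Cochain (cochain_ob := fun n => lhom (C n) N) (@hom_cochain_dd C).

Variables (C D : chain) (f : chain_map C D).
Fact hom_cochain_fd n (g : lhom (D n) N) :
  hompre N (f n.+1) (hompre N (chain_d D n) g) =
  hompre N (chain_d C n) (hompre N (f n) g).
Proof. by apply: homP => x; rewrite !hompreE chain_fd. Qed.
Definition hom_cochain_map : cochain_map (hom_cochain D) (hom_cochain C) :=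
  @CochainMap (hom_cochain D) (hom_cochain C) (fun n => hompre N (f n))
    hom_cochain_fd.
End HomComplex.
End Complexes.

Section Resolutions.
Variable R : comNzRingType.

Definition projective (P : lmodType R) :=
  forall (A B : lmodType R) (p : {linear A -> B}) (g : {linear P -> B}),
  (forall y, exists x, p x = y) ->
  exists h : {linear P -> A}, forall x, p (h x) = g x.

Definition injective_module (E : lmodType R) :=
  forall (A B : lmodType R) (j : {linear A -> B}) (g : {linear A -> E}),
  injective j ->
  exists h : {linear B -> E}, forall x, h (j x) = g x.

Record proj_resolution (X : lmodType R) := ProjResolution {
  pres :> chain R;
  paug : {linear pres 0%N -> X};
  pres_proj : forall n, projective (pres n);
  paug_surj : forall x, exists y, paug y = x;
  pres_exact0 : forall y, paug y = 0 <-> boundaries pres 0 y;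
  pres_exact : forall n y, cycles pres n.+1 y <-> boundaries pres n.+1 y }.

Record inj_resolution (X : lmodType R) := InjResolution {
  ires :> cochain R;
  icoaug : {linear X -> ires 0%N};
  ires_inj : forall n, injective_module (ires n);
  icoaug_inj : injective icoaug;
  ires_exact0 : forall y, cocycles ires 0 y <-> (exists x, icoaug x = y);
  ires_exact : forall n y, cocycles ires n.+1 y <-> coboundaries ires n.+1 y }.

Lemma projective_lift (P A B : lmodType R) (p : {linear A -> B})
    (g : {linear P -> B}) : projective P ->
  (forall x, exists y, p y = g x) ->
  exists h : {linear P -> A}, forall x, p (h x) = g x.
Proof.
move=> hP hg; pose I := imsm p.
have pI x : I (p x) by exists x.
have [|h hh] := hP A (subm I) (corestr pI) (corestr (W := I) hg).
  by move=> y; have [x hx] := submP y; exists x; apply: val_inj.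
by exists h => x; have /(congr1 val) := hh x.
Qed.

Lemma injective_lift (E A B : lmodType R) (j : {linear A -> B})
    (g : {linear A -> E}) : injective_module E ->
  (forall x, j x = 0 -> g x = 0) ->
  exists h : {linear B -> E}, forall x, h (j x) = g x.
Proof.
move=> hE hg; pose K := kersm j.
have jK x : K x -> j x = 0 by [].
have gK x : K x -> g x = 0 by exact: hg.
have [|h hh] := hE (quotm K) B (qlift jK) (qlift gK).
  move=> q r; have [x <-] := qproj_surj q; have [y <-] := qproj_surj r.
  rewrite !qliftE => e; apply/qprojP.
  by change (j (x - y) = 0); rewrite linearB e subrr.
by exists h => x; have := hh (qproj K x); rewrite !qliftE.
Qed.

Lemma nat_rec_choice (T : nat -> Type) (S : forall n, T n -> T n.+1 -> Prop)
    (good : forall n, T n -> Prop) (t0 : T 0%N) :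
  good 0%N t0 ->
  (forall n t, good n t -> exists u, S n t u /\ good n.+1 u) ->
  exists t : forall n, T n, t 0%N = t0 /\ forall n, S n (t n) (t n.+1).
Proof.
move=> h0 hS; pose ST n := {t : T n | good n t}.
have step n (t : ST n) : {u : ST n.+1 | S n (sval t) (sval u)}.
  case: t => t ht; have /cid [u [hu gu]] := hS n t ht.
  by exists (exist _ u gu).
pose s := fix s n : ST n :=
  if n is m.+1 return ST n then sval (step m (s m)) else exist _ t0 h0.
exists (fun n => sval (s n)); split=> // n.
exact: (svalP (step n (s n))).
Qed.

Lemma proj_lift_exists (X Y : lmodType R) (P : proj_resolution X)
    (Q : proj_resolution Y) (f : {linear X -> Y}) :
  exists g : chain_map P Q, forall x, paug Q (g 0%N x) = f (paug P x).
Proof.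
have [g0 hg0] : exists g0 : {linear P 0%N -> Q 0%N},
    forall x, paug Q (g0 x) = f (paug P x).
  apply: (@projective_lift _ _ _ _ (lcomp f (paug P))); first exact: pres_proj.
  by move=> x; exact: paug_surj.
pose S n (t : {linear P n -> Q n}) (u : {linear P n.+1 -> Q n.+1}) :=
  forall x, t (chain_d P n x) = chain_d Q n (u x).
pose good n (t : {linear P n -> Q n}) :=
  forall x, exists y, chain_d Q n y = t (chain_d P n x).
have h0 : good 0%N g0.
  move=> x; apply/pres_exact0; rewrite hg0.
  have /pres_exact0 -> : boundaries P 0 (chain_d P 0 x) by exists x.
  by rewrite linear0.
have [|g [e hg]] := @nat_rec_choice _ S good g0 h0.
  move=> n t ht.
  have [u hu] : exists u : {linear P n.+1 -> Q n.+1},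
      forall x, chain_d Q n (u x) = t (chain_d P n x).
    apply: (@projective_lift _ _ _ _ (lcomp t (chain_d P n))) => //.
    exact: pres_proj.
  exists u; split=> x; first by rewrite hu.
  apply/pres_exact; change (chain_d Q n (u (chain_d P n.+1 x)) = 0).
  by rewrite hu chain_dd linear0.
exists (@ChainMap _ P Q g hg) => x /=.
by rewrite e hg0.
Qed.

Lemma inj_lift_exists (X Y : lmodType R) (I : inj_resolution X)
    (J : inj_resolution Y) (f : {linear X -> Y}) :
  exists g : cochain_map I J, forall x, g 0%N (icoaug I x) = icoaug J (f x).
Proof.
have [g0 hg0] : exists g0 : {linear I 0%N -> J 0%N},
    forall x, g0 (icoaug I x) = icoaug J (f x).
  apply: (@injective_lift _ _ _ _ (lcomp (icoaug J) f)); first exact: ires_inj.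
  move=> x; rewrite -(linear0 (icoaug I)) => /icoaug_inj ->.
  by rewrite linear0.
pose S n (t : {linear I n -> J n}) (u : {linear I n.+1 -> J n.+1}) :=
  forall x, u (cochain_d I n x) = cochain_d J n (t x).
pose good n (t : {linear I n -> J n}) :=
  forall x, cochain_d I n x = 0 -> cochain_d J n (t x) = 0.
have h0 : good 0%N g0.
  move=> x /ires_exact0 [y <-]; rewrite hg0.
  by apply/(ires_exact0 (i := J)); exists (f y).
have [|g [e hg]] := @nat_rec_choice _ S good g0 h0.
  move=> n t ht.
  have [u hu] : exists u : {linear I n.+1 -> J n.+1},
      forall x, u (cochain_d I n x) = cochain_d J n (t x).
    apply: (@injective_lift _ _ _ _ (lcomp (cochain_d J n) t)) => //.
    exact: ires_inj.
  exists u; split=> // x /ires_exact [y <-].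
  by rewrite hu cochain_dd.
by exists (@CochainMap _ I J g hg) => x /=; rewrite e hg0.
Qed.

(* Every module is a quotient of a free module, hence has a projective
   resolution. *)

Lemma free_projective (T : choiceType) : projective {malg R[T]}.
Proof.
move=> A B p g hp.
pose F t : A := sval (cid (hp (g << t >>))).
exists (free_lift F) => x.
apply: (@free_ext _ _ _ (lcomp p (free_lift F)) g) => t.
transitivity (p (free_lift F << t >>)) => //.
by rewrite free_liftE /F; case: cid.
Qed.

Definition syzygy (X : lmodType R) : lmodType R :=
  subm (kersm (free_lift (@id X))).

Lemma proj_resolution_exists (X : lmodType R) : exists _ : proj_resolution X, True.
Proof.
pose Z := fix Z n : lmodType R := if n is m.+1 then syzygy (Z m) else X.
pose F n : lmodType R := {malg R[Z n]}.
pose eps n : {linear F n -> Z n} := free_lift (@id (Z n)).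
pose d n : {linear F n.+1 -> F n} := lcomp (subincl _) (eps n.+1).
have dE n x : d n x = val (eps n.+1 x) by [].
have eps_surj n y : exists x, eps n x = y by exists << y >>; rewrite /eps free_liftE.
have eps0 n y : eps n y = 0 <-> exists x, d n x = y.
  split=> [h|[x <-]]; last exact: (submP (eps n.+1 x)).
  have [x hx] := eps_surj n.+1 (@mksub _ _ (kersm (eps n)) y h).
  by exists x; rewrite dE hx.
have d0 n y : d n y = 0 <-> eps n.+1 y = 0.
  by rewrite dE; split=> [h|->]; [exact: val_inj|].
have dd n x : d n (d n.+1 x) = 0 by apply/d0/eps0; exists x.
unshelve eexists=> //; apply: (@ProjResolution X (Chain dd) (eps 0%N)).
- by move=> n; exact: free_projective.
- exact: (eps_surj 0%N).
- exact: (eps0 0%N).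
- by move=> n y; split=> [/d0/eps0//|/eps0/d0].
Qed.

End Resolutions.

(* Every module embeds into an injective module, namely a power of
   Hom_Z(R, Q/Z), hence has an injective resolution. *)

Definition ratint : {pred rat} := fun x => x \is a Num.int.
Fact ratint_zmod : zmod_closed ratint.
Proof. by split=> [|x y]; [exact: rpred0|exact: rpredB]. Qed.
HB.instance Definition _ := GRing.isZmodClosed.Build rat ratint ratint_zmod.

Definition QZ : zmodType := Quotient.quot ratint.
Definition qz (x : rat) : QZ := \pi_(Quotient.quot ratint) x.

Lemma qz_eq0 x : qz x = 0 <-> x \is a Num.int.
Proof.
have -> : (x \is a Num.int) = (x - 0 \in ratint) by rewrite subr0.
rewrite Quotient.idealrBE raddf0.
by split=> [h|/eqP]; [apply/eqP|].
Qed.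

Lemma qzMz x (n : int) : qz x *~ n = qz (x *~ n).
Proof. by rewrite /qz raddfMz. Qed.

Lemma qz_div (q : QZ) (n : int) : n != 0 -> exists r, r *~ n = q.
Proof.
move=> n0; exists (qz (repr q / n%:~R)).
by rewrite qzMz -mulrzr divfK ?intr_eq0 // /qz reprK.
Qed.

Lemma mulrz_rem (V : zmodType) (b : V) (n q m r : int) :
  n = q * m + r -> b *~ r = b *~ n - b *~ m *~ q.
Proof. by move=> ->; rewrite -mulrzA [m * q]mulrC mulrzDr addrAC subrr add0r. Qed.

Section Extension.
Variable B : zmodType.

(* Graphs of additive maps from a subgroup of B to Q/Z. *)
Definition pgraph (G : set (B * QZ)) :=
  [/\ G (0, 0), forall p q, G p -> G q -> G (p.1 - q.1, p.2 - q.2)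
    & forall q, G (0, q) -> q = 0].

Lemma pgraphMz G p (n : int) : pgraph G -> G p -> G (p.1 *~ n, p.2 *~ n).
Proof.
move=> [G0 GB _] Gp.
have GN x y : G (x, y) -> G (- x, - y).
  by move=> h; have := GB _ _ G0 h; rewrite /= !sub0r.
have Gn (k : nat) : G (p.1 *+ k, p.2 *+ k).
  elim: k => [|k ih]; first by rewrite !mulr0n.
  have := GB _ _ Gp (GN _ _ ih).
  by rewrite /= !opprK !mulrS.
by case: n => k; rewrite ?NegzE ?mulrNz; [exact: Gn|apply: GN; exact: Gn].
Qed.

Lemma pgraphD G p q : pgraph G -> G p -> G q -> G (p.1 + q.1, p.2 + q.2).
Proof.
move=> hG Gp Gq; have [_ GB _] := hG; have := pgraphMz (-1) hG Gq.
by rewrite !mulrN1z => /(GB _ _ Gp) /=; rewrite !opprK.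
Qed.

Lemma pgraph_step G b : pgraph G -> exists q, pgraph
  [set p | exists x y n, G (x, y) /\ p = (x + b *~ n, y + q *~ n)].
Proof.
move=> hG; have [G0 GB GF] := hG.
suff [q hq] : exists q, forall (n : int) y, G (b *~ n, y) -> y = q *~ n.
  exists q; split.
  - by exists 0, 0, 0; rewrite !mulr0z !addr0.
  - move=> _ _ [x [y [n [h ->]]]] [x' [y' [n' [h' ->]]]] /=.
    exists (x - x'), (y - y'), (n - n'); split; first exact: (GB _ _ h h').
    by rewrite !mulrzBr; congr pair; rewrite opprD addrACA.
  - move=> q' [x [y [n [h [e ->]]]]].
    have := pgraphMz (-1) hG h; rewrite /= !mulrN1z => h'.
    have ex : b *~ n = - x by apply/eqP; rewrite -subr_eq0 opprK addrC -e.
    by rewrite -(hq n (- y)) ?subrr // ex.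
pose D (n : nat) := (0 < n)%N && `[< exists y, G (b *+ n, y) >].
have [[n0 Dn0]|noD] := pselect (exists n, D n); last first.
  exists 0 => n y Gy; rewrite mul0rz.
  have [n0|n0] := eqVneq n 0; first by apply: GF; rewrite n0 mulr0z in Gy.
  exfalso; apply: noD; exists `|n|%N; rewrite /D absz_gt0 n0 /=; apply/asboolP.
  case: n n0 Gy => k n0 Gy; first by exists y.
  by exists (- y); have := pgraphMz (-1) hG Gy; rewrite /= !mulrN1z NegzE mulrNz opprK.
have exD : exists n, D n by exists n0.
pose m := ex_minn exD.
have [/andP[m0 /asboolP[y0 Gy0]] mmin] : D m /\ forall n, D n -> (m <= n)%N.
  by rewrite /m; case: ex_minnP.
have [q qm] : exists q : QZ, q *~ m = y0 by apply: qz_div; rewrite -lt0n in m0 *; case: (m) m0.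
exists q => n y Gy.
pose r := (n %% m)%Z.
have rE : n = (n %/ m)%Z * m + r by exact: divz_eq.
have m0z : m%:Z != 0 by case: (m) m0.
have r0 : r = 0.
  have : 0 <= r by exact: modz_ge0.
  have : r < m by apply: ltz_pmod; rewrite ltz_nat.
  case: (r) rE => // [[//|k]] rE /= ltk _.
  have : D k.+1.
    rewrite /D /=; apply/asboolP; exists (y - y0 *~ (n %/ m)%Z).
    have := GB _ _ Gy (pgraphMz (n %/ m)%Z hG Gy0).
    by rewrite /= pmulrn -(mulrz_rem b rE) -pmulrn.
  by move=> /mmin; rewrite leqNgt -ltz_nat ltk.
rewrite r0 in rE.
have := GB _ _ Gy (pgraphMz (n %/ m)%Z hG Gy0).
rewrite /= pmulrn -(mulrz_rem b rE) mulr0z => /GF/eqP.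
by rewrite subr_eq0 => /eqP ->; rewrite -qm -mulrzA mulrC [in RHS]rE addr0.
Qed.

Lemma pgraph_extend G : pgraph G ->
  exists h : {additive B -> QZ}, forall p, G p -> h p.1 = p.2.
Proof.
move=> hG.
pose P := [set H : set (B * QZ) | pgraph (G `|` H)].
have [F FP tot|H [PH Hmax]] := @Zorn_bigcup _ P.
  case: (pselect (F !=set0)) => [[H0 FH0]|F0]; last first.
    rewrite /P /= bigcup0 ?setU0 // => H FH.
    by exfalso; apply: F0; exists H.
  have [G0 GB GF] := hG.
  have in2 p q : (G `|` \bigcup_(X in F) X) p -> (G `|` \bigcup_(X in F) X) q ->
      exists2 H, F H & (G `|` H) p /\ (G `|` H) q.
    move=> [Gp|[H FH Hp]] [Gq|[K FK Kq]].
    - by exists H0 => //; split; left.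
    - by exists K => //; split; [left|right].
    - by exists H => //; split; [right|left].
    - have [HK|KH] := tot _ _ FH FK.
        by exists K => //; split; right; first exact: HK.
      by exists H => //; split; right; last exact: KH.
  split; first by left.
    move=> p q hp hq; have [H FH [Hp Hq]] := in2 _ _ hp hq.
    have [_ hB _] := FP _ FH.
    by have [?|?] := hB _ _ Hp Hq; [left|right; exists H].
  move=> q hq; have [H FH [Hq _]] := in2 _ _ hq hq.
  by have [_ _] := FP _ FH; exact.
pose K := G `|` H; have hK : pgraph K by [].
have tot b : exists q, K (b, q).
  have [q hq] := pgraph_step b hK.
  pose K' := [set p | exists x y n, K (x, y) /\ p = (x + b *~ n, y + q *~ n)].
  have KK' : K `<=` K'.
    by move=> [x y] Kxy; exists x, y, 0; rewrite !mulr0z !addr0.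
  have K'b : K' (b, q).
    by have [K0 _ _] := hK; exists 0, 0, 1; rewrite !mulr1z !add0r.
  exists q; right; apply: contrapT => nH.
  apply: (Hmax K').
    split; last by move=> /(_ _ K'b).
    by move=> x Hx; apply: KK'; right.
  rewrite /P /=; have -> : G `|` K' = K' => //.
  by apply/seteqP; split=> x; [case=> // Gx; apply: KK'; left|right].
have uni b q q' : K (b, q) -> K (b, q') -> q = q'.
  have [_ KB KF] := hK => h h'; have := KB _ _ h h'.
  by rewrite /= subrr => /KF/eqP; rewrite subr_eq0 => /eqP.
pose h b := sval (cid (tot b)).
have hP b : K (b, h b) by rewrite /h; case: cid.
have hadd : zmod_morphism h.
  move=> x y; apply: (uni (x - y)) => //.
  by have [_ KB _] := hK; exact: (KB _ _ (hP x) (hP y)).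
pose hA : {additive B -> QZ} := HB.pack h (GRing.isZmodMorphism.Build B QZ h hadd).
exists hA => -[b q] Gbq /=.
by apply: (uni b) => //; left.
Qed.

Lemma QZ_extend (A : zmodType) (f : {additive A -> B}) (g : {additive A -> QZ}) :
  injective f -> exists h : {additive B -> QZ}, forall a, h (f a) = g a.
Proof.
move=> f_inj; pose G := [set p | exists a, p = (f a, g a)].
have [|h hh] := @pgraph_extend G.
  split; first by exists 0; rewrite !raddf0.
    by move=> _ _ [a ->] [b ->]; exists (a - b); rewrite !raddfB.
  move=> q [a [e ->]]; have -> : a = 0 by apply: f_inj; rewrite raddf0.
  by rewrite raddf0.
by exists h => a; apply: (hh (f a, g a)); exists a.
Qed.

Lemma QZ_separates (x : B) : x != 0 -> exists h : {additive B -> QZ}, h x != 0.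
Proof.
move=> x0.
suff [q [q0 hq]] : exists q : QZ, q != 0 /\ forall n : int, x *~ n = 0 -> q *~ n = 0.
  have [|h hh] := @pgraph_extend [set p | exists n, p = (x *~ n, q *~ n)].
    split; first by exists 0; rewrite !mulr0z.
      by move=> _ _ [m ->] [n ->]; exists (m - n); rewrite !mulrzBr.
    by move=> r [n [e ->]]; exact: hq.
  exists h; have -> : h x = q; last by [].
  by apply: (hh (x, q)); exists 1; rewrite !mulr1z.
pose D (n : nat) := (0 < n)%N && (x *+ n == 0).
have qzV (k : nat) : (1 < k)%N -> qz (k%:R^-1) != 0.
  move=> k1; apply/eqP => /qz_eq0; apply/negP.
  apply/intrP => -[z hz].
  have k0 : (k%:R : rat) != 0 by rewrite pnatr_eq0; case: (k) k1.
  have : (z * k%:Z)%:~R = 1%:~R :> rat by rewrite intrM -hz mulVf.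
  move=> /intr_inj /(congr1 absz); rewrite abszM /= => /eqP.
  by rewrite muln_eq1 => /andP[_ /eqP e]; rewrite e in k1.
have [[n0 Dn0]|noD] := pselect (exists n, D n); last first.
  exists (qz (2%:R^-1)); split; first exact: qzV.
  move=> n xn; have [->|n0] := eqVneq n 0; first by rewrite mulr0z.
  exfalso; apply: noD; exists `|n|%N; rewrite /D absz_gt0 n0 /=.
  case: (n) xn => k /=; first by rewrite -pmulrn => ->.
  by rewrite NegzE mulrNz => /eqP; rewrite oppr_eq0.
have exD : exists n, D n by exists n0.
pose m := ex_minn exD.
have [/andP[m0 /eqP xm] mmin] : D m /\ forall n, D n -> (m <= n)%N.
  by rewrite /m; case: ex_minnP.
have m1 : (1 < m)%N.
  case: (m) m0 xm => [//|[|//]] _; rewrite mulr1n => e.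
  by rewrite e eqxx in x0.
exists (qz (m%:R^-1)); split; first exact: qzV.
move=> n xn.
have m0z : m%:Z != 0 by case: (m) m0.
have rE := divz_eq n m.
have r0 : (n %% m)%Z = 0.
  have : 0 <= (n %% m)%Z by exact: modz_ge0.
  have : (n %% m)%Z < m by apply: ltz_pmod; rewrite ltz_nat.
  case: (n %% m)%Z rE => // [[//|k]] rE /= ltk _.
  have : D k.+1.
    by rewrite /D /= pmulrn (mulrz_rem x rE) xn -pmulrn xm mul0rz subr0.
  by move=> /mmin; rewrite leqNgt -ltz_nat ltk.
rewrite qzMz; apply/qz_eq0.
rewrite rE r0 addr0 -mulrzr intrM mulrCA.
by rewrite -[(m%:Z)%:~R]/(m%:R) mulVf ?mulr1 ?rpred_int // pnatr_eq0 -lt0n.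
Qed.

End Extension.

(* The module Hom_Z(R, (Q/Z)^T), with (c f)(x) = f(x c). *)
Section Coinduced.
Variables (R : comNzRingType) (T : Type).
Let G : zmodType := T -> QZ.

Definition coind : Type := {additive R -> G}.
Identity Coercion coind_additive : coind >-> GRing.Additive.type.
HB.instance Definition _ := gen_eqMixin coind.
HB.instance Definition _ := gen_choiceMixin coind.

Definition mkcoind (f : R -> G) (hf : zmod_morphism f) : coind :=
  HB.pack f (GRing.isZmodMorphism.Build R G f hf).

Implicit Types f g : coind.
Lemma coindP f g : (forall x, f x = g x) -> f = g.
Proof.
case: f => f [[mf]]; case: g => g [[mg]] /= h.
have e : f = g by apply/funext.
by subst g; rewrite (Prop_irrelevance mf mg).
Qed.

Fact coind_add_morph f g : zmod_morphism (fun x => f x + g x).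
Proof. by move=> x y; rewrite !raddfB opprD addrACA. Qed.
Fact coind_opp_morph f : zmod_morphism (fun x => - f x).
Proof. by move=> x y; rewrite raddfB opprD. Qed.
Fact coind_zero_morph : zmod_morphism (fun _ : R => 0 : G).
Proof. by move=> x y; rewrite subr0. Qed.
Fact coind_scale_morph (c : R) f : zmod_morphism (fun x => f (x * c)).
Proof. by move=> x y; rewrite mulrBl raddfB. Qed.

Definition coind_add f g : coind := mkcoind (coind_add_morph f g).
Definition coind_opp f : coind := mkcoind (coind_opp_morph f).
Definition coind_zero : coind := mkcoind coind_zero_morph.
Definition coind_scale c f : coind := mkcoind (coind_scale_morph c f).

Fact coind_addA : associative coind_add.
Proof. by move=> f g h; apply: coindP => x /=; rewrite addrA. Qed.
Fact coind_addC : commutative coind_add.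
Proof. by move=> f g; apply: coindP => x /=; rewrite addrC. Qed.
Fact coind_add0 : left_id coind_zero coind_add.
Proof. by move=> f; apply: coindP => x /=; rewrite add0r. Qed.
Fact coind_addN : left_inverse coind_zero coind_opp coind_add.
Proof. by move=> f; apply: coindP => x /=; rewrite addNr. Qed.
HB.instance Definition _ :=
  GRing.isZmodule.Build coind coind_addA coind_addC coind_add0 coind_addN.

Fact coind_scaleA a b f : coind_scale a (coind_scale b f) = coind_scale (a * b) f.
Proof. by apply: coindP => x /=; rewrite mulrA. Qed.
Fact coind_scale1 : left_id 1 coind_scale.
Proof. by move=> f; apply: coindP => x /=; rewrite mulr1. Qed.
Fact coind_scaleDr : right_distributive coind_scale +%R.
Proof. by move=> a f g; apply: coindP => x. Qed.
Fact coind_scaleDl f : {morph coind_scale^~ f : a b / a + b}.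
Proof. by move=> a b; apply: coindP => x /=; rewrite mulrDr raddfD. Qed.
HB.instance Definition _ := GRing.Zmodule_isLmodule.Build R coind
  coind_scaleA coind_scale1 coind_scaleDr coind_scaleDl.

Lemma coind_injective : @injective_module R coind.
Proof.
move=> A B j g j_inj.
have gE a x t : g (x *: a) 1 t = g a x t by rewrite linearZ /= mul1r.
have ex t : exists h : {additive B -> QZ}, forall a, h (j a) = g a 1 t.
  have gt_morph : zmod_morphism (fun a => g a 1 t).
    by move=> a b; rewrite linearB.
  pose gt : {additive A -> QZ} :=
    HB.pack (fun a => g a 1 t) (GRing.isZmodMorphism.Build A QZ _ gt_morph).
  exact: (@QZ_extend B A j gt j_inj).
pose chi t := sval (cid (ex t)).
have chiE t a : chi t (j a) = g a 1 t by rewrite /chi; case: cid.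
have h_morph b : zmod_morphism (fun (x : R) => (fun t => chi t (x *: b)) : G).
  by move=> x y; apply/funext => t; rewrite scalerBl raddfB.
have h_linear : linear (fun b => mkcoind (h_morph b)).
  move=> a b c; apply: coindP => x; apply/funext => t /=.
  by rewrite scalerDr scalerA raddfD.
exists (mklin h_linear) => a; apply: coindP => x; apply/funext => t /=.
by rewrite -linearZ chiE gE.
Qed.
End Coinduced.

Section EnoughInjectives.
Variable R : comNzRingType.

Definition inj_over (X : lmodType R) : lmodType R :=
  coind R {additive X -> QZ}.

Fact inj_over_morph (X : lmodType R) (x : X) :
  zmod_morphism (fun (a : R) => (fun h => h (a *: x)) : {additive X -> QZ} -> QZ).
Proof. by move=> a b; apply/funext => h; rewrite scalerBl raddfB. Qed.

Fact inj_over_linear (X : lmodType R) :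
  linear (fun x : X => mkcoind (inj_over_morph x) : inj_over X).
Proof.
move=> a x y; apply: coindP => b; apply/funext => h /=.
by rewrite scalerDr scalerA raddfD.
Qed.

Definition to_inj_over (X : lmodType R) : {linear X -> inj_over X} :=
  mklin (@inj_over_linear X).

Lemma to_inj_over_inj (X : lmodType R) : injective (@to_inj_over X).
Proof.
move=> x y e; apply/eqP; rewrite -subr_eq0; apply/negPn/negP => /QZ_separates[h].
rewrite raddfB subr_eq0 => /eqP; apply.
have := congr1 (fun f : coind R _ => f 1 h) e.
by rewrite /= !scale1r.
Qed.

Lemma inj_resolution_exists (X : lmodType R) : exists _ : inj_resolution X, True.
Proof.
pose Z := fix Z n : lmodType R :=
  if n is m.+1 then quotm (imsm (@to_inj_over (Z m))) else X.
pose E n : lmodType R := inj_over (Z n).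
pose eta n : {linear Z n -> E n} := @to_inj_over (Z n).
pose pr n : {linear E n -> Z n.+1} := qproj (imsm (@to_inj_over (Z n))).
pose d n : {linear E n -> E n.+1} := lcomp (eta n.+1) (pr n).
have dE n x : d n x = eta n.+1 (pr n x) by [].
have eta_inj n : injective (eta n) by exact: to_inj_over_inj.
have pr_surj n q : exists x, pr n x = q by exact: qproj_surj.
have pr0 n y : pr n y = 0 <-> exists x, eta n x = y.
  rewrite -(linear0 (pr n)); split=> [/qprojP|h]; first by rewrite subr0.
  by apply/qprojP; rewrite subr0.
have d0 n y : d n y = 0 <-> exists x, eta n x = y.
  rewrite dE -(linear0 (eta n.+1)) -pr0; split=> [/eta_inj//|-> //].
have dd n x : d n.+1 (d n x) = 0 by apply/d0; exists (pr n x).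
unshelve eexists=> //; apply: (@InjResolution R X (Cochain dd) (eta 0%N)).
- by move=> n; exact: coind_injective.
- exact: (eta_inj 0%N).
- exact: (d0 0%N).
- move=> n y; split=> [/d0[z <-]|[z <-]]; last exact: dd.
  by have [x <-] := pr_surj n z; exists x.
Qed.
End EnoughInjectives.

(* Derived functors, computed with chosen resolutions; on maps, with a chosen
   lift to the resolutions. Up to unique isomorphism the results do not depend on
   these choices, about which nothing else is known. *)

Section TorExt.
Variable R : comNzRingType.

Definition projres (X : lmodType R) : proj_resolution X :=
  sval (cid (proj_resolution_exists X)).

Definition projres_map (X Y : lmodType R) (f : {linear X -> Y}) :
    chain_map (projres X) (projres Y) :=
  sval (cid (proj_lift_exists (projres X) (projres Y) f)).

Definition injres (X : lmodType R) : inj_resolution X :=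
  sval (cid (inj_resolution_exists X)).

Definition injres_map (X Y : lmodType R) (f : {linear X -> Y}) :
    cochain_map (injres X) (injres Y) :=
  sval (cid (inj_lift_exists (injres X) (injres Y) f)).

(* Tor_i(X, M): the first variable is resolved. *)
Definition tor (i : int) (X M : lmodType R) : lmodType R :=
  homology (tens_chain M (projres X)) i.

Definition tor_map (i : int) (M X Y : lmodType R) (f : {linear X -> Y}) :
    {linear tor i X M -> tor i Y M} :=
  homology_map (tens_chain_map M (projres_map f)) i.

(* Ext^i(X, N): the first variable is resolved. *)
Definition ext (i : int) (X N : lmodType R) : lmodType R :=
  cohomology (hom_cochain N (projres X)) i.

Definition ext_map (i : int) (N X Y : lmodType R) (f : {linear X -> Y}) :
    {linear ext i Y N -> ext i X N} :=
  cohomology_map (hom_cochain_map N (projres_map f)) i.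
End TorExt.

(* H^i_I is the i-th right derived functor of the I-torsion functor gamma I. *)
Section LocalCohomology.
Variable R : comNzRingType.

Definition ideal := submod R^o.

Fixpoint ideal_pow (I : ideal) (n : nat) : ideal :=
  if n is n'.+1
  then span [set x : R^o | exists a b : R, [/\ I a, ideal_pow I n' b & x = a * b]]
  else total_submod _.

Lemma ideal_powS (I : ideal) n x : ideal_pow I n.+1 x -> ideal_pow I n x.
Proof.
apply=> _ [a [b [_ hb ->]]].
have := @smP _ _ (ideal_pow I n) a b 0 hb (sm0 _); by rewrite addr0.
Qed.

Lemma ideal_powW (I : ideal) n k x : ideal_pow I (k + n) x -> ideal_pow I n x.
Proof. by elim: k => [//|k ih] /ideal_powS. Qed.

Section Gamma.
Variables (I : ideal) (X : lmodType R).
Definition torsion (x : X) := exists n, forall a : R, ideal_pow I n a -> a *: x = 0.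
Fact torsion0 : torsion 0.
Proof. by exists 0%N => a _; rewrite scaler0. Qed.
Fact torsionP (a : R) u v : torsion u -> torsion v -> torsion (a *: u + v).
Proof.
move=> [n hn] [k hk]; exists (k + n)%N => b hb.
have bu : b *: u = 0 by apply: hn; exact: ideal_powW hb.
rewrite addnC in hb; have bv : b *: v = 0 by apply: hk; exact: ideal_powW hb.
by rewrite scalerDr bv addr0 scalerA mulrC -scalerA bu scaler0.
Qed.
Definition gamma : submod X := Submod torsion0 torsionP.
End Gamma.

Variable I : ideal.

Fact gamma_map (X Y : lmodType R) (f : {linear X -> Y}) x :
  gamma I X x -> gamma I Y (f x).
Proof. by move=> [n hn]; exists n => a /hn h; rewrite -linearZ h linear0. Qed.

Section GammaComplex.
Variables (C D : cochain R) (f : cochain_map C D).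
Let gd (C : cochain R) n := restr (@gamma_map _ _ (cochain_d C n)).
Fact gamma_cochain_dd (C' : cochain R) n (x : subm (gamma I (C' n))) :
  gd C' n.+1 (gd C' n x) = 0.
Proof. by apply: val_inj; rewrite !restrE cochain_dd. Qed.
Definition gamma_cochain (C' : cochain R) : cochain R :=
  Cochain (cochain_ob := fun n => subm (gamma I (C' n))) (@gamma_cochain_dd C').

Fact gamma_cochain_fd n (x : subm (gamma I (C n))) :
  restr (@gamma_map _ _ (f n.+1)) (gd C n x) =
  gd D n (restr (@gamma_map _ _ (f n)) x).
Proof. by apply: val_inj; rewrite !restrE cochain_fd. Qed.
Definition gamma_cochain_map : cochain_map (gamma_cochain C) (gamma_cochain D) :=
  @CochainMap _ (gamma_cochain C) (gamma_cochain D) _ gamma_cochain_fd.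
End GammaComplex.

Definition lcoh (i : int) (X : lmodType R) : lmodType R :=
  cohomology (gamma_cochain (injres X)) i.

Definition lcoh_map (i : int) (X Y : lmodType R) (f : {linear X -> Y}) :
    {linear lcoh i X -> lcoh i Y} :=
  cohomology_map (gamma_cochain_map (injres_map f)) i.

Definition coh_complete_intersection :=
  exists c : int, forall i : int, i <> c -> forall x : lcoh i R^o, x = 0.

End LocalCohomology.

Section Rings.
Variable R : comNzRingType.

Definition noetherian :=
  forall J : nat -> ideal R, (forall n, J n `<=` J n.+1) ->
  exists N, forall n, (N <= n)%N -> J n `<=` J N.

Definition maximal_ideal (m : ideal R) :=
  ~ m 1 /\ forall J : ideal R, m `<=` J -> ~ J 1 -> J `<=` m.

Definition local_ring (m : ideal R) :=
  maximal_ideal m /\ forall n : ideal R, maximal_ideal n -> forall x, n x <-> m x.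

Definition ideal_gen (s : seq R) : ideal R := span [set x : R^o | (x : R) \in s].

Definition regular_seq (s : seq R) :=
  (forall i, (i < size s)%N -> forall a : R,
     ideal_gen (take i s) (s`_i * a) -> ideal_gen (take i s) a)
  /\ ~ ideal_gen s 1.

(* c is the length of a longest regular sequence in I. *)
Definition is_grade (I : ideal R) (c : nat) :=
  (exists s, [/\ regular_seq s, forall x, x \in s -> I x & size s = c]) /\
  forall s, regular_seq s -> (forall x, x \in s -> I x) -> (size s <= c)%N.

Definition injective_hull (N E : lmodType R) (j : {linear N -> E}) :=
  [/\ injective_module E, injective j
    & forall W : submod E, (exists2 x, W x & x <> 0) ->
        exists2 y, W (j y) & j y <> 0].
End Rings.

(* Main.v *)
From HB Require Import structures.
Require Import Defs.
From mathcomp Require Import all_boot all_order all_algebra.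
From mathcomp Require Import boolp classical_sets functions.
From mathcomp Require Import finmap zify.
From mathcomp.multinomials Require Import monalg.
Set Implicit Arguments.
Unset Strict Implicit.
Unset Printing Implicit Defensive.
Import GRing.Theory.
Local Open Scope ring_scope.

(* Let I = (f_1, ..., f_r) and let K(X) be the complex obtained from X by iterating
   the cone of V^(N) -> V^(N), p |-> (p_(n+1) - f p_n)_n, over f = f_1, ..., f_r; this
   is a functorial, exact and bounded complex, compatible with direct sums, with
   H^0(K(X)) the I-torsion of X.  Over a Noetherian ring the f-torsion of an
   injective module is injective, so K(E) has no higher cohomology for E injective, and
   the double complex K(E^p) of an injective resolution gives H^i(K(X)) = H^i_I(X).
   If H^i_I(R) = 0 for i <> c then K(P) has cohomology P (x) H^c_I(R) in degree c only,
   for P projective, and the double complex K(P_p) of a projective resolution of X gives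
   Tor_(c-i)(X, H^c_I(R)) = H^i(K(X)), hence (a).  Part (b) follows from (a) by
   adjunction and the exactness of Hom(-, E).  Both comparisons of double complexes are
   done with relations ("z and y are joined by a staircase"): a linear relation that is
   total and surjective and relates zero only to zero is a linear bijection, and its
   naturality is immediate.  That the exceptional degree c is the grade follows from the
   long exact sequences of R/(s_1, ..., s_k), s a maximal regular sequence in I. *)

(** * Classes and linear relations *)

(** The two-term complex V^(N) -> V^(N) stands in for V -> V_f. It needs no ring of fractions, and
    each degree of K(X) is a finite sum of iterated countable direct sums of X, so exactness and
    locality are checked coordinatewise. The price is finite support: sequences built by recursion
    or choice must vanish eventually, and over an injective module this is where the Noetherian
    stabilization of colon ideals enters.

    The two comparisons terminate for different reasons. For an injective resolution all columns are
    acyclic in positive degrees, and a staircase of length n ends at the edge. For a projective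
    resolution the columns keep cohomology in degree c and the rows never end; there a lifting
    problem is pushed to higher and higher degrees of K until the number of generators of I is
    exceeded. The column of X itself has unknown cohomology and is exempt from the acyclicity
    condition.

    For the grade, the point is that every class in H^i_I(X) is killed by a power of each x in I, so
    that it vanishes as soon as x acts injectively on the group. *)

Section Classes.
Variable R : comNzRingType.

(** Stated as a relation between a cochain and a class, so that representatives are handled as plain
    elements of [C n] and the cocycle proof stays hidden. *)
Definition coclass (C : cochain R) (n : nat) (z : C n) (u : cohomology C (Posz n)) :=
  exists h : cocycles C n z, u = qproj _ (mksub h).

Lemma coclass_ex (C : cochain R) (n : nat) (u : cohomology C (Posz n)) : exists z, coclass z u.
Proof.
have [z <-] := qproj_surj u.
by exists (val z), (submP z); congr qproj; apply: val_inj.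
Qed.

Lemma coclass_of (C : cochain R) (n : nat) (z : C n) :
  cochain_d C n z = 0 -> exists u, coclass z u.
Proof. by move=> h; exists (qproj _ (mksub (W := cocycles C n) h)), h. Qed.

Lemma coclass_cocycle (C : cochain R) (n : nat) (z : C n) u :
  coclass z u -> cochain_d C n z = 0.
Proof. by case. Qed.

Lemma coclass_eq (C : cochain R) (n : nat) (z z' : C n) u u' :
  coclass z u -> coclass z' u' -> u = u' <-> coboundaries C n (z - z').
Proof. by move=> [h ->] [h' ->]; exact: qprojP. Qed.

Lemma coclass0 (C : cochain R) (n : nat) (z : C n) u :
  coclass z u -> u = 0 <-> coboundaries C n z.
Proof.
move=> zu.
have x0 : coclass (0 : C n) 0.
  have hz : cocycles C n 0 by exact: sm0.
  by exists hz; rewrite -(linear0 (qproj _)); congr qproj; apply: val_inj.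
by have := coclass_eq zu x0; rewrite subr0.
Qed.

Lemma coclassP (C : cochain R) (n : nat) a (z z' : C n) u u' :
  coclass z u -> coclass z' u' -> coclass (a *: z + z') (a *: u + u').
Proof.
move=> [h ->] [h' ->]; exists (smP a h h').
by rewrite -linearP; congr qproj; apply: val_inj.
Qed.

Lemma coclass_map (C D : cochain R) (f : cochain_map C D) (n : nat) (z : C n) u :
  coclass z u -> coclass (f n z) (cohomology_map f (Posz n) u).
Proof.
move=> [h ->]; exists (cocycles_map f h).
by rewrite [LHS]qmapE; congr qproj; apply: val_inj.
Qed.

Definition clas (C : chain R) (n : nat) (z : C n) (u : homology C (Posz n)) :=
  exists h : cycles C n z, u = qproj _ (mksub h).

Lemma clas_ex (C : chain R) (n : nat) (u : homology C (Posz n)) : exists z, clas z u.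
Proof.
have [z <-] := qproj_surj u.
by exists (val z), (submP z); congr qproj; apply: val_inj.
Qed.

Lemma clas_of (C : chain R) (n : nat) (z : C n) : cycles C n z -> exists u, clas z u.
Proof. by move=> h; exists (qproj _ (mksub h)), h. Qed.

Lemma clas_eq (C : chain R) (n : nat) (z z' : C n) u u' :
  clas z u -> clas z' u' -> u = u' <-> boundaries C n (z - z').
Proof. by move=> [h ->] [h' ->]; exact: qprojP. Qed.

Lemma clasP (C : chain R) (n : nat) a (z z' : C n) u u' :
  clas z u -> clas z' u' -> clas (a *: z + z') (a *: u + u').
Proof.
move=> [h ->] [h' ->]; exists (smP a h h').
by rewrite -linearP; congr qproj; apply: val_inj.
Qed.

Lemma clas0 (C : chain R) (n : nat) (z : C n) u :
  clas z u -> u = 0 <-> boundaries C n z.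
Proof.
move=> zu.
have x0 : clas (0 : C n) 0.
  have hz : cycles C n 0 by exact: sm0.
  by exists hz; rewrite -(linear0 (qproj _)); congr qproj; apply: val_inj.
by have := clas_eq zu x0; rewrite subr0.
Qed.

Lemma clas_map (C D : chain R) (f : chain_map C D) (n : nat) (z : C n) u :
  clas z u -> clas (f n z) (homology_map f (Posz n) u).
Proof.
move=> [h ->]; exists (cycles_map f h).
by rewrite [LHS]qmapE; congr qproj; apply: val_inj.
Qed.
End Classes.

Section LinearRelations.
Variable R : comNzRingType.

Lemma bijectiveP (A B : Type) (f : A -> B) :
  injective f -> (forall y, exists x, f x = y) -> bijective f.
Proof.
move=> fi fs; pose g y := sval (cid (fs y)).
have gK y : f (g y) = y by rewrite /g; case: cid.
by exists g => // x; apply: fi.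
Qed.

Lemma linear_relation_bij (U V : lmodType R) (S : U -> V -> Prop) :
  (forall a u u' v v', S u v -> S u' v' -> S (a *: u + u') (a *: v + v')) ->
  (forall u, exists v, S u v) -> (forall v, exists u, S u v) ->
  (forall u v, S u v -> (u = 0 <-> v = 0)) ->
  exists phi : {linear U -> V}, bijective phi /\ forall u v, S u v <-> v = phi u.
Proof.
move=> SP tot surj inj0.
have SB u u' v v' : S u v -> S u' v' -> S (u - u') (v - v').
  by move=> s s'; have := SP (-1) _ _ _ _ s' s; rewrite !scaleN1r ![- _ + _]addrC.
(* By linearity, single-valuedness and injectivity both reduce to the hypothesis on zero. *)
have Sfun u u' v v' : S u v -> S u' v' -> u = u' <-> v = v'.
  move=> s s'; have [h1 h2] := inj0 _ _ (SB _ _ _ _ s s').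
  by split=> e; apply/subr0_eq; [apply: h1|apply: h2]; rewrite e subrr.
pose phi u := sval (cid (tot u)).
have phiS u : S u (phi u) by rewrite /phi; case: cid.
have phi_lin : linear phi.
  by move=> a u u'; apply/(Sfun _ _ _ _ (phiS _) (SP a _ _ _ _ (phiS u) (phiS u'))).
exists (mklin phi_lin); split.
  apply: bijectiveP => [u u' e|v].
    by apply/(Sfun _ _ _ _ (phiS u) (phiS u')).
  by have [u s] := surj v; exists u; apply/(Sfun _ _ _ _ (phiS u) s).
move=> u v; split=> [s|->]; last exact: phiS.
by apply/(Sfun _ _ _ _ s (phiS u)).
Qed.
End LinearRelations.

(** * The complexes K(X) *)

Section FiniteSequences.
Variable R : comNzRingType.

Section Def.
Variable V : lmodType R.

Fact fsupp0 : exists N, forall n, (N <= n)%N -> (0 : nat -> V) n = 0.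
Proof. by exists 0%N. Qed.
Fact fsuppP a (p q : nat -> V) :
  (exists N, forall n, (N <= n)%N -> p n = 0) ->
  (exists N, forall n, (N <= n)%N -> q n = 0) ->
  exists N, forall n, (N <= n)%N -> (a *: p + q) n = 0.
Proof.
move=> [N hN] [M hM]; exists (maxn N M) => n; rewrite geq_max => /andP[Nn Mn].
change (a *: p n + q n = 0).
by rewrite hN // hM // scaler0 addr0.
Qed.
Definition fsupp : submod (nat -> V : lmodType R) := Submod fsupp0 fsuppP.
Definition fseq : lmodType R := subm fsupp.

Definition fnth (n : nat) (p : fseq) : V := (val p : nat -> V) n.
Definition mkfseq (p : nat -> V)
  (hp : exists N, forall n, (N <= n)%N -> p n = 0) : fseq := @mksub _ _ fsupp p hp.

Lemma fseqP (p q : fseq) : (forall n, fnth n p = fnth n q) -> p = q.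
Proof. by move=> h; apply: val_inj; apply/funext. Qed.
Lemma fnth_fin (p : fseq) : exists N, forall n, (N <= n)%N -> fnth n p = 0.
Proof. exact: submP p. Qed.
Fact fnth_linear n : linear (fnth n).
Proof. by []. Qed.
HB.instance Definition _ n :=
  GRing.isLinear.Build R fseq V *:%R (fnth n) (@fnth_linear n).
Lemma fnthD p q n : fnth n (p + q) = fnth n p + fnth n q. Proof. by []. Qed.
Lemma fnthZ a p n : fnth n (a *: p) = a *: fnth n p. Proof. by []. Qed.
(* The kernel of delta consists of the sequences p_n = f^n p_0, which are finitely
   supported exactly when p_0 is f-torsion; its cokernel is the localization V_f modulo
   the image of V. *)
Section Delta.
Variable f : R.
Definition delta_fun (p : fseq) : nat -> V := fun n => fnth n.+1 p - f *: fnth n p.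
Fact delta_fin p : exists N, forall n, (N <= n)%N -> delta_fun p n = 0.
Proof.
have [N hN] := fnth_fin p; exists N => n Nn.
by rewrite /delta_fun !hN ?scaler0 ?subr0 // (leq_trans Nn).
Qed.
Fact delta_linear : linear (fun p => mkfseq (delta_fin p)).
Proof.
move=> a p q; apply: fseqP => n.
change (delta_fun (a *: p + q) n = a *: delta_fun p n + delta_fun q n).
by rewrite /delta_fun !fnthD !fnthZ scalerDr opprD scalerBr !scalerA [f * a]mulrC addrACA.
Qed.
Definition delta : {linear fseq -> fseq} := mklin delta_linear.
Lemma deltaE p n : fnth n (delta p) = fnth n.+1 p - f *: fnth n p.
Proof. by []. Qed.
End Delta.
End Def.
Arguments delta {V} f.

Section Map.
Variables (V W : lmodType R) (g : {linear V -> W}).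
Fact fmap_fin (p : fseq V) : exists N, forall n, (N <= n)%N -> g (fnth n p) = 0.
Proof. by have [N hN] := fnth_fin p; exists N => n /hN ->; rewrite linear0. Qed.
Fact fmap_linear : linear (fun p => mkfseq (fmap_fin p)).
Proof. by move=> a p q; apply: fseqP => n; rewrite [LHS]linearP. Qed.
Definition fmap : {linear fseq V -> fseq W} := mklin fmap_linear.
Lemma fmapE p n : fnth n (fmap p) = g (fnth n p).
Proof. by []. Qed.

Lemma fmap_delta f p : fmap (delta f p) = delta f (fmap p).
Proof. by apply: fseqP => n; rewrite fmapE !deltaE linearB linearZ. Qed.

(** [Q 0 0] lets the choice be 0 wherever the given sequence vanishes, so the chosen sequence is
    again finitely supported. *)
Lemma fseq_choice (Q : V -> W -> Prop) (q : fseq W) : Q 0 0 ->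
  (forall n, exists x, Q x (fnth n q)) -> exists p, forall n, Q (fnth n p) (fnth n q).
Proof.
move=> Q0 h.
have h' n : exists x, Q x (fnth n q) /\ (fnth n q = 0 -> x = 0).
  have [e|ne] := pselect (fnth n q = 0); first by exists 0; rewrite e.
  by have [x hx] := h n; exists x.
pose s n := sval (cid (h' n)).
have sP n : Q (s n) (fnth n q) /\ (fnth n q = 0 -> s n = 0) by rewrite /s; case: cid.
have hs : exists N, forall n, (N <= n)%N -> s n = 0.
  by have [N hN] := fnth_fin q; exists N => n /hN; exact: (sP n).2.
by exists (mkfseq hs) => n; have [] := sP n.
Qed.

Lemma fmap_lift (q : fseq W) : (forall n, exists x, g x = fnth n q) ->
  exists p, fmap p = q.
Proof.
move=> h; have [|p hp] := @fseq_choice (fun x y => g x = y) q _ h.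
  exact: linear0.
by exists p; apply: fseqP.
Qed.
End Map.
End FiniteSequences.
Arguments delta {R V} f.

(** * The shifted mapping cone of [delta] *)

Section Cone.
Variables (R : comNzRingType) (f : R).

(** The cone is shifted so that it starts in degree 0 and its H^0 is a kernel; degree 0 has no
    second summand because [C] vanishes in degree -1. *)
Definition cone_ob (C : cochain R) (n : nat) : lmodType R :=
  if n is m.+1 then (fseq (C m.+1) * fseq (C m))%type else fseq (C 0%N).

Section Diff.
Variable C : cochain R.
Local Notation d n := (fmap (cochain_d C n)).

Fact cone_d0_linear : linear (fun p : fseq (C 0%N) => (d 0%N p, delta f p)).
Proof. by move=> a p q; rewrite !linearP. Qed.
Fact cone_dS_linear n :
  linear (fun p : fseq (C n.+1) * fseq (C n) => (d n.+1 p.1, delta f p.1 - d n p.2)).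
Proof.
move=> a p q; rewrite !linearP /= addrACA -scalerDr.
by congr pair.
Qed.
Definition cone_d n : {linear cone_ob C n -> cone_ob C n.+1} :=
  match n return {linear cone_ob C n -> cone_ob C n.+1} with
  | 0%N => mklin cone_d0_linear
  | m.+1 => mklin (@cone_dS_linear m)
  end.

Lemma cone_d0E p : cone_d 0%N p = (d 0%N p, delta f p). Proof. by []. Qed.
Lemma cone_dSE n p q : cone_d n.+1 (p, q) = (d n.+1 p, delta f p - d n q).
Proof. by []. Qed.

Lemma fmap_dd n p : fmap (cochain_d C n.+1) (fmap (cochain_d C n) p) = 0.
Proof. by apply: fseqP => k; rewrite !fmapE cochain_dd. Qed.

Fact cone_dd n x : cone_d n.+1 (cone_d n x) = 0.
Proof.
case: n x => [|n] => [x|[p q]].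
  by rewrite cone_d0E cone_dSE fmap_dd fmap_delta subrr.
by rewrite !cone_dSE linearB !fmap_dd fmap_delta subr0 subrr.
Qed.
Definition cone : cochain R := Cochain cone_dd.
End Diff.

Section Map.
Variables (C D : cochain R) (g : cochain_map C D).
Fact cone_fS_linear n :
  linear (fun p : fseq (C n.+1) * fseq (C n) => (fmap (g n.+1) p.1, fmap (g n) p.2)).
Proof. by move=> a p q; rewrite !linearP. Qed.
Definition cone_f n : {linear cone C n -> cone D n} :=
  match n return {linear cone_ob C n -> cone_ob D n} with
  | 0%N => fmap (g 0%N)
  | m.+1 => mklin (@cone_fS_linear m)
  end.
Lemma fmap_fd n p :
  fmap (g n.+1) (fmap (cochain_d C n) p) = fmap (cochain_d D n) (fmap (g n) p).
Proof. by apply: fseqP => k; rewrite !fmapE cochain_fd. Qed.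
Lemma cone_fSE n p q : cone_f n.+1 (p, q) = (fmap (g n.+1) p, fmap (g n) q).
Proof. by []. Qed.
Fact cone_fd n x : cone_f n.+1 (cone_d C n x) = cone_d D n (cone_f n x).
Proof.
case: n x => [|n] => [x|[p q]].
  by rewrite !cone_d0E cone_fSE fmap_fd fmap_delta.
by rewrite cone_fSE !cone_dSE cone_fSE linearB !fmap_fd fmap_delta.
Qed.
Definition cone_map : cochain_map (cone C) (cone D) :=
  @CochainMap _ (cone C) (cone D) cone_f cone_fd.
End Map.
End Cone.

Section ConeProperties.
Variables (R : comNzRingType) (f : R).

Lemma cone_exact (C D E : cochain R) (g : cochain_map C D) (h : cochain_map D E) :
  (forall n z, h n z = 0 -> exists w, g n w = z) ->
  forall n z, cone_map f h n z = 0 -> exists w, cone_map f g n w = z.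
Proof.
move=> ex.
have fex n (p : fseq (D n)) : fmap (h n) p = 0 -> exists q, fmap (g n) q = p.
  move=> p0; apply: fmap_lift => k; apply: ex.
  by have := congr1 (fnth k) p0.
case=> [z|n [p q] e]; first exact: fex.
have [p' <-] := fex _ p (congr1 fst e).
have [q' <-] := fex _ q (congr1 snd e).
by exists (p', q').
Qed.

Lemma cone_map_lin (C D : cochain R) (a : R) (h g g' : cochain_map C D) :
  (forall n z, h n z = a *: g n z + g' n z) ->
  forall n z, cone_map f h n z = a *: cone_map f g n z + cone_map f g' n z.
Proof.
move=> e.
have fe n (p : fseq (C n)) : fmap (h n) p = a *: fmap (g n) p + fmap (g' n) p.
  by apply: fseqP => k; rewrite fmapE e.
by case=> [z|n [p q]]; [exact: fe|congr pair; exact: fe].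
Qed.

Lemma cone_map_comp (C D E : cochain R) (g : cochain_map C D)
    (h : cochain_map D E) (gh : cochain_map C E) :
  (forall n z, gh n z = h n (g n z)) ->
  forall n z, cone_map f gh n z = cone_map f h n (cone_map f g n z).
Proof.
move=> e.
have fe n (p : fseq (C n)) : fmap (gh n) p = fmap (h n) (fmap (g n) p).
  by apply: fseqP => k; rewrite !fmapE e.
by case=> [z|n [p q]]; [exact: fe|congr pair; exact: fe].
Qed.

Lemma cone_map_id (C : cochain R) (g : cochain_map C C) :
  (forall n z, g n z = z) -> forall n z, cone_map f g n z = z.
Proof.
move=> e.
have fe n (p : fseq (C n)) : fmap (g n) p = p by apply: fseqP => k; rewrite fmapE e.
by case=> [z|n [p q]]; [exact: fe|congr pair; exact: fe].
Qed.

Lemma cone_bounded (C : cochain R) r : (forall n (z : C n), (r < n)%N -> z = 0) ->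
  forall n (z : cone f C n), (r.+1 < n)%N -> z = 0.
Proof.
move=> b [//|n] [p q] rn.
have -> : p = 0 by apply: fseqP => k; apply: b; exact: ltnW.
by have -> : q = 0 by apply: fseqP => k; apply: b.
Qed.
End ConeProperties.

Section Cech.
Variable R : comNzRingType.

Lemma zero_module_eq0 (x : zero_module R) : x = 0.
Proof. exact: thinmx0. Qed.

Section Concentrated.
Variable X : lmodType R.
Definition conc_ob (n : nat) : lmodType R := if n is 0%N then X else zero_module R.
Fact conc_dd n (x : conc_ob n) :
  hom_zero (conc_ob n.+1) (conc_ob n.+2) (hom_zero (conc_ob n) (conc_ob n.+1) x) = 0.
Proof. by []. Qed.
Definition conc : cochain R := Cochain conc_dd.
End Concentrated.

Section ConcentratedMap.
Variables (X Y : lmodType R) (g : {linear X -> Y}).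
Definition conc_f n : {linear conc X n -> conc Y n} :=
  match n return {linear conc_ob X n -> conc_ob Y n} with
  | 0%N => g
  | _.+1 => hom_zero _ _
  end.
Fact conc_fd n (x : conc_ob X n) :
  conc_f n.+1 (cochain_d (conc X) n x) = cochain_d (conc Y) n (conc_f n x).
Proof. by rewrite [LHS]zero_module_eq0. Qed.
Definition conc_map : cochain_map (conc X) (conc Y) :=
  @CochainMap _ (conc X) (conc Y) conc_f conc_fd.
End ConcentratedMap.

(** The Cech complex of X for the sequence [fs], with each V -> V_f replaced by the two-term complex
    [delta]. *)
Fixpoint cech (fs : seq R) (X : lmodType R) : cochain R :=
  if fs is f :: fs' then cone f (cech fs' X) else conc X.

Fixpoint cech_map (fs : seq R) (X Y : lmodType R) (g : {linear X -> Y}) :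
    cochain_map (cech fs X) (cech fs Y) :=
  match fs return cochain_map (cech fs X) (cech fs Y) with
  | [::] => conc_map g
  | f :: fs' => cone_map f (cech_map fs' g)
  end.

Implicit Types X Y Z : lmodType R.

Lemma cech_exact fs X Y Z (g : {linear X -> Y}) (h : {linear Y -> Z}) :
  (forall y, h y = 0 -> exists x, g x = y) ->
  forall n z, cech_map fs h n z = 0 -> exists w, cech_map fs g n w = z.
Proof.
move=> ex; elim: fs => [|f fs ih]; last exact: cone_exact.
case=> [z|n z _]; first exact: ex.
by exists 0; rewrite [z]zero_module_eq0.
Qed.

Lemma cech_map_lin fs X Y (a : R) (h g g' : {linear X -> Y}) :
  (forall x, h x = a *: g x + g' x) ->
  forall n z, cech_map fs h n z = a *: cech_map fs g n z + cech_map fs g' n z.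
Proof.
move=> e; elim: fs => [|f fs ih]; last exact: cone_map_lin.
by case=> [z|n z]; [exact: e|rewrite [LHS]zero_module_eq0 [RHS]zero_module_eq0].
Qed.

Lemma cech_map_comp fs X Y Z (g : {linear X -> Y}) (h : {linear Y -> Z})
    (gh : {linear X -> Z}) : (forall x, gh x = h (g x)) ->
  forall n z, cech_map fs gh n z = cech_map fs h n (cech_map fs g n z).
Proof.
move=> e; elim: fs => [|f fs ih]; last exact: cone_map_comp.
by case=> [z|n z]; [exact: e|].
Qed.

Lemma cech_map_id fs X (g : {linear X -> X}) : (forall x, g x = x) ->
  forall n z, cech_map fs g n z = z.
Proof.
move=> e; elim: fs => [|f fs ih]; last exact: cone_map_id.
by case=> [z|n z]; [exact: e|rewrite [z]zero_module_eq0 linear0].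
Qed.

Lemma cech_bounded fs X n (z : cech fs X n) : (size fs < n)%N -> z = 0.
Proof.
elim: fs n z => [|f fs ih] n z; last exact: cone_bounded.
by case: n z => // n z _; exact: zero_module_eq0.
Qed.

(** A zero map satisfies h = h + h, and [cech_map_lin] carries this identity over to the
    complexes. *)
Lemma cech_map0 fs X Y (h : {linear X -> Y}) : (forall x, h x = 0) ->
  forall n z, cech_map fs h n z = 0.
Proof.
move=> h0 n z.
have := @cech_map_lin fs X Y 1 h h h _ n z.
rewrite scale1r => /(_ _)/eqP; rewrite -subr_eq0 opprD addrA subrr sub0r oppr_eq0.
by move=> e; apply/eqP; apply: e => x; rewrite !h0 addr0 scaler0.
Qed.

Lemma cech_inj fs X Y (h : {linear X -> Y}) : (forall x, h x = 0 -> x = 0) ->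
  forall n z, cech_map fs h n z = 0 -> z = 0.
Proof.
move=> hi n z /(@cech_exact fs (zero_module R) _ _ (hom_zero _ _) h) [|w <-].
  by move=> y /hi ->; exists 0.
exact: cech_map0.
Qed.

Lemma cech_surj fs X Y (h : {linear X -> Y}) : (forall y, exists x, h x = y) ->
  forall n z, exists w, cech_map fs h n w = z.
Proof.
move=> hs n z.
apply: (@cech_exact fs X Y (zero_module R) h (hom_zero _ _)) => //.
by rewrite cech_map0.
Qed.

(* Applied to a free module X and the projections onto finite sets of coordinates. *)
Lemma cech_local fs X (D : Type) (d0 : D) (r : D -> {linear X -> X}) :
  (forall d d', exists e, (forall x, r e (r d x) = r d x) /\
                          (forall x, r e (r d' x) = r d' x)) ->
  (forall x, exists d, r d x = x) ->
  forall n z, exists d, cech_map fs (r d) n z = z.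
Proof.
move=> dir loc.
have mono fs' d e n (z : cech fs' X n) : (forall x, r e (r d x) = r d x) ->
    cech_map fs' (r d) n z = z -> cech_map fs' (r e) n z = z.
  by move=> h <-; rewrite -(@cech_map_comp fs' _ _ _ (r d) (r e) (r d)).
elim: fs => [|f fs ih].
  case=> [z|n z]; first exact: loc.
  by exists d0; rewrite [z]zero_module_eq0 linear0.
have fin n (p : fseq (cech fs X n)) : exists d, fmap (cech_map fs (r d) n) p = p.
  have [N hN] := fnth_fin p.
  have [d hd] : exists d, forall k, (k < N)%N ->
      cech_map fs (r d) n (fnth k p) = fnth k p.
    elim: N {hN} => [|N [d hd]]; first by exists d0.
    have [d' hd'] := ih n (fnth N p); have [e [ed ed']] := dir d d'.
    exists e => k; rewrite ltnS leq_eqVlt => /orP[/eqP ->|kN].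
      exact: mono hd'.
    by apply: mono (hd _ kN).
  exists d; apply: fseqP => k; rewrite fmapE.
  by have [/hd//|/hN ->] := ltnP k N; rewrite linear0.
have fmono d e n (p : fseq (cech fs X n)) : (forall x, r e (r d x) = r d x) ->
    fmap (cech_map fs (r d) n) p = p -> fmap (cech_map fs (r e) n) p = p.
  move=> h hp; apply: fseqP => k; rewrite fmapE; apply: mono h _.
  by rewrite -fmapE hp.
case=> [z|n [p q]]; first exact: fin.
have [d hd] := fin _ p; have [d' hd'] := fin _ q; have [e [ed ed']] := dir d d'.
by exists e; congr pair; [exact: fmono ed hd|exact: fmono ed' hd'].
Qed.
End Cech.

(** * Torsion over Noetherian rings *)

Section PrincipalTorsion.
Variables (R : comNzRingType) (f : R).

Definition ptors (X : lmodType R) (x : X) := exists n, f ^+ n *: x = 0.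

Lemma ptors_leq (X : lmodType R) (x : X) n k :
  (n <= k)%N -> f ^+ n *: x = 0 -> f ^+ k *: x = 0.
Proof. by move=> /subnK <- h; rewrite exprD -scalerA h scaler0. Qed.

Fact ptors0 (X : lmodType R) : ptors (0 : X).
Proof. by exists 0%N; rewrite scaler0. Qed.
Fact ptorsP (X : lmodType R) (a : R) (x y : X) :
  ptors x -> ptors y -> ptors (a *: x + y).
Proof.
move=> [n hn] [k hk]; exists (maxn n k).
rewrite scalerDr (ptors_leq (leq_maxr n k) hk) addr0 scalerA mulrC -scalerA.
by rewrite (ptors_leq (leq_maxl n k) hn) scaler0.
Qed.
Definition ptors_submod (X : lmodType R) : submod X :=
  Submod (ptors0 X) (@ptorsP X).
End PrincipalTorsion.

Section SumSubmodule.
Variables (R : comNzRingType) (V : lmodType R) (W : submod V) (x : V).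
Fact adjoin0 : exists w r, W w /\ 0 = w + r *: x.
Proof. by exists 0, 0; rewrite scale0r addr0; split=> //; exact: sm0. Qed.
Fact adjoinP (a : R) u v : (exists w r, W w /\ u = w + r *: x) ->
  (exists w r, W w /\ v = w + r *: x) ->
  exists w r, W w /\ a *: u + v = w + r *: x.
Proof.
move=> [w [r [hw ->]]] [w' [r' [hw' ->]]]; exists (a *: w + w'), (a * r + r').
split; first exact: smP.
by rewrite scalerDr scalerDl scalerA addrACA.
Qed.
Definition adjoin : submod V :=
  Submod (smset := fun u => exists w r, W w /\ u = w + r *: x) adjoin0 adjoinP.
Lemma adjoin_incl u : W u -> adjoin u.
Proof. by exists u, 0; rewrite scale0r addr0. Qed.
Lemma adjoin_gen : adjoin x.
Proof. by exists 0, 1; rewrite scale1r add0r; split=> //; exact: sm0. Qed.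
End SumSubmodule.

Section Submodules.
Variables (R : comNzRingType) (V : lmodType R) (W : submod V).
Lemma smD u v : W u -> W v -> W (u + v).
Proof. by move=> hu hv; have := smP 1 hu hv; rewrite scale1r. Qed.
Lemma smZ a u : W u -> W (a *: u).
Proof. by move=> hu; have := smP a hu (sm0 W); rewrite addr0. Qed.
Lemma smN u : W u -> W (- u).
Proof. by move=> /(smZ (-1)); rewrite scaleN1r. Qed.
Lemma smB u v : W u -> W v -> W (u - v).
Proof. by move=> hu /smN; exact: smD. Qed.
End Submodules.

Section Noetherian.
Variable R : comNzRingType.
Hypothesis noeth : noetherian R.

(** Otherwise dependent choice would produce a strictly ascending chain of ideals. *)
Lemma ideal_max (P : ideal R -> Prop) : (exists J, P J) ->
  exists J, P J /\ forall K : ideal R, P K -> (forall x, J x -> K x) -> forall x, K x -> J x.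
Proof.
move=> [J0 PJ0]; apply: contrapT => no.
have step J : P J -> exists K : ideal R,
    ((forall x, J x -> K x) /\ ~ (forall x, K x -> J x)) /\ P K.
  move=> PJ; apply: contrapT => no'; apply: no; exists J; split=> // K PK JK.
  by apply: contrapT => KJ; apply: no'; exists K.
have [|J [_ hJ]] := @nat_rec_choice (fun=> ideal R)
  (fun _ (J K : ideal R) => (forall x, J x -> K x) /\ ~ (forall x, K x -> J x))
  (fun=> P) J0 PJ0.
  by move=> _ J PJ; exact: step.
have [|N hN] := noeth (J := J); first by move=> n; exact: (hJ n).1.
by apply: (hJ N).2; exact: hN.
Qed.

(** The ideals of those r with f^n r x in W ascend with n, hence stabilize. The point is that N does
    not depend on r. *)
Lemma power_colon_stable (V : lmodType R) (W : submod V) (f : R) (x : V) :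
  exists N, forall k r, W (f ^+ (N + k) *: (r *: x)) -> W (f ^+ N *: (r *: x)).
Proof.
have lin n : linear (fun r : R^o => f ^+ n *: ((r : R) *: x)).
  by move=> a r s; rewrite scalerDl scalerDr -scalerA !scalerA [f ^+ n * a]mulrC.
pose J n : ideal R := presm (mklin (lin n)) W.
have [|N hN] := noeth (J := J).
  by move=> n r h; change (W (f ^+ n.+1 *: (r *: x))); rewrite exprS -scalerA; exact: smZ.
by exists N => k r h; apply: (hN (N + k)%N _ r h); exact: leq_addr.
Qed.

(** Choose l so that the annihilators of the powers of f in R are constant from l on. Then r f^(l+k)
    |-> r f^l w is well defined, injectivity extends it to R, and w' is the image of 1. The factor
    f^l is the price for f being a possible zero divisor. *)
Lemma injective_divisible (E : lmodType R) (f : R) (w : E) k : injective_module E ->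
  exists w' l, f ^+ (k + l) *: w' = f ^+ l *: w.
Proof.
move=> hE; have [l hl] := power_colon_stable (zero_submod R^o) f 1.
have mlin : linear (fun r : R^o => f ^+ (l + k) *: r).
  by move=> a r s; rewrite scalerDr !scalerA mulrC.
have glin : linear (fun r : R^o => (r : R) *: (f ^+ l *: w)).
  by move=> a r s; rewrite scalerDl -scalerA.
have [|h hh] := @injective_lift _ _ _ _ (mklin mlin) (mklin glin) hE.
  move=> r /= h; rewrite scalerA [r * _]mulrC.
  have := hl k r; rewrite /smset /= -[r *: 1]/(r * 1) mulr1 => /(_ h).
  by rewrite -[f ^+ l *: r]/(f ^+ l * r) => ->; rewrite scale0r.
exists (h 1), l; have := hh 1; rewrite /= scale1r => <-.
by rewrite linearZ addnC.
Qed.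

(** The recursion s_(n+1) = q_n + f s_n solves the equation, but without finite support. Adding the
    homogeneous solution f^n w repairs this: w comes from divisibility, with f^(N+l) w = - f^l s_N,
    and f^l s_N = s_(N+l) because q vanishes from N on. *)
Lemma delta_surj (E : lmodType R) (f : R) (q : fseq E) : injective_module E ->
  exists p, delta f p = q.
Proof.
move=> hE; have [N hN] := fnth_fin q.
pose s := fix s n : E := if n is m.+1 then fnth m q + f *: s m else 0.
have [w [l hw]] := injective_divisible f (- s N) N hE.
pose p n := s n + f ^+ n *: w.
have pS n : p n.+1 = fnth n q + f *: p n.
  by rewrite /p /= scalerDr scalerA -exprS addrA.
have fin : exists M, forall n, (M <= n)%N -> p n = 0.
  exists (N + l)%N => n /subnK <-; elim: (n - _)%N => [|m ih]; last first.
    rewrite addSn pS ih scaler0 addr0 hN //.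
    by rewrite addnCA leq_addr.
  rewrite add0n /p hw.
  have -> : s (N + l)%N = f ^+ l *: s N.
    elim: l {hw} => [|l ih]; first by rewrite addn0 expr0 scale1r.
    by rewrite addnS /= ih hN ?leq_addr // add0r scalerA -exprS.
  by rewrite scalerN subrr.
exists (mkfseq fin); apply: fseqP => n.
by rewrite deltaE [fnth n.+1 _]pS addrK.
Qed.

(* A submodule Q of B maximal among those meeting A in ker g makes B/Q an
   essential extension of A/ker g; over a Noetherian ring such an extension of an
   f-torsion module is f-torsion. *)
Lemma ptors_injective (E : lmodType R) (f : R) : injective_module E ->
  injective_module (subm (ptors_submod f E)).
Proof.
move=> hE A B j g j_inj.
pose K x := exists a, j a = x /\ g a = 0.
(* The submodule is [Q], the union of [K] and [H], rather than [H] itself, so that the empty chain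
   in Zorn's lemma is harmless: it yields the submodule [K]. *)
pose P (H : set B) := exists Q : submod B,
  (forall x, Q x <-> K x \/ H x) /\ forall a, Q (j a) -> g a = 0.
have [F FP tot|H [[Q [QH Qg]] Hmax]] := @Zorn_bigcup _ P.
  pose U x := K x \/ (\bigcup_(X in F) X)%classic x.
  have UP x y : U x -> U y -> exists Q : submod B,
      [/\ Q x, Q y, forall z, Q z -> U z & forall a, Q (j a) -> g a = 0].
    have K0 x' y' : K x' -> K y' -> exists Q : submod B,
        [/\ Q x', Q y', forall z, Q z -> U z & forall a, Q (j a) -> g a = 0].
      have k0 : K 0 by exists 0; rewrite !linear0.
      have kP a u v : K u -> K v -> K (a *: u + v).
        move=> [b [<- gb]] [b' [<- gb']]; exists (a *: b + b').
        by rewrite !linearP gb gb' scaler0 addr0.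
      move=> Kx Ky; exists (Submod k0 kP); split=> // [z Kz|a [b [/j_inj <- //]]].
      by left.
    have FU X : F X -> exists Q : submod B, [/\ forall z, X z \/ K z -> Q z,
        forall z, Q z -> U z & forall a, Q (j a) -> g a = 0].
      move=> FX; have [Q [QX Qg]] := FP _ FX; exists Q; split=> // z.
        by move=> h; apply/QX; case: h; [right|left].
      by move=> /QX[?|?]; [left|right; exists X].
    case=> [Kx|[X FX Xx]] [Ky|[Y FY Yy]].
    - exact: K0.
    - by have [Q [h1 h2 h3]] := FU _ FY; exists Q; split=> //; apply: h1; [right|left].
    - by have [Q [h1 h2 h3]] := FU _ FX; exists Q; split=> //; apply: h1; [left|right].
    - have [XY|YX] := tot _ _ FX FY.
        have [Q [h1 h2 h3]] := FU _ FY.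
        by exists Q; split=> //; apply: h1; left => //; exact: XY.
      have [Q [h1 h2 h3]] := FU _ FX.
      by exists Q; split=> //; apply: h1; left => //; exact: YX.
  have U0 : U 0 by left; exists 0; rewrite !linear0.
  have Ulin a u v : U u -> U v -> U (a *: u + v).
    by move=> Uu Uv; have [Q [Qu Qv QU _]] := UP _ _ Uu Uv; apply: QU; exact: smP.
  exists (Submod U0 Ulin); split=> // a Ua.
  by have [Q [Qa _ _ Qg]] := UP _ _ Ua Ua; exact: Qg.
have KQ x : K x -> Q x by move=> Kx; apply/QH; left.
(* With N from [power_colon_stable], adding f^N x to Q would keep the condition on ker g. If j a = q
   + r f^N x and f^k kills g a, then f^k j a lies in K, so f^(N+k) r x lies in Q, hence so does f^N
   r x, and j a with it. Maximality of Q then puts f^N x in Q. *)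
have Qtors x : exists n, Q (f ^+ n *: x).
  have [N hN] := power_colon_stable Q f x.
  exists N; pose Q' := adjoin Q (f ^+ N *: x).
  have Q'g a : Q' (j a) -> g a = 0.
    move=> [q [r [Qq e]]]; apply: Qg.
    have [k hk] := submP (g a).
    have gk : g (f ^+ k *: a) = 0 by apply: val_inj; rewrite linearZ; exact: hk.
    have : Q (f ^+ k *: j a) by apply: KQ; exists (f ^+ k *: a); rewrite linearZ.
    rewrite e scalerDr => h.
    have h' : Q (f ^+ (N + k) *: (r *: x)).
      have -> : f ^+ (N + k) *: (r *: x) =
          f ^+ k *: q + f ^+ k *: (r *: (f ^+ N *: x)) - f ^+ k *: q.
        by rewrite addrC addKr !scalerA exprD; congr (_ *: _); rewrite [RHS]mulrC !mulrA.
      by apply: smB => //; exact: smZ.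
    apply: smD => //.
    by have := hN _ _ h'; rewrite !scalerA mulrC.
  apply: contrapT => nQ; apply: (Hmax Q').
    split=> [z Hz|]; first by apply: adjoin_incl; apply/QH; right.
    move=> QH'; apply: nQ; apply/QH; right; apply: QH'; exact: adjoin_gen.
  exists Q'; split=> // z; split; first by right.
  by case=> // Kz; apply: adjoin_incl; exact: KQ.
(* The extension is taken through B/Q, all of whose elements are f-torsion, so its values lie in the
   torsion submodule. *)
have [|h hh] := @injective_lift _ E A (quotm Q) (lcomp (qproj Q) j)
  (lcomp (subincl _) g) hE.
  move=> a; rewrite /lcomp /= -(linear0 (qproj Q)) => /qprojP.
  by rewrite subr0 => /Qg ->.
have htors x : ptors_submod f E (lcomp h (qproj Q) x).
  have [n hn] := Qtors x; exists n; rewrite -linearZ /lcomp /=.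
  rewrite -(linear0 h); congr (h _).
  by rewrite -(linear0 (qproj Q)); apply/qprojP; rewrite subr0.
exists (corestr htors) => a; apply: val_inj.
exact: hh.
Qed.
End Noetherian.

(** * Degree-zero cocycles of K(X) as torsion elements *)

Section DegreeZero.
Variable R : comNzRingType.
Implicit Types X Y : lmodType R.

Lemma cone0_cocycle (f : R) (C : cochain R) (z : fseq (C 0%N)) :
  cochain_d (cone f C) 0 z = 0 ->
  (forall k, cochain_d C 0 (fnth k z) = 0) /\
  (forall k, fnth k z = f ^+ k *: fnth 0 z).
Proof.
move=> e; split=> [k|k].
  by have := congr1 (fnth k) (congr1 fst e : fmap (cochain_d C 0) z = 0).
elim: k => [|k ih]; first by rewrite expr0 scale1r.
have := congr1 (fnth k) (congr1 snd e : delta f z = 0).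
rewrite deltaE => /eqP; rewrite subr_eq0 => /eqP ->.
by rewrite ih scalerA exprS.
Qed.

(** Takes the entry at index 0 in every direction. It determines a degree-zero cocycle, whose n-th
    entry in the direction f is f^n times the entry at 0. *)
Fixpoint cech_ev (fs : seq R) X : {linear cech fs X 0%N -> X} :=
  match fs return {linear cech fs X 0%N -> X} with
  | [::] => idfun
  | f :: fs' => lcomp (cech_ev fs' X) (fnth 0)
  end.

Lemma cech_ev_map fs X Y (g : {linear X -> Y}) z :
  cech_ev fs Y (cech_map fs g 0%N z) = g (cech_ev fs X z).
Proof. by elim: fs z => [//|f fs ih] z; exact: ih. Qed.

Lemma cech_ev_inj fs X (z : cech fs X 0%N) :
  cochain_d (cech fs X) 0 z = 0 -> cech_ev fs X z = 0 -> z = 0.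
Proof.
elim: fs z => [//|f fs ih] z /cone0_cocycle [dz zk] e.
have z0 : fnth 0 z = 0 by exact: ih.
by apply: fseqP => k; rewrite zk z0 scaler0.
Qed.

Lemma cech_ev_ptors fs X (z : cech fs X 0%N) :
  cochain_d (cech fs X) 0 z = 0 -> forall f, f \in fs -> ptors f (cech_ev fs X z).
Proof.
elim: fs z => [//|f fs ih] z /cone0_cocycle [dz zk] g.
rewrite inE => /orP[/eqP ->|gfs]; last exact: ih (dz 0%N) _ gfs.
have [N hN] := fnth_fin z; exists N.
change (f ^+ N *: cech_ev fs X (fnth 0 z) = 0).
by rewrite -linearZ_LR -zk hN // linear0.
Qed.

Lemma cech_ev_ex fs X (x : X) : (forall f, f \in fs -> ptors f x) ->
  exists z, cochain_d (cech fs X) 0 z = 0 /\ cech_ev fs X z = x.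
Proof.
elim: fs => [|f fs ih] h; first by exists x.
have [|z0 [dz0 evz0]] := ih; first by move=> g gfs; apply: h; rewrite inE gfs orbT.
have [|N hN] := h f; first by rewrite inE eqxx.
(* This makes n |-> f^n z0 finitely supported: f^N kills x, and the evaluation is injective on
   cocycles. *)
have zN : f ^+ N *: z0 = 0.
  apply: cech_ev_inj; first by rewrite linearZ_LR dz0 scaler0.
  by rewrite linearZ_LR evz0.
have fin : exists M, forall n, (M <= n)%N -> f ^+ n *: z0 = 0.
  by exists N => n /ptors_leq; exact.
exists (mkfseq fin); split; last first.
  by rewrite -[RHS]evz0 -[in RHS](scale1r z0).
congr pair; apply: fseqP => k; rewrite ?fmapE ?deltaE /fnth /=.
  by rewrite linearZ_LR dz0 scaler0.
by rewrite scalerA -exprS subrr.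
Qed.
End DegreeZero.

(** * Acyclicity of K(E) for injective E *)

Section InjectiveAcyclic.
Variable R : comNzRingType.
Hypothesis noeth : noetherian R.

(** One generator is treated at a time by [ptors_injective]. That lemma concerns whole modules, so
    the torsion part is an iterated submodule J with an embedding into E. *)
Lemma torsion_part_injective (fs : seq R) (E : lmodType R) : injective_module E ->
  exists (J : lmodType R) (e : {linear J -> E}),
    [/\ injective_module J, injective e
      & forall x, (exists y, e y = x) <-> forall f, f \in fs -> ptors f x].
Proof.
move=> hE; elim: fs => [|f fs [J [e [hJ e_inj eP]]]].
  exists E, idfun; split=> //.
  by move=> x; split=> [//|_]; exists x.
exists (subm (ptors_submod f J)), (lcomp e (subincl _)); split.
- exact: ptors_injective.
- by move=> x y /e_inj /val_inj.
- move=> x; split=> [[y <-] g|h].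
    rewrite inE => /orP[/eqP ->|].
      have [n hn] := submP y; exists n; rewrite /lcomp /= -linearZ_LR.
      by rewrite -(linear0 e); congr (e _).
    by move: g; apply/eP; exists (val y).
  have [|y ye] := (eP x).2; first by move=> g gfs; apply: h; rewrite inE gfs orbT.
  have [|n hn] := h f; first by rewrite inE eqxx.
  have yt : ptors_submod f J y.
    by exists n; apply: e_inj; rewrite linearZ_LR linear0 /= ye.
  by exists (mksub yt).
Qed.

(** In the cone sequence all cohomology groups but one vanish by induction. What remains is, in
    degree 1, the cokernel of [delta] on finite sequences in H^0, the torsion part of E; this part
    is injective, so [delta_surj] applies. *)
Lemma cech_injective_acyclic fs (E : lmodType R) : injective_module E ->
  forall n (z : cech fs E n.+1), cochain_d (cech fs E) n.+1 z = 0 ->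
  exists y, cochain_d (cech fs E) n y = z.
Proof.
move=> hE; elim: fs => [|f fs ih] n.
  by move=> z _; exists 0; rewrite [z]zero_module_eq0 linear0.
have fex k (p : fseq (cech fs E k.+1)) : fmap (cochain_d (cech fs E) k.+1) p = 0 ->
    exists q, fmap (cochain_d (cech fs E) k) q = p.
  move=> p0; apply: fmap_lift => l; apply: ih.
  by have := congr1 (fnth l) p0.
move=> [p q] e.
have [p' ep] := fex n p (congr1 fst e).
have {}e : delta f p = fmap (cochain_d _ n) q.
  by apply/eqP; rewrite -subr_eq0; apply/eqP; exact: (congr1 snd e).
case: n p q p' ep e => [|n] p q p' ep e; last first.
  have [q' eq'] : exists q', fmap (cochain_d (cech fs E) n) q' = delta f p' - q.
    by apply: fex; rewrite linearB -e -ep fmap_delta subrr.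
  by exists (p', q'); rewrite [LHS]cone_dSE ep eq' opprB addrC subrK.
(* The remaining sequence [r] of degree-zero cocycles is carried to J by evaluation, the equation
   for [delta] is solved there, and the solution is carried back to [t]. *)
have [J [e' [hJ e'_inj eP]]] := torsion_part_injective fs hE.
pose r := q - delta f p'.
have dr k : cochain_d (cech fs E) 0 (fnth k r) = 0.
  rewrite -fmapE linearB -e -ep fmap_delta subrr //.
have [||r' hr'] := @fseq_choice _ J _
  (fun x y => cochain_d (cech fs E) 0 y = 0 /\ e' x = cech_ev fs E y) r.
- by rewrite !linear0.
- move=> k; have [x ex] := (eP _).2 (cech_ev_ptors (dr k)).
  by exists x.
have [s es] := delta_surj noeth f r' hJ.
have [||t ht] := @fseq_choice _ _ J
  (fun y x => cochain_d (cech fs E) 0 y = 0 /\ cech_ev fs E y = e' x) s.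
- by rewrite !linear0.
- by move=> k; apply: cech_ev_ex; apply/eP; exists (fnth k s).
exists (p' + t); rewrite [LHS]cone_d0E !linearD ep.
rewrite [X in _ + X](_ : _ = 0) ?addr0; last by apply: fseqP => k; exact: (ht k).1.
suff -> : delta f t = r by rewrite addrC subrK.
apply: fseqP => k; apply/eqP; rewrite -subr_eq0; apply/eqP.
apply: (@cech_ev_inj _ fs).
  by rewrite linearB /= dr deltaE linearB linearZ_LR /= !(ht _).1 scaler0 !subr0.
rewrite linearB /= -(hr' k).2 deltaE linearB linearZ_LR /= !(ht _).2.
by rewrite -linearZ_LR -!linearB -deltaE es subrr linear0.
Qed.
End InjectiveAcyclic.

(** * Torsion for an ideal and for its generators *)

Section TorsionIdeal.
Variable R : comNzRingType.
Variable X : lmodType R.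

Definition killed (I : ideal R) n (x : X) := forall a : R, ideal_pow I n a -> a *: x = 0.

Lemma ideal_pow_mul (I : ideal R) n (a b : R) :
  I a -> ideal_pow I n b -> ideal_pow I n.+1 (a * b).
Proof. by move=> Ia Ib; apply: span_incl; exists a, b. Qed.

Lemma killedS (I : ideal R) n (x : X) :
  killed I n.+1 x <-> forall a : R, I a -> killed I n (a *: x).
Proof.
split=> [h a Ia b Ib|h a].
  by rewrite scalerA mulrC; apply: h; exact: ideal_pow_mul.
have lin : linear (fun r : R^o => (r : R) *: x).
  by move=> c r s; rewrite scalerDl -scalerA.
move=> /(_ (kersm (mklin lin))); apply=> _ [b [d [Ib Id ->]]].
by change ((b * d) *: x = 0); rewrite mulrC -scalerA; exact: h.
Qed.

Lemma killed_expr (I : ideal R) (f : R) n (x : X) : I f -> killed I n x -> f ^+ n *: x = 0.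
Proof.
move=> If; apply; elim: n => [//|n ih].
by rewrite exprS; exact: ideal_pow_mul.
Qed.

(** Write an element of I as b + r f. Multiplication by b in J lowers n and keeps f x killed by I^m,
    while r f x is already killed by I^m. *)
Lemma killed_adjoin (I J : ideal R) (f : R) :
  (forall a, I a -> exists b r, J b /\ a = b + r * f) ->
  forall n m (x : X), killed J n x -> killed I m (f *: x) -> killed I (n + m) x.
Proof.
move=> IJ; elim=> [|n ih] m x.
  by move=> /(_ 1 Logic.I); rewrite scale1r => -> _ a _; rewrite scaler0.
move=> Jx Ifx; rewrite addSn; apply/killedS => a /IJ [b [r [Jb ->]]] c Ic.
rewrite scalerDl scalerDr.
have -> : c *: (b *: x) = 0.
  apply: (ih m) Ic => [|d Id]; first by move/killedS: Jx; exact.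
  have -> : d *: (f *: (b *: x)) = b *: (d *: (f *: x)).
    by rewrite !scalerA mulrC mulrA.
  by rewrite Ifx // scaler0.
have -> : c *: ((r * f) *: x) = r *: (c *: (f *: x)).
  by rewrite !scalerA mulrA [c * r]mulrC.
by rewrite add0r Ifx ?scaler0 //; exact: ideal_powW Ic.
Qed.

Lemma gamma_adjoin (I J : ideal R) (f : R) :
  (forall a, I a -> exists b r, J b /\ a = b + r * f) ->
  forall x : X, gamma J X x -> ptors f x -> gamma I X x.
Proof.
move=> IJ x Jx [k]; elim: k x Jx => [|k ih] x Jx.
  by rewrite expr0 scale1r => ->; exact: sm0.
rewrite exprSr -scalerA => /(ih _ (smZ f Jx)) [m Ifx].
by have [n Jn] := Jx; exists (n + m)%N; exact: killed_adjoin IJ _ _ _ Jn Ifx.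
Qed.
End TorsionIdeal.

Section FinitelyGenerated.
Variable R : comNzRingType.

Lemma submod_ext (V : lmodType R) (U W : submod V) : (forall x, U x <-> W x) -> U = W.
Proof.
case: U => U U0 UP; case: W => W W0 WP /= h.
have e : U = W by apply/funext => x; apply/propext; exact: h.
by subst W; congr Submod; exact: Prop_irrelevance.
Qed.

Lemma span_min (V : lmodType R) (S : set V) (W : submod V) :
  (forall x, S x -> W x) -> forall x, Defs.span S x -> W x.
Proof. by move=> h x; apply. Qed.

Lemma ideal_gen_mem (s : seq R) f : f \in s -> ideal_gen s f.
Proof. by move=> fs; exact: span_incl. Qed.

Lemma ideal_gen_adjoin (s s' : seq R) (f : R) : s' =i f :: s ->
  forall a, ideal_gen s' a <-> adjoin (ideal_gen s) (f : R^o) a.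
Proof.
move=> e a; split.
  apply: span_min => x xs'; have : (x : R) \in f :: s by rewrite -e.
  rewrite inE => /orP[/eqP ->|xs].
    exact: adjoin_gen.
  by apply: adjoin_incl; exact: ideal_gen_mem.
move=> [w [r [hw ->]]]; apply: smD.
  by apply: span_min hw => x xs; apply: ideal_gen_mem; rewrite e inE xs orbT.
by apply/smZ/ideal_gen_mem; rewrite e inE eqxx.
Qed.

Lemma gamma_ideal_gen (s : seq R) (X : lmodType R) (x : X) :
  gamma (ideal_gen s) X x <-> forall f, f \in s -> ptors f x.
Proof.
split=> [[n h] f fs|]; first by exists n; apply: killed_expr h; exact: ideal_gen_mem.
elim: s => [|f s ih] h.
  (* Exponent 1 and not 0: the zeroth power is the unit ideal, even of the zero ideal generated by
     no elements. *)
  exists 1%N; apply/killedS => a /(span_min (W := zero_submod R^o)) -> //.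
  by move=> b _; rewrite scale0r scaler0.
apply: (@gamma_adjoin _ _ _ (ideal_gen s) f).
- by move=> a /(@ideal_gen_adjoin s _ f (fun=> erefl)).
- by apply: ih => g gs; apply: h; rewrite inE gs orbT.
- by apply: h; rewrite inE eqxx.
Qed.

(** A maximal one among the finitely generated ideals inside I must contain every element of I. *)
Lemma noetherian_fg (noeth : noetherian R) (I : ideal R) : exists s, I = ideal_gen s.
Proof.
have genI (s : seq R) : (forall x : R, x \in s -> I x) ->
    forall x : R, ideal_gen s x -> I x.
  by move=> sI x h; apply: (span_min (W := I) _ h) => y; exact: sI.
have [|J [[s [sI ->]] Jmax]] := @ideal_max _ noeth
  (fun J => exists s : seq R, (forall x : R, x \in s -> I x) /\ J = ideal_gen s).
  by exists (ideal_gen [::]), [::].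
exists s; apply: submod_ext => x; split=> [Ix|]; last exact: genI.
have sxs : exists s' : seq R, (forall y : R, y \in s' -> I y) /\
    ideal_gen (x :: s : seq R) = ideal_gen s'.
  by exists (x :: s); split=> // y; rewrite inE => /orP[/eqP ->//|]; exact: sI.
apply: (Jmax _ sxs) => [y h|].
  apply: (span_min _ h) => z zs; apply: ideal_gen_mem.
  by rewrite inE [X in _ || X]zs orbT.
by apply: ideal_gen_mem; rewrite inE eqxx.
Qed.
End FinitelyGenerated.

(** * Staircases in double complexes *)

Section CoresolutionZigzag.
Variable R : comNzRingType.
Implicit Types D : nat -> cochain R.

(** [D p] is the p-th column and [del p q] the horizontal map. Squares will commute rather than
    anticommute, since no total complex is formed. *)
Definition rows D := forall p q, {linear D p q -> D p.+1 q}.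

(** Each step lifts x through the column differential and moves one column to the right, from column
    0, degree n, to column n, degree 0. Dropping the first column makes the recursion structural,
    without casts. *)
Fixpoint czigzag n D (del : rows D) : D 0%N n -> D n 0%N -> Prop :=
  match n return D 0%N n -> D n 0%N -> Prop with
  | 0%N => fun x y => x = y
  | m.+1 => fun x y => exists w : D 0%N m, cochain_d (D 0%N) m w = x /\
      @czigzag m (fun p => D p.+1) (fun p => del p.+1) (del 0%N m w) y
  end.

Lemma czigzagP n D (del : rows D) a x x' y y' :
  @czigzag n D del x y -> @czigzag n D del x' y' ->
  czigzag del (a *: x + x') (a *: y + y').
Proof.
elim: n D del x x' y y' => [|n ih] D del x x' y y' /=; first by move=> -> ->.
move=> [w [<- h]] [w' [<- h']]; exists (a *: w + w'); split; first exact: linearP.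
rewrite linearP; exact: ih h h'.
Qed.

Lemma czigzag_map n D (del : rows D) D' (del' : rows D')
    (phi : forall p q, {linear D p q -> D' p q}) :
  (forall p q x, phi p q.+1 (cochain_d (D p) q x) = cochain_d (D' p) q (phi p q x)) ->
  (forall p q x, phi p.+1 q (del p q x) = del' p q (phi p q x)) ->
  forall x y, @czigzag n D del x y -> @czigzag n D' del' (phi 0%N n x) (phi n 0%N y).
Proof.
elim: n D del D' del' phi => [|n ih] D del D' del' phi hd hdel x y /=.
  by move=> ->.
move=> [w [<- h]]; exists (phi 0%N n w); split; first by rewrite hd.
rewrite -hdel; apply: (ih _ _ _ _ (fun p q => phi p.+1 q)) h => // p q z.
Qed.

(** Rows are exact only at columns p >= 1 and columns only in degrees q >= 1. In the application the
    kernels left over at the two edges are K(X) and the torsion of the injective resolution. *)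
Record coresolution D (del : rows D) :
    Prop := Coresolution {
  cores_comm : forall p q x,
    del p q.+1 (cochain_d (D p) q x) = cochain_d (D p.+1) q (del p q x);
  cores_dd : forall p q x, del p.+1 q (del p q x) = 0;
  cores_row : forall p q x, del p.+1 q x = 0 -> exists y, del p q y = x;
  cores_col : forall p q x, cochain_d (D p) q.+1 x = 0 ->
    exists y, cochain_d (D p) q y = x }.

Lemma coresolution_shift D (del : rows D) : @coresolution D del ->
  @coresolution (fun p => D p.+1) (fun p => del p.+1).
Proof.
by case=> [h1 h2 h3 h4]; split=> p; [exact: h1|exact: h2|exact: h3|exact: h4].
Qed.

Section Zigzag.
Variables (D : nat -> cochain R) (del : rows D).
Hypothesis res : coresolution del.

Lemma czigzag_ex_row n x : cochain_d (D 0%N) n x = 0 -> del 0%N n x = 0 ->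
  exists y, [/\ czigzag del x y, cochain_d (D n) 0 y = 0 & del n 0%N y = 0].
Proof.
elim: n D del res x => [|n ih] D' del' res' x dx delx; first by exists x.
have [w ew] := cores_col res' dx.
have [||y [h1 h2 h3]] := ih _ _ (coresolution_shift res') (del' 0%N n w).
- by rewrite -(cores_comm res') ew.
- by rewrite (cores_dd res').
by exists y; split=> //; exists w.
Qed.

Lemma czigzag_ex_col n y : cochain_d (D n) 0 y = 0 -> del n 0%N y = 0 ->
  exists x, [/\ czigzag del x y, cochain_d (D 0%N) n x = 0 & del 0%N n x = 0].
Proof.
elim: n D del res y => [|n ih] D' del' res' y dy dely; first by exists y.
have [x [h1 h2 h3]] := ih _ _ (coresolution_shift res') y dy dely.
have [w ew] := cores_row res' h3.
exists (cochain_d (D' 0%N) n w); split.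
- by exists w; rewrite ew.
- exact: cochain_dd.
- by rewrite (cores_comm res') ew.
Qed.
End Zigzag.

(** Coboundaries of the kernel of [del] in column 0, the complex that is being resolved;
    [col_coboundary] is the mirror image among degree-zero cocycles. *)
Definition row_coboundary D (del : rows D) n (x : D 0%N n) :=
  match n return D 0%N n -> Prop with
  | 0%N => fun x => x = 0
  | m.+1 => fun x => exists u, del 0%N m u = 0 /\ cochain_d (D 0%N) m u = x
  end x.

Definition col_coboundary (D : nat -> cochain R)
    (del : forall p q, {linear D p q -> D p.+1 q}) n (y : D n 0%N) :=
  match n return D n 0%N -> Prop with
  | 0%N => fun y => y = 0
  | m.+1 => fun y => exists u, cochain_d (D m) 0 u = 0 /\ del m 0%N u = y
  end y.

(** If x = d x'' with del x'' = 0, then w - x'' is a cocycle, say d u, and del w = d (del u) is a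
    coboundary of the same kind one column further. *)
Lemma czigzag_row_coboundary n D (del : rows D) x y : @coresolution D del ->
  czigzag del x y -> row_coboundary del x -> @col_coboundary D del n y.
Proof.
elim: n D del x y => [|n ih] D del x y res; first by move=> /= ->.
move=> [w [ew h]] [x'' [delx dx]].
have dw : cochain_d (D 0%N) n (w - x'') = 0 by rewrite linearB ew dx subrr.
have delw : del 0%N n w = del 0%N n (w - x'') by rewrite linearB delx subr0.
case: n ih x y w ew h x'' delx dx dw delw => [|n] ih x y w ew h x'' delx dx dw delw.
  by exists (w - x''); split=> //; rewrite -delw.
have [u eu] := cores_col res dw.
apply: (ih _ _ _ _ (coresolution_shift res) h).
exists (del 0%N n u); split; first exact: cores_dd res _ _ _.
by rewrite -(cores_comm res) eu delw.
Qed.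

Lemma czigzag_col_coboundary n D (del : rows D) x y : @coresolution D del ->
  czigzag del x y -> @col_coboundary D del n y -> row_coboundary del x.
Proof.
elim: n D del x y => [|n ih] D del x y res; first by move=> /= ->.
move=> [w [<- h]]; case: n ih x y w h => [|n] ih x y w h [y' [dy' ey']].
  exists (w - y'); rewrite linearB /=; split; last by rewrite linearB dy' subr0.
  by rewrite ey'; apply/eqP; rewrite subr_eq0; apply/eqP.
have [x' [delx' ex']] : row_coboundary (fun p => del p.+1) (del 0%N n.+1 w).
  by apply: (ih _ _ _ _ (coresolution_shift res) h); exists y'.
have [u eu] := cores_row res delx'.
exists (w - cochain_d (D 0%N) n u); split.
  by rewrite linearB (cores_comm res) eu ex' subrr.
by rewrite linearB cochain_dd subr0.
Qed.
End CoresolutionZigzag.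

(** * Resolutions whose columns have cohomology in one degree only *)

Section ResolutionZigzag.
Variable R : comNzRingType.
Implicit Types D : nat -> cochain R.

Definition drows D := forall p q, {linear D p.+1 q -> D p q}.

(* NatTrec.add j.+1 a reduces to NatTrec.add j a.+1, which makes the recursive
   call well typed. *)
Fixpoint rzigzag j D (del : drows D) a :
    D 0%N a -> D j.+1 (NatTrec.add j a) -> Prop :=
  match j return D 0%N a -> D j.+1 (NatTrec.add j a) -> Prop with
  | 0%N => fun x y => del 0%N a y = x
  | i.+1 => fun x y => exists s : D 1%N a, del 0%N a s = x /\
      @rzigzag i (fun p => D p.+1) (fun p => del p.+1) a.+1 (cochain_d (D 1%N) a s) y
  end.

Lemma rzigzagP j D (del : drows D) a c x x' y y' :
  @rzigzag j D del a x y -> @rzigzag j D del a x' y' ->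
  rzigzag del (c *: x + x') (c *: y + y').
Proof.
elim: j D del a x x' y y' => [|j ih] D del a x x' y y' /=.
  by move=> <- <-; exact: linearP.
move=> [w [<- h]] [w' [<- h']]; exists (c *: w + w'); split; first exact: linearP.
rewrite linearP; exact: ih h h'.
Qed.

Lemma rzigzag_map j D (del : drows D) D' (del' : drows D') a
    (phi : forall p q, {linear D p q -> D' p q}) :
  (forall p q x, phi p q.+1 (cochain_d (D p) q x) = cochain_d (D' p) q (phi p q x)) ->
  (forall p q x, phi p q (del p q x) = del' p q (phi p.+1 q x)) ->
  forall x y, @rzigzag j D del a x y -> rzigzag del' (phi 0%N a x) (phi j.+1 _ y).
Proof.
elim: j D del D' del' phi a => [|j ih] D del D' del' phi a hd hdel x y /=.
  by move=> <-; rewrite hdel.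
move=> [w [<- h]]; exists (phi 1%N a w); split; first by rewrite hdel.
rewrite -hd; apply: (ih _ _ _ _ (fun p q => phi p.+1 q)) h => // p q z.
Qed.

(** Column 0 is the augmentation: nothing is assumed on its cohomology. Surjectivity of [del 0] is
    left out as well, since it would be lost when the first column is dropped. *)
Record resolution (c r : nat) D (del : drows D) : Prop := Resolution {
  res_comm : forall p q x,
    del p q.+1 (cochain_d (D p.+1) q x) = cochain_d (D p) q (del p q x);
  res_dd : forall p q x, del p q (del p.+1 q x) = 0;
  res_row : forall p q x, del p q x = 0 -> exists y, del p.+1 q y = x;
  res_col : forall p q x, q <> c -> cochain_d (D p.+1) q x = 0 ->
    coboundaries (D p.+1) q x;
  res_bound : forall p q (x : D p q), (r < q)%N -> x = 0 }.

Lemma resolution_shift c r D (del : drows D) : resolution c r del ->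
  @resolution c r (fun p => D p.+1) (fun p => del p.+1).
Proof.
by case=> [h1 h2 h3 h4 h5]; split=> p;
  [exact: h1|exact: h2|exact: h3|exact: h4|exact: h5].
Qed.

(** Coboundaries of the image complex of [del] in column 0. Once columns have been dropped, [del]
    need not be onto, and these can be fewer than all coboundaries. *)
Definition im_coboundary D (del : drows D) a : D 0%N a -> Prop :=
  match a return D 0%N a -> Prop with
  | 0%N => fun x => x = 0
  | b.+1 => fun x => exists t : D 1%N b, cochain_d (D 0%N) b (del 0%N b t) = x
  end.

Variables (c r : nat).

(** Dimension shifting: d s comes from the next column, one degree higher, where induction corrects
    s to a cocycle. Above degree c the columns are acyclic, and the climb ends at the bound r. *)
Lemma resolution_vanish D (del : drows D) q s : resolution c r del -> (c < q)%N ->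
  cochain_d (D 0%N) q (del 0%N q s) = 0 -> im_coboundary del (del 0%N q s).
Proof.
have [m] := ubnP (r.+1 - q).
elim: m D del q s => [//|m ih] D del [//|q] s lm res cq dx.
have [rq|qr] := ltnP r q.+1.
  by exists 0; rewrite !linear0 (res_bound res (del _ _ _) rq).
have e : del 0%N q.+2 (cochain_d (D 1%N) q.+1 s) = 0 by rewrite (res_comm res).
have [s' es'] := res_row res e.
have lm' : (r.+1 - q.+2 < m)%N.
  by rewrite ltnS in lm; apply: leq_trans lm; rewrite subSS subSn.
have [t et] : im_coboundary (fun p => del p.+1) (del 1%N q.+2 s').
  apply: (ih _ _ q.+2 s' lm' (resolution_shift res) (ltnW cq)).
  by rewrite es' cochain_dd.
have [u eu] : coboundaries (D 1%N) q.+1 (s - del 1%N q.+1 t).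
  apply: (res_col res); first by move=> ec; rewrite ec ltnn in cq.
  by rewrite linearB et es' subrr.
by exists u; rewrite -(res_comm res) eu linearB (res_dd res) subr0.
Qed.

(** The obstruction to lifting x to a cocycle lies in degree c + 1 of the next image complex, where
    [resolution_vanish] removes it. *)
Lemma resolution_lift D (del : drows D) x : resolution c r del ->
  cochain_d (D 0%N) c x = 0 -> (exists s, del 0%N c s = x) ->
  exists y, del 0%N c y = x /\ cochain_d (D 1%N) c y = 0.
Proof.
move=> res dx [s es].
have e : del 0%N c.+1 (cochain_d (D 1%N) c s) = 0 by rewrite (res_comm res) es.
have [s' es'] := res_row res e.
have [t et] : im_coboundary (fun p => del p.+1) (del 1%N c.+1 s').
  apply: (resolution_vanish (resolution_shift res) (ltnSn c)).
  by rewrite es' cochain_dd.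
exists (s - del 1%N c t); rewrite !linearB (res_dd res) subr0; split=> //.
by rewrite [X in _ - X]et es' subrr.
Qed.

Lemma rzigzag_ex_aug j D (del : drows D) a x : resolution c r del ->
  NatTrec.add j a = c -> cochain_d (D 0%N) a x = 0 -> (exists s, del 0%N a s = x) ->
  exists y, @rzigzag j D del a x y /\ cochain_d (D j.+1) _ y = 0.
Proof.
elim: j D del a x => [|j ih] D del a x res ec dx sx.
  by rewrite /= in ec; subst a; exact: resolution_lift.
have [s es] := sx.
have e : del 0%N a.+1 (cochain_d (D 1%N) a s) = 0 by rewrite (res_comm res) es.
have [||y [h1 h2]] := ih _ _ a.+1 (cochain_d (D 1%N) a s) (resolution_shift res) ec.
- exact: cochain_dd.
- by have [s' es'] := res_row res e; exists s'.
by exists y; split=> //; exists s.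
Qed.

(** For a cocycle y this says that its class is a cycle in the chain complex of q-th cohomologies of
    the columns p >= 1; [row_boundary] says that it is a boundary there. *)
Definition row_cycle D (del : drows D) j q : D j.+1 q -> Prop :=
  match j return D j.+1 q -> Prop with
  | 0%N => fun=> True
  | i.+1 => fun y => coboundaries (D i.+1) q (del i.+1 q y)
  end.

Lemma rzigzag_row_cycle j D (del : drows D) a x (y : D j.+1 (NatTrec.add j a)) :
  rzigzag del x y -> row_cycle del y.
Proof.
elim: j D del a x y => [//|[|j] ih] D del a x y [s [_ h]].
  by exists s; rewrite -h.
exact: (ih (fun p => D p.+1) (fun p => del p.+1) a.+1 _ y h).
Qed.

Definition row_boundary D (del : drows D) j q (y : D j.+1 q) :=
  exists y', cochain_d (D j.+2) q y' = 0 /\ coboundaries (D j.+1) q (y - del j.+1 q y').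

Lemma NatTrec_addS_neq j a : NatTrec.add j.+1 a = c -> a <> c.
Proof.
by rewrite NatTrec.addE addSn => <- e; move: (leq_addl j a); rewrite {1}e ltnn.
Qed.

Lemma rzigzag_ex_col j D (del : drows D) a (y : D j.+1 (NatTrec.add j a)) :
  resolution c r del -> NatTrec.add j a = c -> cochain_d (D j.+1) _ y = 0 ->
  row_cycle del y ->
  exists x, [/\ rzigzag del x y, cochain_d (D 0%N) a x = 0
    & exists s, del 0%N a s = x].
Proof.
elim: j D del a y => [|j ih] D del a y res ec dy cy.
  exists (del 0%N a y); split=> //; last by exists y.
  by rewrite -(res_comm res) [X in del _ _ X]dy linear0.
have cy' : row_cycle (fun p => del p.+1) y by case: (j) y dy cy {ih ec}.
have [x' [h1 h2 [s' es']]] := ih _ _ a.+1 y (resolution_shift res) ec dy cy'.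
have [s es] : coboundaries (D 1%N) a.+1 x'.
  (* The end x' is a coboundary for two reasons: if its degree is c, because y is a row cycle, and
     otherwise because column 1 is acyclic in that degree. *)
  case: j ih y ec dy cy cy' x' h1 h2 s' es' => [|j] ih y ec dy cy cy' x' h1 h2 s' es'.
    by rewrite -h1.
  by apply: (res_col res) h2; exact: (@NatTrec_addS_neq j).
exists (del 0%N a s); split; last by exists s.
  by exists s; rewrite es.
by rewrite -(res_comm res) es -es' (res_dd res).
Qed.

(** Each step subtracts a coboundary so that the rest comes from the next column. At the last step,
    in degree c, [resolution_lift] is needed because [row_boundary] asks for a lift that is a
    cocycle. *)
Lemma rzigzag_im_coboundary j D (del : drows D) a x (y : D j.+1 (NatTrec.add j a)) :
  resolution c r del -> NatTrec.add j a = c -> cochain_d (D j.+1) _ y = 0 ->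
  rzigzag del x y -> im_coboundary del x -> row_boundary del y.
Proof.
elim: j D del a x y => [|j ih] D del a x y res ec dy.
  move=> xy hx; rewrite /= in ec.
  have [w [cw dw ew]] : exists w, [/\ coboundaries (D 1%N) a w,
      cochain_d (D 1%N) a w = 0 & del 0%N a w = x].
    case: a x {y dy ec xy} hx => [|a] x hx.
      by exists 0; split; [exact: sm0|exact: linear0|rewrite linear0 hx].
    have [t et] := hx; exists (cochain_d (D 1%N) a t); split; first by exists t.
      exact: cochain_dd.
    by rewrite (res_comm res).
  have e : del 0%N a (y - w) = 0 by rewrite linearB ew [del _ _ _]xy subrr.
  have e' : cochain_d (D 1%N) a (y - w) = 0 by rewrite linearB dw [cochain_d _ _ _]dy subrr.
  subst a; have [y' [ey' dy']] := resolution_lift (resolution_shift res) e' (res_row res e).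
  by exists y'; split=> //; rewrite [del _ _ _]ey' opprB addrC subrK.
move=> [s [es h]] hx; apply: (ih _ _ a.+1 _ y (resolution_shift res) ec dy h).
have [w [dw ew]] : exists w, cochain_d (D 1%N) a w = 0 /\ del 0%N a w = x.
  case: a x {y dy ec s es h} hx => [|a] x hx.
    by exists 0; split; [exact: linear0|rewrite linear0 hx].
  have [t et] := hx; exists (cochain_d (D 1%N) a t); split; first exact: cochain_dd.
  by rewrite (res_comm res).
have e : del 0%N a (s - w) = 0 by rewrite linearB ew es subrr.
have [u eu] := res_row res e.
by exists u; rewrite [del _ _ _]eu linearB dw subr0.
Qed.

Lemma rzigzag_row_boundary j D (del : drows D) a x (y : D j.+1 (NatTrec.add j a)) :
  resolution c r del -> NatTrec.add j a = c ->
  rzigzag del x y -> row_boundary del y -> im_coboundary del x.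
Proof.
elim: j D del a x y => [|j ih] D del a x y res ec.
  move=> <- [y' [dy' cy]].
  have -> : del 0%N a y = del 0%N a (y - del 1%N a y') by rewrite linearB (res_dd res) subr0.
  case: a y {x ec} y' dy' cy => [|a] y y' dy' cy; first by rewrite [_ - _]cy; exact: linear0.
  by have [t et] := cy; exists t; rewrite -(res_comm res); congr (del _ _ _).
move=> [s [es h]] hy.
have [t et] := ih _ _ a.+1 _ y (resolution_shift res) ec h hy.
have dst : cochain_d (D 1%N) a (s - del 1%N a t) = 0.
  by rewrite linearB [X in _ - X]et subrr.
have ac : a <> c by exact: (@NatTrec_addS_neq j).
have := res_col res ac dst.
have <- : del 0%N a (s - del 1%N a t) = x by rewrite linearB es (res_dd res) subr0.
move: (s - _); clear -res; case: a => [|a] w; first by move=> ->; exact: linear0.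
by move=> [u <-]; exists u; rewrite (res_comm res).
Qed.

(** When j > c, a staircase from y reaches degree 0 before column 0. There a coboundary is zero, so
    the staircase starts at 0 and y is a row boundary. *)
Lemma row_boundary_above j D (del : drows D) q (y : D j.+1 q) :
  resolution c r del -> (c < j)%N -> q = c -> cochain_d (D j.+1) q y = 0 ->
  row_cycle del y -> row_boundary del y.
Proof.
elim: j D del y => [//|j ih] D del y res.
rewrite ltnS leq_eqVlt => /orP[/eqP cj|cj] qc dy cy; last first.
  apply: (ih _ _ y (resolution_shift res) cj qc dy).
  by case: (j) cj y dy cy {ih} => [//|k] _ y dy cy.
have e : NatTrec.add j 0 = c by rewrite NatTrec.addE addn0.
have {}qc : q = NatTrec.add j 0 by rewrite e.
subst q.
have cy' : row_cycle (fun p => del p.+1) y by case: (j) y dy cy {ih cj e} => [//|k] y dy cy.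
have [x [xy dx sx]] := rzigzag_ex_col (resolution_shift res) e dy cy'.
apply: (rzigzag_im_coboundary (resolution_shift res) e dy xy).
have [j0|j0] := eqVneq j 0%N; last first.
  by apply: (res_col res) dx; move=> j0'; move: j0; rewrite -cj -j0' eqxx.
by move: y xy cy {e ih cj dy cy' dx sx}; rewrite j0 => y <-.
Qed.
End ResolutionZigzag.

(** * Local cohomology as the cohomology of K(X) *)

Section Comparison.
Variable R : comNzRingType.
Hypothesis noeth : noetherian R.
Variable fs : seq R.
Let I : ideal R := ideal_gen fs.
Implicit Types X Y : lmodType R.

Definition cech_rows (E : cochain R) : rows (fun p => cech fs (E p)) :=
  fun p q => cech_map fs (cochain_d E p) q.

Lemma cech_coresolution X (E : inj_resolution X) : coresolution (cech_rows E).
Proof.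
split=> p q x.
- exact: cochain_fd.
- rewrite /cech_rows -(@cech_map_comp _ fs _ _ _ _ _ (hom_zero _ _)); first exact: cech_map0.
  by move=> y; rewrite cochain_dd.
- by apply: cech_exact => y /ires_exact.
- by apply: cech_injective_acyclic => //; exact: ires_inj.
Qed.

Section Resolution.
Variables (X : lmodType R) (E : inj_resolution X).
Local Notation eps := (cech_map fs (icoaug E)).

Lemma cech_aug_inj n (z : cech fs X n) : eps n z = 0 -> z = 0.
Proof.
by apply: cech_inj => x; rewrite -(linear0 (icoaug E)) => /icoaug_inj.
Qed.

Lemma cech_aug_im n (x : cech fs (E 0%N) n) :
  cech_rows E 0 n x = 0 <-> exists z, eps n z = x.
Proof.
split=> [|[z <-]]; first by apply: cech_exact => y /ires_exact0.
rewrite /cech_rows -(@cech_map_comp _ fs _ _ _ _ _ (hom_zero _ _)); first exact: cech_map0.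
move=> y /=; symmetry.
by have /(_ (icoaug E y)) := @ires_exact0 _ _ E; case=> _; apply; exists y.
Qed.

Lemma cech_aug_coboundary n (z : cech fs X n) :
  coboundaries (cech fs X) n z <-> row_coboundary (cech_rows E) (eps n z).
Proof.
case: n z => [|n] z; first by split=> [->|/cech_aug_inj //]; exact: linear0.
split=> [[z' <-]|[u [/cech_aug_im [z' <-] e]]].
  by exists (eps n z'); split; [apply/cech_aug_im; exists z'|rewrite cochain_fd].
exists z'; apply/eqP; rewrite -subr_eq0; apply/eqP/cech_aug_inj.
by rewrite linearB cochain_fd e subrr.
Qed.

Lemma cech_gamma n (y : cech fs (E n) 0%N) : cochain_d (cech fs (E n)) 0 y = 0 ->
  gamma I (E n) (cech_ev fs _ y).
Proof. by move=> dy; apply/gamma_ideal_gen; exact: cech_ev_ptors. Qed.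

Lemma gamma_cech n (y : subm (gamma I (E n))) : exists z,
  cochain_d (cech fs (E n)) 0 z = 0 /\ cech_ev fs _ z = val y.
Proof. by apply: cech_ev_ex; apply/gamma_ideal_gen; exact: submP y. Qed.

Lemma cech_ev_coboundary n (y : cech fs (E n) 0%N) (t : gamma_cochain I E n) :
  cochain_d (cech fs (E n)) 0 y = 0 -> val t = cech_ev fs _ y ->
  col_coboundary (cech_rows E) y <-> coboundaries (gamma_cochain I E) n t.
Proof.
case: n y t => [|n] y t dy ty.
  split=> [y0|t0]; first by apply: val_inj; rewrite ty y0 linear0.
  by apply: cech_ev_inj => //; rewrite -ty t0.
split=> [[u [du uy]]|[w wt]].
  exists (mksub (cech_gamma du)); apply: val_inj.
  by rewrite restrE ty -uy cech_ev_map.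
have [u [du uw]] := gamma_cech w.
exists u; split=> //; apply/eqP; rewrite -subr_eq0; apply/eqP/cech_ev_inj.
  by rewrite linearB dy subr0 -(cores_comm (cech_coresolution E)) du linear0.
by rewrite linearB cech_ev_map uw -ty -wt restrE subrr.
Qed.

Definition lcoh_rel n (u : cohomology (cech fs X) (Posz n))
    (v : cohomology (gamma_cochain I E) (Posz n)) :=
  exists z y t, [/\ coclass z u, coclass (t : gamma_cochain I E n) v,
    czigzag (cech_rows E) (eps n z) y, cochain_d (cech fs (E n)) 0 y = 0
    & val t = cech_ev fs _ y].

Lemma lcoh_relP n a u u' v v' : @lcoh_rel n u v -> lcoh_rel u' v' ->
  lcoh_rel (a *: u + u') (a *: v + v').
Proof.
move=> [z [y [t [zu tv zy dy ty]]]] [z' [y' [t' [zu' tv' zy' dy' ty']]]].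
exists (a *: z + z'), (a *: y + y'), (a *: t + t'); split.
- exact: coclassP.
- exact: coclassP.
- by rewrite linearP; exact: czigzagP.
- by rewrite linearP dy dy' scaler0 addr0.
- by rewrite !linearP /= ty ty'.
Qed.

Lemma lcoh_rel_total n u : exists v, @lcoh_rel n u v.
Proof.
have [z zu] := coclass_ex u; have dz := coclass_cocycle zu.
have [||y [zy dy dely]] := czigzag_ex_row (cech_coresolution E) (x := eps n z).
- by rewrite -cochain_fd dz linear0.
- by apply/cech_aug_im; exists z.
pose t : gamma_cochain I E n := mksub (cech_gamma dy).
have [|v tv] := @coclass_of _ _ _ t; last by exists v, z, y, t.
by apply: val_inj; rewrite restrE /= -cech_ev_map [X in cech_ev _ _ X]dely linear0.
Qed.

Lemma lcoh_rel_surj n v : exists u, @lcoh_rel n u v.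
Proof.
have [t tv] := coclass_ex v; have dt := coclass_cocycle tv.
have [y [dy yt]] := gamma_cech t.
have dely : cech_rows E n 0 y = 0.
  apply: cech_ev_inj.
    by rewrite -(cores_comm (cech_coresolution E)) dy linear0.
  by rewrite cech_ev_map yt; exact: (congr1 val dt).
have [x [xy dx /cech_aug_im [z ez]]] := czigzag_ex_col (cech_coresolution E) dy dely.
have [|u zu] := @coclass_of _ _ _ z.
  by apply: cech_aug_inj; rewrite cochain_fd ez.
by exists u, z, y, t; split=> //; rewrite ez.
Qed.

Lemma lcoh_rel0 n u v : @lcoh_rel n u v -> (u = 0 <-> v = 0).
Proof.
move=> [z [y [t [zu tv zy dy ty]]]].
rewrite (coclass0 zu) (coclass0 tv) cech_aug_coboundary -(cech_ev_coboundary dy ty).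
have res := cech_coresolution E.
by split; [exact: czigzag_row_coboundary res zy|exact: czigzag_col_coboundary res zy].
Qed.
End Resolution.

(** Any lift g of f will do, so naturality also holds for the unspecified lift inside [lcoh_map]. *)
Lemma lcoh_rel_map X Y (f : {linear X -> Y}) (E : inj_resolution X)
    (F : inj_resolution Y) (g : cochain_map E F) n u v :
  (forall x, g 0%N (icoaug E x) = icoaug F (f x)) ->
  @lcoh_rel X E n u v ->
  lcoh_rel (cohomology_map (cech_map fs f) n u)
           (cohomology_map (gamma_cochain_map I g) n v).
Proof.
move=> gf [z [y [t [zu tv zy dy ty]]]].
exists (cech_map fs f n z), (cech_map fs (g n) 0%N y), (gamma_cochain_map I g n t); split.
- exact: coclass_map.
- exact: coclass_map.
- have -> : cech_map fs (icoaug F) n (cech_map fs f n z) =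
      cech_map fs (g 0%N) n (cech_map fs (icoaug E) n z).
    by rewrite -!(@cech_map_comp _ fs _ _ _ _ _ (lcomp (icoaug F) f)).
  apply: (czigzag_map (phi := fun p q => cech_map fs (g p) q)) zy => p q x.
    exact: cochain_fd.
  rewrite /cech_rows -!(@cech_map_comp _ fs _ _ _ _ _ (lcomp (cochain_d F p) (g p))) //.
  by move=> e; rewrite cochain_fd.
- by rewrite -cochain_fd dy linear0.
- by rewrite restrE ty cech_ev_map.
Qed.

Lemma cech_lcoh n : exists chi : forall X,
    {linear cohomology (cech fs X) (Posz n) -> lcoh I (Posz n) X},
  (forall X, bijective (chi X)) /\
  (forall X Y (f : {linear X -> Y}) u,
     chi Y (cohomology_map (cech_map fs f) (Posz n) u) = lcoh_map I (Posz n) f (chi X u)).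
Proof.
pose ex X := linear_relation_bij (@lcoh_relP X (injres X) n)
  (@lcoh_rel_total X (injres X) n) (@lcoh_rel_surj X (injres X) n)
  (@lcoh_rel0 X (injres X) n).
exists (fun X => sval (cid (ex X))); split=> [X|X Y f u].
  by case: cid => /= chi [].
case: (cid (ex X)) => chiX /= [_ hX]; case: (cid (ex Y)) => chiY /= [_ hY].
symmetry; apply/hY; apply: lcoh_rel_map; last exact/hX.
exact: svalP (cid (inj_lift_exists (injres X) (injres Y) f)).
Qed.
End Comparison.

(** * Projective modules *)

Section CechCohomology.
Variables (R : comNzRingType) (fs : seq R) (n : nat).
Implicit Types X Y Z : lmodType R.

Lemma coclass_uniq (C : cochain R) k (z : C k) u u' :
  coclass z u -> coclass z u' -> u = u'.
Proof. by move=> h h'; apply/(coclass_eq h h'); rewrite subrr; exact: sm0. Qed.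

Definition cohc X : lmodType R := cohomology (cech fs X) (Posz n).
Definition cohc_map X Y (f : {linear X -> Y}) : {linear cohc X -> cohc Y} :=
  cohomology_map (cech_map fs f) (Posz n).

Lemma cohc_map_lin X Y (a : R) (h g g' : {linear X -> Y}) u :
  (forall x, h x = a *: g x + g' x) -> cohc_map h u = a *: cohc_map g u + cohc_map g' u.
Proof.
move=> e; have [z zu] := coclass_ex u.
apply: (coclass_uniq (coclass_map _ zu)).
by rewrite (cech_map_lin e); apply: coclassP; exact: coclass_map.
Qed.

Lemma cohc_map_comp X Y Z (g : {linear X -> Y}) (h : {linear Y -> Z})
    (gh : {linear X -> Z}) u : (forall x, gh x = h (g x)) ->
  cohc_map gh u = cohc_map h (cohc_map g u).
Proof.
move=> e; have [z zu] := coclass_ex u.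
apply: (coclass_uniq (coclass_map _ zu)).
by rewrite (cech_map_comp e); do 2 apply: coclass_map.
Qed.

Lemma cohc_map_id X (g : {linear X -> X}) u : (forall x, g x = x) -> cohc_map g u = u.
Proof.
move=> e; have [z zu] := coclass_ex u.
by apply: (coclass_uniq (coclass_map _ zu)); rewrite (cech_map_id e).
Qed.
End CechCohomology.

Section TensorElements.
Variables (R : comNzRingType) (A M : lmodType R).

(** The projection modulo W and the zero map agree on pure tensors. *)
Lemma tens_ind (W : submod (tensor A M)) :
  (forall x m, W (tens x m)) -> forall t, W t.
Proof.
move=> h t; have : qproj W t = hom_zero _ _ t.
  apply: tens_ext => x m; rewrite -[RHS](linear0 (qproj W)).
  by apply/qprojP; rewrite subr0; exact: h.
by rewrite /= -[RHS](linear0 (qproj W)) => /qprojP; rewrite subr0.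
Qed.

Lemma tensZl (a : R) (x : A) (m : M) : tens (a *: x) m = a *: tens x m.
Proof. by rewrite -[a *: x]addr0 tensPl tens0 addr0. Qed.

Lemma tens0r (x : A) : tens x (0 : M) = 0.
Proof.
by have := tensPr 1 x (0 : M) 0; rewrite scaler0 addr0 scale1r -{1}[tens x 0]addr0 => /addrI.
Qed.

Lemma tensZr (a : R) (x : A) (m : M) : tens x (a *: m) = a *: tens x m.
Proof. by rewrite -[a *: m]addr0 tensPr tens0r addr0. Qed.
End TensorElements.

Section TensorFunctor.
Variables (R : comNzRingType) (M : lmodType R).
Implicit Types X Y Z : lmodType R.

Lemma tmap_comp X Y Z (g : {linear X -> Y}) (h : {linear Y -> Z}) (gh : {linear X -> Z}) t :
  (forall x, gh x = h (g x)) -> tmap M gh t = tmap M h (tmap M g t).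
Proof.
move=> e; apply: (@tens_ext _ _ _ _ (tmap M gh) (lcomp (tmap M h) (tmap M g))) => x m.
change (tmap M gh (tens x m) = tmap M h (tmap M g (tens x m))).
by rewrite !tmapE e.
Qed.

Lemma tmap_id X (g : {linear X -> X}) t : (forall x, g x = x) -> tmap M g t = t.
Proof.
move=> e; apply: (@tens_ext _ _ _ _ (tmap M g) idfun) => x m.
by rewrite tmapE e.
Qed.

Lemma tmap_lin X Y (a : R) (h g g' : {linear X -> Y}) t :
  (forall x, h x = a *: g x + g' x) -> tmap M h t = a *: tmap M g t + tmap M g' t.
Proof.
move=> e; apply: (@tens_ext _ _ _ _ (tmap M h)
  (hom_add (hom_scale a (tmap M g)) (tmap M g'))) => x m.
change (tmap M h (tens x m) = a *: tmap M g (tens x m) + tmap M g' (tens x m)).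
by rewrite !tmapE e tensPl.
Qed.

Lemma tmap0 X Y (f : {linear X -> Y}) t : (forall x, f x = 0) -> tmap M f t = 0.
Proof.
move=> e; apply: (@tens_ext _ _ _ _ (tmap M f) (hom_zero _ _)) => x m.
by rewrite tmapE e tens0.
Qed.
End TensorFunctor.

Section FreeCoordinates.
Variables (R : comNzRingType) (S : choiceType).
Local Notation F := {malg R[S]}.

Fact coord_linear (t : S) : linear (fun x : F => x@_t : R^o).
Proof. by move=> a x y; rewrite mcoeffD mcoeffZ. Qed.
Definition coord t : {linear F -> R^o} := mklin (coord_linear t).

Fact mulby_linear (X : lmodType R) (x : X) : linear (fun r : R^o => (r : R) *: x).
Proof. by move=> a r s; rewrite scalerDl -scalerA. Qed.
Definition mulby (X : lmodType R) (x : X) : {linear R^o -> X} := mklin (mulby_linear x).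

Fixpoint coord_sum (d : seq S) : {linear F -> F} :=
  if d is t :: d' then hom_add (lcomp (mulby << t >>) (coord t)) (coord_sum d')
  else hom_zero _ _.

Lemma coord_sumE d x s : uniq d -> (coord_sum d x)@_s = if s \in d then x@_s else 0.
Proof.
elim: d => [_|t d ih /= /andP[td ud]]; first by rewrite mcoeff0.
rewrite mcoeffD mcoeffZ mcoeffU ih // inE.
have [<-|st] := eqVneq t s; first by rewrite (negPf td) /= mulr1 addr0.
by rewrite mulr0 add0r.
Qed.

(** Duplicates are removed because [coord_sum] adds a coordinate once per occurrence. *)
Definition coord_proj (d : seq S) := coord_sum (undup d).

Lemma coord_projE d x s : (coord_proj d x)@_s = if s \in d then x@_s else 0.
Proof. by rewrite coord_sumE ?undup_uniq // mem_undup. Qed.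

Lemma coord_proj_dir d d' : exists e,
  (forall x, coord_proj e (coord_proj d x) = coord_proj d x) /\
  (forall x, coord_proj e (coord_proj d' x) = coord_proj d' x).
Proof.
exists (d ++ d'); split=> x; apply/malgP => s; rewrite !coord_projE mem_cat;
  by case: (s \in d) => //=; case: (s \in d').
Qed.

Lemma coord_proj_loc x : exists d, coord_proj d x = x.
Proof.
exists (msupp x); apply/malgP => s; rewrite coord_projE.
by case: ifP => // /negbT /mcoeff_outdom.
Qed.
End FreeCoordinates.
Arguments coord {R S} t.
Arguments coord_sum {R S} d.
Arguments coord_proj {R S} d.

(** * The natural map from the tensor product of X and H^c(K(R)) to H^c(K(X)) *)

Section Theta.
Variables (R : comNzRingType) (fs : seq R) (c : nat) (H : lmodType R).
Variable chi : {linear H -> cohc fs c R^o}.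
Hypothesis chi_bij : bijective chi.
Implicit Types X Y : lmodType R.

Fact theta_l X (h : H) : linear (fun x : X => cohc_map fs c (mulby x) (chi h)).
Proof.
by move=> a x y; apply: cohc_map_lin => r /=; rewrite scalerDr !scalerA mulrC.
Qed.
Fact theta_r X (x : X) : linear (fun h : H => cohc_map fs c (mulby x) (chi h)).
Proof. by move=> a h h'; rewrite !linearP. Qed.
(** An element x is a map R -> X, and the tensor of x and h goes to the image of the class of h
    under it. H is kept abstract, identified through [chi], so that it can be the local cohomology
    module itself. *)
Definition theta X : {linear tensor X H -> cohc fs c X} :=
  tlift (@theta_l X) (@theta_r X).

Lemma thetaE X (x : X) (h : H) : theta X (tens x h) = cohc_map fs c (mulby x) (chi h).
Proof. exact: tliftE. Qed.

Lemma theta_map X Y (f : {linear X -> Y}) t :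
  theta Y (tmap H f t) = cohc_map fs c f (theta X t).
Proof.
apply: (@tens_ext _ _ _ _ (lcomp (theta Y) (tmap H f))
  (lcomp (cohc_map fs c f) (theta X))) => x h.
change (theta Y (tmap H f (tens x h)) = cohc_map fs c f (theta X (tens x h))).
by rewrite tmapE !thetaE; apply: cohc_map_comp => r /=; rewrite linearZ_LR.
Qed.

Lemma theta_ring_inj t : theta R^o t = 0 -> t = 0.
Proof.
have [h ->] : exists h, t = tens (1 : R^o) h.
  pose W := imsm (mklin (fun a h h' => tensPr a (1 : R^o) h h') : {linear H -> _}).
  have [|h <-] := @tens_ind _ _ _ W _ t; last by exists h.
  by move=> x h; exists (x *: h); rewrite /= tensZr -tensZl /GRing.scale /= mulr1.
rewrite thetaE cohc_map_id; last by move=> r; exact: mulr1.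
move=> e; have -> : h = 0 by apply: (bij_inj chi_bij); rewrite linear0.
exact: tens0r.
Qed.

Section Free.
Variable S : choiceType.
Local Notation F := ({malg R[S]} : lmodType R).

Lemma cech_free_proj n (z : cech fs F n) : exists d, cech_map fs (coord_proj d) n z = z.
Proof.
exact: (@cech_local _ fs F _ [::] (@coord_proj R S) (@coord_proj_dir R S)
  (@coord_proj_loc R S)).
Qed.

Lemma cech_coord_cons t d n (z : cech fs F n) :
  cech_map fs (coord_sum (t :: d)) n z =
  cech_map fs (mulby << t >>) n (cech_map fs (coord t) n z)
  + cech_map fs (coord_sum d) n z.
Proof.
rewrite -(@cech_map_comp _ fs _ _ _ (coord t) (mulby << t >>)
  (lcomp (mulby << t >>) (coord t))) //.
rewrite -[X in X + _]scale1r; apply: cech_map_lin => x.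
by rewrite scale1r.
Qed.

(** The cochain z lives on finitely many coordinates, and each contributes the image of a cocycle of
    K(R). *)
Lemma cech_free_acyclic n (z : cech fs F n) : (forall u : cohc fs n R^o, u = 0) ->
  cochain_d (cech fs F) n z = 0 -> coboundaries (cech fs F) n z.
Proof.
move=> acyc dz; have [d <-] := cech_free_proj z.
rewrite /coord_proj; elim: (undup d) => [|t e ih].
  by rewrite [X in coboundaries _ _ X]cech_map0 //; exact: sm0.
rewrite cech_coord_cons; apply: smD => //.
have [|u zu] := @coclass_of _ _ _ (cech_map fs (coord t) n z).
  by rewrite -cochain_fd dz linear0.
by apply/(coclass0 (coclass_map (cech_map fs (mulby << t >>)) zu)); rewrite (acyc u) linear0.
Qed.

Lemma theta_free_surj u : exists w, theta F w = u.
Proof.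
have [z zu] := coclass_ex u; have dz := coclass_cocycle zu.
have [d ed] := cech_free_proj z; move: zu; rewrite -ed.
suff [w hw] : exists w, coclass (cech_map fs (coord_proj d) c z) (theta F w).
  by move=> zu; exists w; exact: coclass_uniq hw zu.
rewrite /coord_proj; elim: (undup d) => [|t e [w hw]].
  exists 0; rewrite linear0 cech_map0 // -(scale0r z).
  have [v zv] := coclass_of dz.
  by have := coclassP (-1) zv zv; rewrite !scaleN1r !addNr scale0r.
have [|v zv] := @coclass_of _ _ _ (cech_map fs (coord t) c z).
  by rewrite -cochain_fd dz linear0.
have [g _ chiK] := chi_bij.
exists (tens << t >> (g v) + w); rewrite cech_coord_cons linearD thetaE chiK.
have := coclassP 1 (coclass_map (cech_map fs (mulby << t >>)) zv) hw.
by rewrite !scale1r.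
Qed.

Lemma tens_free_proj (w : tensor F H) : exists d, tmap H (coord_proj d) w = w.
Proof.
have mono d e (w' : tensor F H) :
    (forall x : F, coord_proj e (coord_proj d x) = coord_proj d x) ->
    tmap H (coord_proj d) w' = w' -> tmap H (coord_proj e) w' = w'.
  move=> h <-; symmetry; apply: tmap_comp => x; exact: esym (h x).
pose P w := exists d, tmap H (@coord_proj R S d) w = w.
have P0 : P 0 by exists [::]; rewrite linear0.
have PP a u v : P u -> P v -> P (a *: u + v).
  move=> [d hd] [d' hd']; have [e [ed ed']] := @coord_proj_dir R S d d'.
  by exists e; rewrite linearP (mono d) // (mono d').
apply: (@tens_ind _ _ _ (Submod P0 PP)) => x h.
by have [d hd] := coord_proj_loc x; exists d; rewrite tmapE hd.
Qed.

Lemma theta_free_inj w : theta F w = 0 -> w = 0.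
Proof.
move=> w0; have [d <-] := tens_free_proj w.
rewrite /coord_proj; elim: (undup d) => [|t e ih].
  exact: tmap0.
rewrite (@tmap_lin _ _ _ _ 1 _ (lcomp (mulby << t >>) (coord t)) (coord_sum e)).
  rewrite ih addr0 scale1r.
  have -> : tmap H (lcomp (mulby << t >>) (coord t)) w =
      tmap H (mulby << t >>) (tmap H (coord t) w) by exact: tmap_comp.
  by rewrite (@theta_ring_inj (tmap H (coord t) w)) ?linear0 // theta_map w0 linear0.
by move=> x; rewrite scale1r.
Qed.
End Free.

Section Projective.
Variable P : lmodType R.
Hypothesis P_proj : projective P.

Lemma projective_retract : exists (p : {linear {malg R[P]} -> P}) s,
  forall x, p ((s : {linear P -> {malg R[P]}}) x) = x.
Proof.
have [|s hs] := @P_proj _ _ (free_lift (@id P)) idfun.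
  by move=> y; exists << y >>; exact: free_liftE.
by exists (free_lift id), s.
Qed.

Lemma cech_projective_acyclic n (z : cech fs P n) : (forall u : cohc fs n R^o, u = 0) ->
  cochain_d (cech fs P) n z = 0 -> coboundaries (cech fs P) n z.
Proof.
move=> acyc dz; have [p [s ps]] := projective_retract.
have [|u zu] := @coclass_of _ _ _ (cech_map fs s n z).
  by rewrite -cochain_fd dz linear0.
have u0 : u = 0.
  by apply/(coclass0 zu)/cech_free_acyclic => //; exact: coclass_cocycle zu.
have := coclass_map (cech_map fs p) zu.
rewrite u0 linear0 -(@cech_map_comp _ fs _ _ _ s p idfun) // cech_map_id //.
by case/coclass0 => + _; apply.
Qed.

Lemma theta_projective_bij : bijective (theta P).
Proof.
have [p [s ps]] := projective_retract.
apply: bijectiveP => [w w' e|u].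
  apply/subr0_eq; have {}e : theta P (w - w') = 0 by rewrite linearB e subrr.
  rewrite -(@tmap_id _ H _ idfun (w - w')) // (@tmap_comp _ H _ _ _ s p) //.
  by rewrite [X in tmap _ _ X]theta_free_inj ?linear0 // theta_map e linear0.
have [w hw] := theta_free_surj (cohc_map fs c s u).
by exists (tmap H p w); rewrite theta_map hw -(cohc_map_comp _ (gh := idfun)) // cohc_map_id.
Qed.
End Projective.
End Theta.

(** * Tor as the cohomology of K(X) *)

Section TorResolution.
Variables (R : comNzRingType) (fs : seq R).
Implicit Types X Y : lmodType R.

(** The shift by one puts K(X) in column 0, so that the augmentation becomes an ordinary horizontal
    map. *)
Definition cech_res X (P : chain R) (p : nat) : cochain R :=
  cech fs (if p is p'.+1 then P p' else X).

Definition cech_del X (P : chain R) (aug : {linear P 0%N -> X}) : drows (cech_res X P) :=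
  fun p q => match p return {linear cech_res X P p.+1 q -> cech_res X P p q} with
  | 0%N => cech_map fs aug q
  | p'.+1 => cech_map fs (chain_d P p') q
  end.

Section Fixed.
Variables (c : nat) (H : lmodType R) (chi : {linear H -> cohc fs c R^o}).
Hypothesis chi_bij : bijective chi.
Hypothesis acyc : forall i, i <> c -> forall u : cohc fs i R^o, u = 0.

Variables (X : lmodType R) (P : proj_resolution X).
Local Notation del := (cech_del (paug P)).

Lemma cech_resolution : resolution c (size fs) del.
Proof.
split.
- by case=> [|p] q x; exact: cochain_fd.
- case=> [|p] q x /=; rewrite -(@cech_map_comp _ fs _ _ _ _ _ (hom_zero _ _)) ?cech_map0 //.
    by move=> y; rewrite (pres_exact0 (p := P) _).2 //; exists y.
  by move=> y; rewrite chain_dd.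
- case=> [|p] q x /=; apply: cech_exact => y.
    by move/(pres_exact0 (p := P)).
  by move/(pres_exact (p := P)).
- move=> p q x qc; apply: cech_projective_acyclic; first exact: pres_proj.
  exact: acyc.
- by move=> p q x; exact: cech_bounded.
Qed.

Lemma cech_del_surj q (x : cech fs X q) : exists s, del 0 q s = x.
Proof. by apply: cech_surj; exact: paug_surj. Qed.

Lemma cech_im_coboundary q (x : cech fs X q) :
  im_coboundary del x <-> coboundaries (cech fs X) q x.
Proof.
case: q x => [//|q] x; split=> [[t ht]|[t <-]]; first by exists (del 0 q t).
by have [s <-] := cech_del_surj t; exists s.
Qed.

(** Since [theta] is natural and bijective on projectives, it turns the differential of the tensored
    resolution into the one induced on H^c of the columns. *)
Lemma theta_cycle j (t : tensor (P j) H) (y : cech fs (P j) c) :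
  coclass y (theta chi (P j) t) ->
  cycles (tens_chain H P) j t <-> @row_cycle R _ del j c y.
Proof.
case: j t y => [//|j] t y yt.
have inj := bij_inj (theta_projective_bij chi_bij (@pres_proj _ _ P j)).
split=> [t0|y0].
  apply/(coclass0 (coclass_map (cech_map fs (chain_d P j)) yt)).
  rewrite -[cohomology_map _ _ _]/(cohc_map fs c (chain_d P j) _) -theta_map.
  by rewrite [X in theta _ _ X]t0 linear0.
apply: inj; rewrite linear0 theta_map.
exact/(coclass0 (coclass_map (cech_map fs (chain_d P j)) yt)).
Qed.

Lemma theta_boundary j (t : tensor (P j) H) (y : cech fs (P j) c) :
  coclass y (theta chi (P j) t) ->
  boundaries (tens_chain H P) j t <-> @row_boundary R _ del j c y.
Proof.
move=> yt; split=> [[t' et]|[y' [dy' cy]]].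
  have [y' yt'] := coclass_ex (theta chi (P j.+1) t').
  exists y'; split; first exact: coclass_cocycle yt'.
  apply/(coclass_eq yt (coclass_map (cech_map fs (chain_d P j)) yt')).
  by rewrite -et [LHS]theta_map.
have [w yw] := coclass_of dy'.
have [g _ gK] := theta_projective_bij chi_bij (@pres_proj _ _ P j.+1).
exists (g w).
apply: (bij_inj (theta_projective_bij chi_bij (@pres_proj _ _ P j))).
rewrite [LHS]theta_map gK; symmetry.
exact/(coclass_eq yt (coclass_map (cech_map fs (chain_d P j)) yw)).
Qed.

Lemma tor_vanish_above j (u : homology (tens_chain H P) (Posz j)) : (c < j)%N -> u = 0.
Proof.
move=> cj; have [t tu] := clas_ex u; apply/(clas0 tu).
have [y yt] := coclass_ex (theta chi (P j) t).
apply/(theta_boundary yt).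
apply: (row_boundary_above cech_resolution cj erefl (coclass_cocycle yt)).
by apply/(theta_cycle yt); case: tu.
Qed.
End Fixed.

Section Relation.
Variables (j a : nat).
Local Notation c := (NatTrec.add j a).
Variables (H : lmodType R) (chi : {linear H -> cohc fs c R^o}).
Hypothesis chi_bij : bijective chi.
Hypothesis acyc : forall i, i <> c -> forall u : cohc fs i R^o, u = 0.

Definition tor_rel X (P : proj_resolution X) (u : homology (tens_chain H P) (Posz j))
    (v : cohc fs a X) :=
  exists t (y : cech_res X P j.+1 c) (z : cech_res X P 0%N a),
    [/\ clas t u, coclass y (theta chi (P j) t), coclass z v
      & rzigzag (cech_del (paug P)) z y].

Lemma tor_relP X (P : proj_resolution X) k u u' v v' :
  @tor_rel X P u v -> tor_rel u' v' -> tor_rel (k *: u + u') (k *: v + v').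
Proof.
move=> [t [y [z [tu yt zv zy]]]] [t' [y' [z' [tu' yt' zv' zy']]]].
exists (k *: t + t'), (k *: y + y'), (k *: z + z'); split.
- exact: clasP.
- by rewrite linearP; exact: coclassP.
- exact: coclassP.
- exact: rzigzagP.
Qed.

Section Bijection.
Variables (X : lmodType R) (P : proj_resolution X).
Let res := cech_resolution acyc P.

Lemma tor_rel_total u : exists v, @tor_rel X P u v.
Proof.
have [t tu] := clas_ex u; have [y yt] := coclass_ex (theta chi (P j) t).
have cy : row_cycle (cech_del (paug P)) (y : cech_res X P j.+1 c).
  by apply/(theta_cycle chi_bij yt); case: tu.
have [z [zy dz _]] := rzigzag_ex_col res erefl (coclass_cocycle yt) cy.
by have [v zv] := coclass_of dz; exists v, t, y, z.
Qed.

Lemma tor_rel_surj v : exists u, @tor_rel X P u v.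
Proof.
have [z zv] := coclass_ex v.
have [y [zy dy]] := rzigzag_ex_aug res erefl (coclass_cocycle zv) (cech_del_surj P z).
have [w yw] := coclass_of dy.
have [g _ gK] := theta_projective_bij chi_bij (@pres_proj _ _ P j).
have yt : coclass y (theta chi (P j) (g w)) by rewrite gK.
have [|u tu] := @clas_of _ (tens_chain H P) j (g w).
  by apply/(theta_cycle chi_bij yt); exact: rzigzag_row_cycle zy.
by exists u, (g w), y, z.
Qed.

Lemma tor_rel0 u v : @tor_rel X P u v -> (u = 0 <-> v = 0).
Proof.
move=> [t [y [z [tu yt zv zy]]]].
rewrite (clas0 tu) (coclass0 zv) (theta_boundary chi_bij yt).
rewrite -(cech_im_coboundary P).
split; first exact: rzigzag_row_boundary res erefl zy.
exact: rzigzag_im_coboundary res erefl (coclass_cocycle yt) zy.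
Qed.
End Bijection.

Lemma tor_rel_map X Y (f : {linear X -> Y}) (P : proj_resolution X)
    (Q : proj_resolution Y) (g : chain_map P Q) u v :
  (forall x, paug Q (g 0%N x) = f (paug P x)) ->
  @tor_rel X P u v ->
  tor_rel (homology_map (tens_chain_map H g) (Posz j) u) (cohc_map fs a f v).
Proof.
move=> gf [t [y [z [tu yt zv zy]]]].
pose phi p q : {linear cech_res X P p q -> cech_res Y Q p q} :=
  match p return {linear cech_res X P p q -> cech_res Y Q p q} with
  | 0%N => cech_map fs f q
  | p'.+1 => cech_map fs (g p') q
  end.
exists (tmap H (g j) t), (phi j.+1 _ y), (phi 0%N _ z); split.
- exact: (clas_map (tens_chain_map H g) tu).
- by rewrite theta_map; exact: coclass_map.
- exact: coclass_map.
- apply: rzigzag_map zy => [[|p] q x|[|p] q x].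
  + exact: cochain_fd.
  + exact: cochain_fd.
  + by rewrite /= -!(@cech_map_comp _ fs _ _ _ _ _ (lcomp f (paug P))).
  + rewrite /= -!(@cech_map_comp _ fs _ _ _ _ _ (lcomp (g p) (chain_d P p))) //.
    by move=> e; rewrite [LHS]chain_fd.
Qed.

Lemma tor_cohc : exists phi : forall X, {linear tor (Posz j) X H -> cohc fs a X},
  (forall X, bijective (phi X)) /\
  (forall X Y (f : {linear X -> Y}) u,
     phi Y (tor_map (Posz j) H f u) = cohc_map fs a f (phi X u)).
Proof.
pose ex X := linear_relation_bij (@tor_relP X (projres X)) (@tor_rel_total X (projres X))
  (@tor_rel_surj X (projres X)) (@tor_rel0 X (projres X)).
exists (fun X => sval (cid (ex X))); split=> [X|X Y f u].
  by case: cid => /= phi [].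
case: (cid (ex X)) => phiX /= [_ hX]; case: (cid (ex Y)) => phiY /= [_ hY].
symmetry; apply/hY; apply: tor_rel_map; last exact/hX.
exact: svalP (cid (proj_lift_exists (projres X) (projres Y) f)).
Qed.
End Relation.
End TorResolution.

(** * Grade *)

Section ZeroDivisors.
Variable R : comNzRingType.
Hypothesis noeth : noetherian R.
Implicit Types I J : ideal R.

Lemma idealM J (a b : R) : J b -> J (a * b).
Proof. by move=> Jb; exact: (@smZ _ _ J a b). Qed.

Variable J : ideal R.

Definition colon (a : R) : ideal R := presm (@mulby R R^o a) J.

(** For such a, the colon ideal (J : a) is an associated prime of R/J. *)
Definition max_colon (a : R) := ~ J a /\ forall b : R, ~ J b ->
  (forall x : R, J (x * a) -> J (x * b)) -> forall x : R, J (x * b) -> J (x * a).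

Lemma max_colon_above (a : R) : ~ J a ->
  exists b, max_colon b /\ forall x : R, J (x * a) -> J (x * b).
Proof.
move=> Ja.
have [|K [[b [Jb ab ->]] Kmax]] := @ideal_max _ noeth
  (fun K => exists b : R, [/\ ~ J b, forall x : R, J (x * a) -> J (x * b) & K = colon b]).
  by exists (colon a), a.
exists b; split=> //; split=> // b' Jb' bb'.
apply: (Kmax (colon b')); last exact: bb'.
by exists b'; split=> // x /ab /bb'.
Qed.

(** The ideal (J : ua) contains (J : a), hence equals it by maximality, and v lies in the former. *)
Lemma max_colon_prime (a u v : R) : max_colon a -> J (u * v * a) -> ~ J (u * a) -> J (v * a).
Proof.
move=> [Ja amax] uva ua; apply: (amax (u * a) ua).
  by move=> x xa; rewrite mulrCA; exact: idealM.
by rewrite mulrA [v * u]mulrC.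
Qed.

(* The usual proof (I lies in the union of the finitely many associated primes
   of R/J, hence in one of them) condensed into one maximality argument: the ideal
   W stands for J plus the annihilated elements of the primes already avoided by f. *)
Lemma zero_divisors_common_annihilated (I : ideal R) :
  (forall x : R, I x -> exists a : R, ~ J a /\ J (x * a)) ->
  exists y : R, ~ J y /\ forall x : R, I x -> J (x * y).
Proof.
move=> zd; apply: contrapT => no.
have hg (y : R) : ~ J y -> exists g : R, I g /\ ~ J (g * y).
  move=> Jy; apply: contrapT => no'; apply: no; exists y; split=> // x Ix.
  by apply: contrapT => xy; apply: no'; exists x.
(* [inv W f] says that f lies in I and that no maximal colon ideal (J : y) containing f contains (J
   : W). *)
pose inv (W : ideal R) (f : R) := I f /\ forall y : R, max_colon y -> J (f * y) ->
  exists h : R, (forall w : R, W w -> J (h * w)) /\ ~ J (h * y).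
have [|W [[f [If hf]] Wmax]] := @ideal_max _ noeth (fun W => exists f, inv W f).
  exists J, 0; split; first exact: sm0.
  by move=> y [Jy _] _; exists 1; split=> [w|]; rewrite mul1r.
have [a [Ja fa]] := zd f If.
have [y [ymax /(_ f fa) fy]] := max_colon_above Ja.
have [h [hW hy]] := hf y ymax fy.
have [g [Ig gy]] := hg y ymax.1.
(* As f lies in the prime (J : y) while h and g do not, [f'] avoids it. *)
pose f' := f + h * g.
have f'y : ~ J (f' * y).
  move=> f'y; apply: gy; apply: (max_colon_prime ymax) hy.
  have -> : h * g * y = f' * y - f * y by rewrite /f' mulrDl addrAC subrr add0r.
  exact: smB.
(* Maximality of W would then put y in W, and h * y in J, against the choice of h. *)
suff invW : inv (adjoin W (y : R^o)) f'.
  apply: hy; apply: hW.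
  apply: (Wmax (adjoin W (y : R^o))); [by exists f'| |exact: adjoin_gen].
  by move=> x; exact: adjoin_incl.
split; first by apply: smD => //; exact: idealM.
move=> y' y'max f'y'.
have [h1 [h1W h1y']] : exists h1 : R, (forall w : R, W w -> J (h1 * w)) /\ ~ J (h1 * y').
  have [hy'|] := pselect (J (h * y')); last by exists h.
  apply: hf => //.
  have -> : f * y' = f' * y' - g * (h * y').
    by rewrite /f' mulrDl mulrA [g * h]mulrC addrK.
  by apply: smB => //; exact: idealM.
(* Otherwise (J : y) would lie in (J : y'), hence equal it by maximality, and [f'] would lie in (J :
   y). *)
have [k [ky ky']] : exists k : R, J (k * y) /\ ~ J (k * y').
  apply: contrapT => nok; apply: f'y; apply: (ymax.2 y' y'max.1) => // x xy.
  by apply: contrapT => xy'; apply: nok; exists x.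
exists (h1 * k); split; last first.
  by move=> h1ky'; apply: ky'; exact: (max_colon_prime y'max h1ky' h1y').
move=> _ [w [r [Ww ->]]].
have -> : h1 * k * (w + r *: (y : R^o)) = k * (h1 * w) + h1 * r * (k * y).
  rewrite mulrDr -[r *: _]/(r * y); congr (_ + _); first by rewrite mulrCA mulrA.
  by rewrite !mulrA; congr (_ * _); rewrite -!mulrA [k * r]mulrC.
by apply: smD; apply: idealM => //; exact: h1W.
Qed.
End ZeroDivisors.

(** * Reduction modulo a regular element *)

Section GradeStep.
Variables (R : comNzRingType) (fs : seq R).
Hypothesis noeth : noetherian R.
Let I : ideal R := ideal_gen fs.
Implicit Types X Y : lmodType R.

Lemma lcoh_ptors X n (x : R) (v : lcoh I (Posz n) X) : I x -> ptors x v.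
Proof.
move=> Ix; have [t tv] := coclass_ex v.
have [N hN] := submP (t : subm (gamma I (injres X n))).
exists N; have tN : x ^+ N *: t = 0.
  by apply: val_inj; rewrite linearZ_LR; exact: (killed_expr Ix hN).
have := coclassP (x ^+ N - 1) tv tv; rewrite !scalerBl !scale1r !subrK tN.
by move/coclass0 => [_]; apply; exact: sm0.
Qed.

Lemma cohc_ptors X n (x : R) (u : cohc fs n X) : I x -> ptors x u.
Proof.
move=> Ix; have [chi [bij _]] := cech_lcoh noeth fs n.
have [N hN] := lcoh_ptors (chi X u) Ix.
by exists N; apply: (bij_inj (bij X)); rewrite linear0 linearZ_LR.
Qed.

Lemma cech_map_scale X (f : {linear X -> X}) (a : R) n (z : cech fs X n) :
  (forall y, f y = a *: y) -> cech_map fs f n z = a *: z.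
Proof.
move=> e; rewrite (@cech_map_lin _ fs _ _ a f idfun (hom_zero _ _)).
  by rewrite cech_map_id // cech_map0 // addr0.
by move=> y; rewrite e /= addr0.
Qed.

Variables (X Y : lmodType R) (x : R) (f : {linear X -> X}) (g : {linear X -> Y}).
Hypothesis Ix : I x.
Hypothesis fE : forall y, f y = x *: y.
Hypothesis f_inj : forall y, f y = 0 -> y = 0.
Hypothesis g_surj : forall y, exists w, g w = y.
Hypothesis gf : forall y, g (f y) = 0.
Hypothesis fg : forall y, g y = 0 -> exists w, f w = y.

Let K := cech_map fs.

Lemma cech_regular_inj n (z : cech fs X n) : x *: z = 0 -> z = 0.
Proof. by rewrite -(cech_map_scale _ fE); exact: cech_inj. Qed.

Lemma cech_gf n (z : cech fs X n) : K g n (x *: z) = 0.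
Proof.
rewrite -(cech_map_scale _ fE) /K.
by rewrite -(@cech_map_comp _ fs _ _ _ f g (hom_zero _ _)) ?cech_map0.
Qed.

Lemma cech_fg n (z : cech fs X n) : K g n z = 0 -> exists w, x *: w = z.
Proof.
by move=> /(cech_exact fg) [w <-]; exists w; rewrite (cech_map_scale _ fE).
Qed.

(** The image of w in K(Y) is a cocycle in a degree where the cohomology vanishes; lifting a
    primitive of it to K(X) corrects w by a coboundary. *)
Lemma cech_cocycle_lift i n (w : cech fs X i) :
  (forall i, (i < n)%N -> forall u : cohc fs i Y, u = 0) -> (i.+1 < n.+1)%N ->
  K g i.+1 (cochain_d (cech fs X) i w) = 0 ->
  exists w', K g i w' = 0 /\ cochain_d (cech fs X) i w' = cochain_d (cech fs X) i w.
Proof.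
move=> vY lin e.
have [|v wv] := @coclass_of _ (cech fs Y) i (K g i w); first by rewrite -cochain_fd.
have := (coclass0 wv).1 (vY i lin v); clear v wv lin.
case: i w e => [|i] w e; first by exists w.
move=> [t et]; have [t' et'] := cech_surj g_surj t.
exists (w - cochain_d (cech fs X) i t'); split.
  by rewrite linearB /K cochain_fd et' et subrr.
by rewrite linearB cochain_dd subr0.
Qed.

(** Vanishing for Y one degree lower makes x injective on the cohomology of K(X), while every class
    there is killed by a power of x. *)
Lemma regular_vanish n : (forall i, (i < n)%N -> forall u : cohc fs i Y, u = 0) ->
  forall i, (i < n.+1)%N -> forall u : cohc fs i X, u = 0.
Proof.
move=> vY i lin u.
have inj (v : cohc fs i X) : x *: v = 0 -> v = 0.
  move=> xv; have [z zv] := coclass_ex v; apply/(coclass0 zv).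
  have xzv : coclass (x *: z) (x *: v).
    by have := coclassP (x - 1) zv zv; rewrite !scalerBl !scale1r !subrK.
  have := (coclass0 xzv).1 xv; have dz := coclass_cocycle zv.
  clear v xv zv xzv u; case: i lin z dz => [|i] lin z dz; first exact: cech_regular_inj.
  move=> [w dw].
  have [|w' [gw' dw']] := cech_cocycle_lift (w := w) vY lin.
    by rewrite dw cech_gf.
  have [s es] := cech_fg gw'; exists s.
  apply/eqP; rewrite -subr_eq0; apply/eqP/cech_regular_inj.
  by rewrite scalerBr -linearZ_LR es dw' dw subrr.
have [N] := cohc_ptors u Ix.
elim: N => [|N ih]; first by rewrite expr0 scale1r.
by rewrite exprS -scalerA => /inj.
Qed.

(** The connecting map from degree n of Y to degree n + 1 of X is chased on elements; it is
    injective because the cohomology of K(X) vanishes in degree n. *)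
Lemma regular_nonzero n : (forall i, (i < n)%N -> forall u : cohc fs i Y, u = 0) ->
  (exists u : cohc fs n Y, u <> 0) -> exists u : cohc fs n.+1 X, u <> 0.
Proof.
move=> vY [u u0]; have [z zu] := coclass_ex u.
have [z' ez'] := cech_surj g_surj z.
have [|s es] := @cech_fg _ (cochain_d (cech fs X) n z').
  by rewrite /K cochain_fd ez'; exact: coclass_cocycle zu.
have ds : cochain_d (cech fs X) n.+1 s = 0.
  by apply: cech_regular_inj; rewrite -linearZ_LR es cochain_dd.
have [v sv] := coclass_of ds; exists v => /(coclass0 sv) [t et].
apply/u0/(coclass0 zu).
have [|w zw] := @coclass_of _ _ _ (z' - x *: t).
  by rewrite linearB linearZ_LR et es subrr.
have w0 : w = 0 by exact: (regular_vanish vY (ltnSn n)).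
have := coclass_map (cech_map fs g) zw; rewrite w0 linear0 => /coclass0 [+ _] => /(_ erefl).
by rewrite linearB ez' [X in _ - X]cech_gf subr0.
Qed.
End GradeStep.

(** * Nonvanishing in the degree of the grade *)

Section GradeNonvanishing.
Variables (R : comNzRingType) (fs : seq R).
Hypothesis noeth : noetherian R.
Let I : ideal R := ideal_gen fs.
Hypothesis I_proper : ~ I 1.
Variables (s : seq R).
Hypothesis s_reg : regular_seq s.
Hypothesis s_I : forall x, x \in s -> I x.
Hypothesis s_max : forall s' : seq R, regular_seq s' -> (forall x : R, x \in s' -> I x) ->
  (size s' <= size s)%N.

(** An element of I regular modulo s could be appended to s, so I consists of zero divisors modulo
    s. *)
Lemma maximal_regular_annihilated : exists y : R, ~ ideal_gen s y /\
  forall x : R, I x -> ideal_gen s (x * y).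
Proof.
apply: zero_divisors_common_annihilated => // x Ix.
apply: contrapT => no.
have : (size (rcons s x) <= size s)%N; last by rewrite size_rcons ltnn.
apply: s_max; last first.
  by move=> y; rewrite mem_rcons inE => /orP[/eqP ->//|]; exact: s_I.
split; last first.
  have gen (a : R) : ideal_gen (rcons s x) a -> I a.
    move=> ha; apply: (span_min (W := I) _ ha) => y.
    by rewrite /mkset mem_rcons inE => /orP[/eqP ->//|]; exact: s_I.
  by move=> h; apply: I_proper; exact: gen h.
move=> i; rewrite size_rcons ltnS leq_eqVlt => /orP[/eqP ->|si] a.
  rewrite nth_rcons ltnn eqxx -cats1 take_size_cat // => xa.
  by apply: contrapT => na; apply: no; exists a.
rewrite nth_rcons si -cats1 take_cat si.
exact: s_reg.1.
Qed.

Let M k : lmodType R := quotm (ideal_gen (take k s)).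

(** The induction removes the terms of s from the end, from R/(s) at n = 0 to R/0 at n = [size s].
    At the start, the class of an element annihilated by I gives a nonzero H^0. *)
Lemma regular_quotient_cohc n : (n <= size s)%N ->
  (forall i, (i < n)%N -> forall u : cohc fs i (M (size s - n)), u = 0) /\
  exists u : cohc fs n (M (size s - n)), u <> 0.
Proof.
elim: n => [_|n ih ns].
  split=> //; rewrite subn0.
  have [y [sy Iy]] := maximal_regular_annihilated.
  pose q : M (size s) := qproj _ (y : R^o).
  have [f ffs|z [dz evz]] := @cech_ev_ex R fs (M (size s)) q.
    exists 1%N; rewrite expr1 -linearZ_LR -(linear0 (qproj _)); apply/qprojP.
    by rewrite subr0 take_size; apply: Iy; exact: ideal_gen_mem.
  have [u zu] := coclass_of dz; exists u => /(coclass0 zu) z0.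
  apply: sy; rewrite -(take_size s) -[y]subr0; apply/qprojP.
  by rewrite -[LHS]evz z0 !linear0.
have [vY nY] := ih (ltnW ns).
set k := (size s - n.+1)%N; have kS : (size s - n)%N = k.+1 by rewrite subnSK.
have ks : (k < size s)%N by rewrite -kS leq_subr.
rewrite kS in vY nY.
pose x := s`_k.
have Ix : I x by apply: s_I; exact: mem_nth.
pose f : {linear M k -> M k} := hom_scale x (idfun : {linear M k -> M k}).
have adj a : ideal_gen (take k.+1 s) a <-> adjoin (ideal_gen (take k s)) (x : R^o) a.
  by apply: ideal_gen_adjoin => y; rewrite (take_nth 0) // mem_rcons.
have incl a : ideal_gen (take k s) a -> ideal_gen (take k.+1 s) (idfun a).
  by move=> h; apply/adj; exact: adjoin_incl.
pose g : {linear M k -> M k.+1} := qmap incl.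
have fE a : f (qproj _ a) = qproj _ (x *: a) by rewrite linearZ_LR.
have gE a : g (qproj _ a) = qproj _ a by exact: qmapE.
have q0 l (a : R^o) : qproj (ideal_gen (take l s)) a = 0 <-> ideal_gen (take l s) a.
  by rewrite -(linear0 (qproj _)) qprojP subr0.
have f_inj y : f y = 0 -> y = 0.
  by have [a <-] := qproj_surj y; rewrite fE => /q0 xa; apply/q0; exact: s_reg.1 xa.
have g_surj y : exists w, g w = y.
  by have [a <-] := qproj_surj y; exists (qproj _ a); exact: gE.
have gf y : g (f y) = 0.
  have [a <-] := qproj_surj y; rewrite fE gE; apply/q0/adj.
  exists 0, a; split; first exact: sm0.
  by rewrite add0r [RHS]mulrC.
have fg y : g y = 0 -> exists w, f w = y.
  have [a <-] := qproj_surj y; rewrite gE => /q0 /adj [w [r [hw ->]]].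
  exists (qproj _ (r : R^o)); rewrite fE; apply/qprojP.
  have -> : x *: (r : R^o) - (w + r *: (x : R^o)) = - w.
    by rewrite opprD addrCA -[x *: _]mulrC subrr addr0.
  exact: smN.
split; last exact: (regular_nonzero noeth Ix (f := f) (g := g)).
exact: (regular_vanish noeth Ix (f := f) (g := g)).
Qed.

Lemma grade_cohc_nonzero : exists u : cohc fs (size s) R^o, u <> 0.
Proof.
have [_ [u u0]] := regular_quotient_cohc (leqnn _).
rewrite subnn in u u0.
apply: contrapT => no; apply: u0.
have z0 a : ideal_gen (take 0 s) a -> (idfun : {linear R^o -> R^o}) a = 0.
  by rewrite take0; apply: (span_min (W := zero_submod R^o)).
(* The identity of R/0 factors through R, so a nonzero class over R/0 gives one over R. *)
rewrite -[LHS](@cohc_map_id _ fs _ _ (lcomp (qproj _) (qlift z0))).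
  rewrite (@cohc_map_comp _ fs _ _ _ _ (qlift z0) (qproj _)) //.
  rewrite [X in cohc_map _ _ _ X](_ : _ = 0) ?linear0 //.
  by apply: contrapT => h; apply: no; eexists; exact: h.
move=> y; have [a <-] := qproj_surj y.
change (qproj (ideal_gen (take 0 s)) (qlift z0 (qproj _ a)) = qproj _ a).
by rewrite qliftE.
Qed.
End GradeNonvanishing.

(** * The isomorphisms *)

Section Curry.
Variables (R : comNzRingType) (M E : lmodType R).
Implicit Types A B : lmodType R.

Fact uncurry_l A (h : lhom A (lhom M E)) (m : M) : linear (fun x => h x m).
Proof. by move=> a x y; rewrite linearP. Qed.
Fact uncurry_r A (h : lhom A (lhom M E)) (x : A) : linear (fun m => h x m).
Proof. by move=> a m n; rewrite linearP. Qed.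
Definition uncurry A (h : lhom A (lhom M E)) : {linear tensor A M -> E} :=
  tlift (uncurry_l h) (uncurry_r h).
Lemma uncurryE A (h : lhom A (lhom M E)) x m : uncurry h (tens x m) = h x m.
Proof. exact: tliftE. Qed.

Lemma uncurry_lin A a (h h' : lhom A (lhom M E)) t :
  uncurry (a *: h + h') t = a *: uncurry h t + uncurry h' t.
Proof.
apply: (@tens_ext _ _ _ _ (uncurry (a *: h + h'))
  (hom_add (hom_scale a (uncurry h)) (uncurry h'))) => x m.
change (uncurry (a *: h + h') (tens x m) =
  a *: uncurry h (tens x m) + uncurry h' (tens x m)).
by rewrite !uncurryE.
Qed.

Lemma uncurry0 A (t : tensor A M) : uncurry (0 : lhom A (lhom M E)) t = 0.
Proof.
apply: (@tens_ext _ _ _ _ (uncurry 0) (hom_zero _ _)) => x m.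
exact: uncurryE.
Qed.

Lemma uncurry_pre A B (f : {linear A -> B}) (h : lhom B (lhom M E)) t :
  uncurry (hompre _ f h) t = uncurry h (tmap M f t).
Proof.
apply: (@tens_ext _ _ _ _ (uncurry (hompre _ f h)) (lcomp (uncurry h) (tmap M f))) => x m.
change (uncurry (hompre _ f h) (tens x m) = uncurry h (tmap M f (tens x m))).
by rewrite tmapE !uncurryE.
Qed.

Fact curry_r A (g : {linear tensor A M -> E}) (x : A) : linear (fun m => g (tens x m)).
Proof. by move=> a m n; rewrite tensPr linearP. Qed.
Fact curry_l A (g : {linear tensor A M -> E}) :
  linear (fun x => mklin (curry_r g x) : lhom M E).
Proof. by move=> a x y; apply: homP => m; rewrite /= tensPl linearP. Qed.
Definition curry A (g : {linear tensor A M -> E}) : lhom A (lhom M E) :=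
  mklin (curry_l g).
Lemma curryE A (g : {linear tensor A M -> E}) x m : curry g x m = g (tens x m).
Proof. by []. Qed.
Lemma curryK A (g : {linear tensor A M -> E}) t : uncurry (curry g) t = g t.
Proof. by apply: tens_ext => x m; rewrite uncurryE. Qed.
End Curry.

Section ExtDuality.
Variables (R : comNzRingType) (M E : lmodType R).
Hypothesis E_inj : injective_module E.
Variable j : nat.
Local Notation N := (lhom M E).

Section Relation.
Variable P : chain R.

Definition ext_rel (u : cohomology (hom_cochain N P) (Posz j))
    (g : lhom (homology (tens_chain M P) (Posz j)) E) :=
  exists h : lhom (P j) N, coclass (h : hom_cochain N P j) u /\
    forall (t : tens_chain M P j) w, clas t w -> g w = uncurry h t.

Lemma ext_relP a u u' g g' : ext_rel u g -> ext_rel u' g' ->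
  ext_rel (a *: u + u') (a *: g + g').
Proof.
move=> [h [hu hg]] [h' [hu' hg']]; exists (a *: h + h'); split; first exact: coclassP.
by move=> t w tw; rewrite uncurry_lin -(hg _ _ tw) -(hg' _ _ tw).
Qed.

Lemma ext_rel_total u : exists g, ext_rel u g.
Proof.
have [h hu] := coclass_ex u; have dh := coclass_cocycle hu.
have h0 z : presm (subincl (cycles (tens_chain M P) j)) (boundaries (tens_chain M P) j) z ->
    lcomp (uncurry h) (subincl _) z = 0.
  move=> [t' et]; change (uncurry h (subincl _ z) = 0); rewrite -et.
  rewrite -[LHS]uncurry_pre [X in uncurry X](_ : _ = 0); last exact: dh.
  exact: uncurry0.
exists (qlift h0), h; split=> // t w [ht ->].
by rewrite qliftE.
Qed.

(** A functional on homology is one on cycles that vanishes on boundaries. Injectivity of E extends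
    it to all chains, and vanishing on boundaries makes its curried form a cocycle. *)
Lemma ext_rel_surj g : exists u, ext_rel u g.
Proof.
have [|G hG] := @injective_lift _ E _ _ (subincl (cycles (tens_chain M P) j))
  (lcomp g (qproj _)) E_inj.
  by move=> z z0; have -> : z = 0 by [apply: val_inj]; rewrite linear0.
have hc : hompre N (chain_d P j) (curry G) = 0.
  apply: homP => x; apply: homP => m; rewrite hompreE curryE -tmapE.
  have dt : cycles (tens_chain M P) j (tmap M (chain_d P j) (tens x m)).
    by case: (j) x => [//|i] x; exact: (chain_dd (c := tens_chain M P)).
  have := hG (mksub dt); rewrite /subincl /= => ->.
  have -> : qproj (presm (subincl _) (boundaries (tens_chain M P) j)) (mksub dt) = 0.
    by rewrite -(linear0 (qproj _)); apply/qprojP; rewrite subr0; exists (tens x m).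
  by rewrite linear0.
have [u cu] := @coclass_of _ (hom_cochain N P) j (curry G) hc.
exists u, (curry G); split=> // t w [ht ->].
by rewrite curryK; symmetry; exact: (hG (mksub ht)).
Qed.

(** If g = 0, the uncurried cocycle vanishes on cycles, hence factors through the differential by
    injectivity of E; the factor is the required primitive. *)
Lemma ext_rel0 u g : ext_rel u g -> (u = 0 <-> g = 0).
Proof.
move=> [h [hu hg]]; rewrite (coclass0 hu); split.
  move=> ch; apply: homP => w; have [t tw] := clas_ex w; rewrite (hg _ _ tw).
  suff -> : uncurry h t = 0 by [].
  case: tw => ht _; move: t ht h ch {u g w hu hg}.
  case: (j) => [|i] t ht h; first by move=> ->; exact: uncurry0.
  by move=> [h' <-]; rewrite uncurry_pre [X in uncurry _ X]ht linear0.
move=> g0; have h0 t : cycles (tens_chain M P) j t -> uncurry h t = 0.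
  by move=> /clas_of [w tw]; rewrite -(hg _ _ tw) g0.
case: (j) h h0 {u g hu hg g0} => [|i] h h0.
  by apply: homP => x; apply: homP => m; rewrite -uncurryE h0.
have [|G hG] := @injective_lift _ E _ _ (tmap M (chain_d P i)) (uncurry h) E_inj.
  exact: h0.
exists (curry G); apply: homP => x; apply: homP => m.
by rewrite hompreE curryE -tmapE hG uncurryE.
Qed.
End Relation.

Lemma ext_rel_map (P Q : chain R) (f : chain_map P Q) u g : @ext_rel Q u g ->
  ext_rel (cohomology_map (hom_cochain_map N f) (Posz j) u)
          (hompre E (homology_map (tens_chain_map M f) (Posz j)) g).
Proof.
move=> [h [hu hg]]; exists (hompre N (f j) h); split.
  exact: (coclass_map (hom_cochain_map N f) hu).
move=> t w tw; rewrite hompreE uncurry_pre.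
exact: hg (clas_map (tens_chain_map M f) tw).
Qed.
End ExtDuality.

Section ZeroMaps.
Variable R : comNzRingType.

Lemma hom_zero_bij (A B : lmodType R) : (forall x : A, x = 0) -> (forall y : B, y = 0) ->
  bijective (hom_zero A B).
Proof.
move=> A0 B0; exists (fun=> 0) => x; first by rewrite [RHS]A0.
by rewrite [RHS]B0.
Qed.

Lemma linear_inverse (A B : lmodType R) (f : {linear A -> B}) : bijective f ->
  exists g : {linear B -> A}, cancel f g /\ cancel g f.
Proof.
move=> [g fK gK].
have glin : linear g by move=> a x y; apply: (can_inj fK); rewrite linearP !gK.
by exists (mklin glin).
Qed.
End ZeroMaps.

Lemma ext_tor_duality (R : comNzRingType) (M E : lmodType R) (k : int) :
  injective_module E -> exists rho : forall X : lmodType R,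
    {linear ext k X (lhom M E) -> lhom (tor k X M) E},
  (forall X, bijective (rho X)) /\
  (forall (X Y : lmodType R) (f : {linear X -> Y}) e,
     rho X (ext_map k (lhom M E) f e) = hompre E (tor_map k M f) (rho Y e)).
Proof.
move=> E_inj; case: k => [j|j]; last first.
  exists (fun X => hom_zero _ _); split=> [X|X Y f e]; last by apply: homP.
  apply: hom_zero_bij => [x|g]; first exact: zero_module_eq0.
  by apply: homP => x; rewrite [x]zero_module_eq0 linear0.
pose ex X := linear_relation_bij (@ext_relP _ M E j (projres X))
  (@ext_rel_total _ M E j (projres X)) (ext_rel_surj E_inj (j := j) (P := projres X))
  (ext_rel0 E_inj (j := j) (P := projres X)).
exists (fun X => sval (cid (ex X))); split=> [X|X Y f e].
  by case: cid => /= rho [].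
case: (cid (ex X)) => rhoX /= [_ hX]; case: (cid (ex Y)) => rhoY /= [_ hY].
by symmetry; apply/hX; apply: ext_rel_map; exact/hY.
Qed.

Section MainIsomorphism.
Variables (R : comNzRingType) (noeth : noetherian R) (fs : seq R).
Let I : ideal R := ideal_gen fs.
Variables (c : nat) (H : lmodType R) (chi : {linear H -> cohc fs c R^o}).
Hypothesis chi_bij : bijective chi.
Hypothesis acyc : forall i, i <> c -> forall u : cohc fs i R^o, u = 0.

(** As [del] is onto K(X), [resolution_vanish] applies to every cocycle. This settles the indices at
    which Tor has negative degree. *)
Lemma lcoh_vanish_above a (X : lmodType R) (v : lcoh I (Posz a) X) : (c < a)%N -> v = 0.
Proof.
move=> ca; have [psi [bij _]] := cech_lcoh noeth fs a.
have [g _ gK] := bij X; rewrite -[LHS]gK.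
suff -> : g v = 0 by rewrite linear0.
have [z zv] := coclass_ex (g v); apply/(coclass0 zv).
apply/(cech_im_coboundary (projres X)).
have [s es] := cech_del_surj (projres X) z; rewrite -es.
apply: (resolution_vanish (cech_resolution acyc (projres X)) ca).
by rewrite es; exact: coclass_cocycle zv.
Qed.

Lemma tor_lcoh (k i : int) : c%:Z = k + i ->
  exists phi : forall X : lmodType R, {linear tor k X H -> lcoh I i X},
  (forall X, bijective (phi X)) /\
  (forall (X Y : lmodType R) (f : {linear X -> Y}) t,
     phi Y (tor_map k H f t) = lcoh_map I i f (phi X t)).
Proof.
have zero (k' i' : int) : (forall (X : lmodType R) (t : tor k' X H), t = 0) ->
    (forall (X : lmodType R) (v : lcoh I i' X), v = 0) ->
    exists phi : forall X : lmodType R, {linear tor k' X H -> lcoh I i' X},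
    (forall X, bijective (phi X)) /\
    (forall (X Y : lmodType R) (f : {linear X -> Y}) t,
       phi Y (tor_map k' H f t) = lcoh_map I i' f (phi X t)).
  move=> t0 l0; exists (fun X => hom_zero _ _); split=> [X|X Y f t].
    exact: hom_zero_bij.
  by rewrite /= linear0.
(* A negative i forces k > c, where Tor vanishes; a negative k forces i > c, where local cohomology
   vanishes; both cannot be negative as c >= 0. *)
case: k i => [j|j] [a|a] e.
- have ec : c = NatTrec.add j a.
    by apply/eqP; rewrite NatTrec.addE -eqz_nat e.
  subst c.
  have [phi [bij nat_phi]] := tor_cohc chi_bij acyc.
  have [psi [bij' nat_psi]] := cech_lcoh noeth fs a.
  exists (fun X => lcomp (psi X) (phi X)); split=> [X|X Y f t].
    exact: bij_comp (bij' X) (bij X).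
  rewrite /lcomp /= nat_phi; exact: nat_psi.
- apply: zero => X x; last exact: zero_module_eq0.
  apply: (tor_vanish_above chi_bij acyc (P := projres X)).
  by rewrite -ltz_nat e; case: (a); lia.
- apply: zero => X x; first exact: zero_module_eq0.
  by apply: lcoh_vanish_above; rewrite -ltz_nat e; lia.
- by exfalso; move: e; lia.
Qed.
End MainIsomorphism.

(** The exceptional degree is a priori any integer; nonvanishing in the degree of the grade
    identifies it. *)
Lemma lcoh_acyclic_grade (R : comNzRingType) (noeth : noetherian R) (fs : seq R) (c : nat) :
  let I := ideal_gen fs in
  ~ I 1 -> coh_complete_intersection I -> is_grade I c ->
  forall i, i <> c -> forall u : cohc fs i R^o, u = 0.
Proof.
move=> I I_proper [c' vanish] [[s [s_reg s_I <-]] s_max].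
have vanish' i : Posz i <> c' -> forall u : cohc fs i R^o, u = 0.
  move=> ic u; have [psi [bij _]] := cech_lcoh noeth fs i.
  by apply: (bij_inj (bij R^o)); rewrite linear0; exact: vanish.
have [u u0] := grade_cohc_nonzero noeth I_proper s_reg s_I s_max.
have ec : Posz (size s) = c'.
  by apply: contrapT => sc; apply: u0; exact: vanish'.
by move=> i ic; apply: vanish'; rewrite -ec => -[].
Qed.

Theorem theorem3p1 (R : comNzRingType) (m : ideal R)
    (R_noetherian : noetherian R) (R_local : local_ring m)
    (I : ideal R) (I_proper : ~ I 1) (I_cci : coh_complete_intersection I)
    (c : nat) (I_grade : is_grade I c) (i : int) :
  let H : lmodType R := lcoh I c R^o in
  (exists phi : forall X : lmodType R, {linear tor (c%:Z - i) X H -> lcoh I i X},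
     (forall X, bijective (phi X)) /\
     (forall (X Y : lmodType R) (f : {linear X -> Y}) t,
        phi Y (tor_map (c%:Z - i) H f t) = lcoh_map I i f (phi X t)))
  /\
  (forall (E : lmodType R) (j : {linear quotm m -> E}), injective_hull j ->
   exists psi : forall X : lmodType R,
       {linear ext (c%:Z - i) X (lhom H E) -> lhom (lcoh I i X) E},
     (forall X, bijective (psi X)) /\
     (forall (X Y : lmodType R) (f : {linear X -> Y}) e,
        psi X (ext_map (c%:Z - i) (lhom H E) f e)
        = hompre E (lcoh_map I i f) (psi Y e))).
Proof.
move=> H; have [fs eI] := noetherian_fg R_noetherian I; subst I.
have acyc := lcoh_acyclic_grade R_noetherian I_proper I_cci I_grade.
have [psi [psi_bij _]] := cech_lcoh R_noetherian fs c.
have [chi [chiK psiK]] := linear_inverse (psi_bij R^o).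
have chi_bij : bijective chi by exists (psi R^o).
have ec : c%:Z = (c%:Z - i) + i by rewrite subrK.
have [phi [phi_bij phi_nat]] := tor_lcoh R_noetherian chi_bij acyc ec.
split; first by exists phi.
move=> E j [E_inj _ _].
have [rho [rho_bij rho_nat]] := ext_tor_duality H (c%:Z - i) E_inj.
pose phi' X := sval (cid (linear_inverse (phi_bij X))).
have phiK X : cancel (phi X) (phi' X) by rewrite /phi'; case: cid => g [].
have phi'K X : cancel (phi' X) (phi X) by rewrite /phi'; case: cid => g [].
(* Hom(-, E) reverses arrows, so the inverse of [phi] carries functionals on Tor to functionals on
   local cohomology. *)
exists (fun X => lcomp (hompre E (phi' X)) (rho X)); split=> [X|X Y f e].
  apply: bij_comp (rho_bij X).
  exists (hompre E (phi X)) => g; apply: homP => x; rewrite !hompreE.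
    by rewrite phiK.
  by rewrite phi'K.
apply: homP => v; change (rho X (ext_map (c%:Z - i) (lhom H E) f e) (phi' X v) =
  rho Y e (phi' Y (lcoh_map (ideal_gen fs) i f v))).
rewrite rho_nat hompreE; congr (rho Y e _).
by apply: (can_inj (phiK Y)); rewrite phi_nat !phi'K.
Qed.
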